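(* Let $\chi_1 \pmod{q_1}$ and $\chi_2 \pmod{q_2}$ be primitive Dirichlet characters with $\chi_1\chi_2(-1)=1$ and $q_1q_2>1$, and put $N=q_1q_2$. Let $N=QR$ with $Q,R$ positive integers, $(Q,R)=1$, and assume $q_1\neq 1$ and $q_2\neq R$. Suppose $r,u\in\mathbb{Z}$ with $(r,R)=1$ and $(u,Q)=1$. Then for every $k\in\mathbb{Z}$, $$S_{\chi_1,\chi_2}(\pm 1+Nkur,\ NRku^2)=0$$ (for both choices of sign).
   Context: A primitive character modulo $1$ means the trivial character, $\chi(n)=1$ for all $n$. Let $\psi=\chi_1\overline{\chi_2}$, viewed as a character of $\Gamma_0(N)$ via $\psi\left(\begin{smallmatrix} a&b\\ c&d\end{smallmatrix}\right)=\psi(d)$. Write $e(x)=e^{2\pi i x}$, $\tau(\chi)$ for the Gauss sum, $L(s,\chi)$ for the Dirichlet $L$-function. For $z$ in the upper half-plane define $$F_{\chi_1,\chi_2}(z)=c_1z+c_0+\sum_{n\ge1}\frac{\lambda(n)}{\sqrt n}e(nz),\qquad \lambda(n)=\sum_{ab=n}\chi_1(a)\overline{\chi_2}(b)(b/a)^{1/2},$$ where $c_1=\pi i L(-1,\overline{\chi_2})$ if $q_1=1$ and $c_1=0$ otherwise, and $c_0=\tfrac12L(1,\chi_1)$ if $q_2=1$ and $c_0=0$ otherwise. For $\gamma\in\Gamma_0(N)$ the function $F_{\chi_1,\chi_2}(\gamma z)-\psi(\gamma)F_{\chi_1,\chi_2}(z)$ is independent of $z$; call this constant $\phi_{\chi_1,\chi_2}(\gamma)$,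 and define the newform Dedekind sum $S_{\chi_1,\chi_2}(\gamma)=\frac{\tau(\overline{\chi_1})}{\pi i}\phi_{\chi_1,\chi_2}(\gamma)$. When $q_1\neq1$, $S_{\chi_1,\chi_2}(\gamma)$ depends only on the first column $(a,c)^T$ of $\gamma$, and $S_{\chi_1,\chi_2}(a,c)$ denotes $S_{\chi_1,\chi_2}(\gamma)$ for any $\gamma\in\Gamma_0(N)$ with first column $(a,c)^T$. *)

(* Defs.v *)
From Stdlib Require Import Reals ZArith Znumtheory.
From Coquelicot Require Export Coquelicot.
Open Scope R_scope.

Fixpoint csum (f : nat -> C) (n : nat) : C :=
  match n with O => RtoC 0 | S k => Cplus (csum f k) (f k) end.

Definition CSeries (f : nat -> C) : C :=
  (Series (fun n => Re (f n)), Series (fun n => Im (f n))).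

Definition ZtoC (n : Z) : C := RtoC (IZR n).

(** e(z) = exp(2 pi i z) for complex z. *)
Definition ce (z : C) : C :=
  Cmult (RtoC (exp (- 2 * PI * Im z)))
        (cos (2 * PI * Re z), sin (2 * PI * Re z)).

Definition dirichlet_char (q : Z) (chi : Z -> C) : Prop :=
  (1 <= q)%Z /\
  (forall m n, chi (m * n)%Z = Cmult (chi m) (chi n)) /\
  (forall n, chi (n + q)%Z = chi n) /\
  (forall n, Z.gcd n q = 1%Z -> chi n <> RtoC 0) /\
  (forall n, Z.gcd n q <> 1%Z -> chi n = RtoC 0).

(** Primitive: not induced from any proper divisor d of q, i.e. there is no
    d | q, d < q, with chi(a) = 1 for all a coprime to q and a = 1 mod d.
    (For q = 1 this gives exactly the trivial character.) *)
Definition primitive_char (q : Z) (chi : Z -> C) : Prop :=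
  dirichlet_char q chi /\
  forall d, (1 <= d < q)%Z -> (d | q)%Z ->
    ~ (forall a, Z.gcd a q = 1%Z -> (a mod d = 1 mod d)%Z -> chi a = RtoC 1).

Definition gauss_sum (q : Z) (chi : Z -> C) : C :=
  csum (fun a => Cmult (chi (Z.of_nat (S a)))
                       (ce (RtoC (INR (S a) / IZR q)))) (Z.to_nat q).

Definition L_at_1 (chi : Z -> C) : C :=
  CSeries (fun n => Cdiv (chi (Z.of_nat (S n))) (RtoC (INR (S n)))).

(** L(-1, chi) = - B_{2,chi} / 2 with the generalized Bernoulli number
    B_{2,chi} = q * sum_{a=1}^{q} chi(a) B_2(a/q), B_2(x) = x^2 - x + 1/6. *)
Definition L_at_m1 (q : Z) (chi : Z -> C) : C :=
  Cmult (RtoC (- / 2))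
   (Cmult (ZtoC q)
     (csum (fun a => let x := INR (S a) / IZR q in
              Cmult (chi (Z.of_nat (S a))) (RtoC (x * x - x + / 6)))
           (Z.to_nat q))).

Definition conjchar (chi : Z -> C) : Z -> C := fun n => Cconj (chi n).

Definition lam (chi1 chi2 : Z -> C) (n : nat) : C :=
  csum (fun i => let a := S i in
          if (n mod a =? 0)%nat then
            let b := (n / a)%nat in
            Cmult (Cmult (chi1 (Z.of_nat a)) (Cconj (chi2 (Z.of_nat b))))
                  (RtoC (sqrt (INR b / INR a)))
          else RtoC 0) n.

Definition coef1 (q1 q2 : Z) (chi2 : Z -> C) : C :=
  if Z.eqb q1 1 then Cmult ((0, PI) : C) (L_at_m1 q2 (conjchar chi2)) else RtoC 0.

Definition coef0 (q2 : Z) (chi1 : Z -> C) : C :=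
  if Z.eqb q2 1 then Cmult (RtoC (/ 2)) (L_at_1 chi1) else RtoC 0.

Definition Ffun (q1 q2 : Z) (chi1 chi2 : Z -> C) (z : C) : C :=
  Cplus (Cplus (Cmult (coef1 q1 q2 chi2) z) (coef0 q2 chi1))
   (CSeries (fun m => let n := S m in
      Cmult (Cdiv (lam chi1 chi2 n) (RtoC (sqrt (INR n))))
            (ce (Cmult (RtoC (INR n)) z)))).

Definition mobius (a b c d : Z) (z : C) : C :=
  Cdiv (Cplus (Cmult (ZtoC a) z) (ZtoC b)) (Cplus (Cmult (ZtoC c) z) (ZtoC d)).

Definition psi (chi1 chi2 : Z -> C) (d : Z) : C :=
  Cmult (chi1 d) (Cconj (chi2 d)).

(** phi(gamma) = F(gamma z) - psi(gamma) F(z), evaluated at the point z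
    (this is independent of z in the upper half plane). *)
Definition phi_at (q1 q2 : Z) (chi1 chi2 : Z -> C) (a b c d : Z) (z : C) : C :=
  Cminus (Ffun q1 q2 chi1 chi2 (mobius a b c d z))
         (Cmult (psi chi1 chi2 d) (Ffun q1 q2 chi1 chi2 z)).

Definition dedekindS_at (q1 q2 : Z) (chi1 chi2 : Z -> C) (a b c d : Z) (z : C) : C :=
  Cmult (Cdiv (gauss_sum q1 (conjchar chi1)) ((0, PI) : C))
        (phi_at q1 q2 chi1 chi2 a b c d z).

Definition in_Gamma0 (N a b c d : Z) : Prop := (a * d - b * c = 1)%Z /\ (N | c)%Z.

(* Main.v *)
Require Import Defs.
From Stdlib Require Import Reals ZArith Znumtheory Lra Lia.
From Coquelicot Require Import Coquelicot.

(** Put [s = u R]. A matrix with the given first column fixes the cusp [r/s], up to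
    right multiplication by a translation, and acts as a translation in the
    coordinate [1 / (s z - r)]. Partial fractions of the cotangent turn
    [F(z) = sum_a chi1(a)/a sum_b conj(chi2(b)) e(a b z)], up to a constant, into a
    multiple of the double series over [a] and [y <> 0] of
    [U(a,y) / (a (a w + y))], with [w = q2 (s z - r)], where [U(a,-)] is the discrete
    Fourier transform of [b |-> chi1(a) conj(chi2(b)) e(a b r / s)] modulo [q2 s].
    The terms [y = 0], which carry the growth of [F] at the cusp, are absent because
    [q2 <> R]. Since
    [1/(a (a w + y)) = (1/a - 1/(a + y/w)) / y], the translation of [1/w] by
    [h = +- q1 k u] is undone for each [y] by the substitution [a -> a + h y], which
    leaves [U(-,y)] invariant. Hence [F] is invariant, and [psi = 1] on the matrix. *)

(** * Finite sums and complex limits *)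

(** The double series over [a] and [y] converges only conditionally, and this shapes the proof: the
    [y]-sum has to be taken first to recover [F], whereas the substitution [a -> a + h y] needs the
    [a]-sum first. The exchange rests on tail estimates in [y] that are uniform in the truncation of
    [a]. For these the weight is split into its mean over a period in [y], which does not depend on
    [a], and a part of mean zero: the first is controlled by cancellation in [chi1] (whence
    [q1 <> 1]), the second by cancellation in [y]. The series has only [a > 0], while the
    substitution moves [a] through all integers. Parity closes this gap: since [chi1 chi2(-1) = 1],
    the term at [(a,-y)] equals the term at [(-a,y)], so positive [a] with both signs of [y] becomes
    all [a <> 0] with [y > 0]. The missing [a = 0] has weight zero because [chi1(0) = 0], and the
    parts [1/a] do not depend on [w], so they cancel in the difference of the two values of [F]. *)

Lemma csum_ext (f g : nat -> C) (n : nat) :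
  (forall i, (i < n)%nat -> f i = g i) -> csum f n = csum g n.
Proof.
  induction n as [|n IH]; intros H; simpl; [reflexivity|].
  rewrite IH by (intros; apply H; lia). rewrite H by lia. reflexivity.
Qed.

Lemma csum_zero (f : nat -> C) (n : nat) :
  (forall i, (i < n)%nat -> f i = 0) -> csum f n = 0.
Proof.
  induction n as [|n IH]; intros H; simpl; [reflexivity|].
  rewrite IH by (intros; apply H; lia). rewrite H by lia. ring.
Qed.

Lemma csum_plus (f g : nat -> C) (n : nat) :
  csum (fun i => f i + g i)%C n = (csum f n + csum g n)%C.
Proof. induction n as [|n IH]; simpl; [|rewrite IH]; ring. Qed.

Lemma csum_minus (f g : nat -> C) (n : nat) :
  csum (fun i => f i - g i)%C n = (csum f n - csum g n)%C.
Proof. induction n as [|n IH]; simpl; [|rewrite IH]; ring. Qed.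

Lemma csum_scal (k : C) (f : nat -> C) (n : nat) :
  csum (fun i => k * f i)%C n = (k * csum f n)%C.
Proof. induction n as [|n IH]; simpl; [|rewrite IH]; ring. Qed.

Lemma csum_const (k : C) (n : nat) : csum (fun _ => k) n = (INR n * k)%C.
Proof.
  induction n as [|n IH]; [simpl; ring|].
  change (csum (fun _ => k) n + k = RtoC (INR (S n)) * k)%C.
  rewrite IH, S_INR, RtoC_plus. ring.
Qed.

Lemma csum_swap (f : nat -> nat -> C) (m n : nat) :
  csum (fun i => csum (f i) n) m = csum (fun j => csum (fun i => f i j) m) n.
Proof.
  induction m as [|m IH]; simpl.
  - symmetry; apply csum_zero; reflexivity.
  - rewrite IH, <- csum_plus. reflexivity.
Qed.

Lemma csum_app (f : nat -> C) (m n : nat) :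
  csum f (m + n) = (csum f m + csum (fun i => f (m + i)%nat) n)%C.
Proof.
  induction n as [|n IH]; simpl; [rewrite Nat.add_0_r; ring|].
  rewrite Nat.add_succ_r; simpl. rewrite IH; ring.
Qed.

Lemma csum_S_l (f : nat -> C) (n : nat) :
  csum f (S n) = (f O + csum (fun i => f (S i)) n)%C.
Proof.
  change (S n) with (1 + n)%nat. rewrite csum_app. simpl. ring.
Qed.

Lemma csum_mul (f : nat -> C) (m n : nat) :
  csum f (n * m) = csum (fun k => csum (fun i => f (k * m + i)%nat) m) n.
Proof.
  induction n as [|n IH]; [reflexivity|]. simpl csum at 2.
  replace (S n * m)%nat with (n * m + m)%nat by ring.
  rewrite csum_app, IH. reflexivity.
Qed.

Lemma csum_rev (f : nat -> C) (n : nat) :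
  csum f n = csum (fun i => f (n - 1 - i)%nat) n.
Proof.
  induction n as [|n IH]; [reflexivity|].
  rewrite (csum_S_l (fun i => f (S n - 1 - i)%nat)). simpl csum at 1.
  rewrite IH. replace (S n - 1 - 0)%nat with n by lia.
  rewrite (csum_ext (fun i => f (S n - 1 - S i)%nat) (fun i => f (n - 1 - i)%nat))
    by (intros; f_equal; lia). ring.
Qed.

Lemma csum_single (f : nat -> C) (n j : nat) :
  (j < n)%nat -> (forall i, (i < n)%nat -> i <> j -> f i = 0) ->
  csum f n = f j.
Proof.
  intros Hj H. induction n as [|n IH]; [lia|]. simpl.
  destruct (Nat.eq_dec j n) as [->|Hn].
  - rewrite csum_zero; [ring|]. intros i Hi; apply H; lia.
  - rewrite IH; [|lia|intros; apply H; lia]. rewrite (H n) by lia. ring.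
Qed.

Fixpoint rsum (f : nat -> R) (n : nat) : R :=
  match n with O => 0 | S k => rsum f k + f k end.

Lemma rsum_le (f g : nat -> R) (n : nat) :
  (forall i, (i < n)%nat -> f i <= g i) -> rsum f n <= rsum g n.
Proof.
  induction n as [|n IH]; intros H; simpl; [lra|].
  apply Rplus_le_compat; [apply IH; intros; apply H; lia|apply H; lia].
Qed.

Lemma rsum_scal (k : R) (f : nat -> R) (n : nat) :
  rsum (fun i => k * f i) n = k * rsum f n.
Proof. induction n as [|n IH]; simpl; [|rewrite IH]; ring. Qed.

Lemma rsum_const (k : R) (n : nat) : rsum (fun _ => k) n = INR n * k.
Proof.
  induction n as [|n IH]; [simpl; ring|].
  change (rsum (fun _ => k) n + k = INR (S n) * k).
  rewrite IH, S_INR. ring.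
Qed.

Lemma rsum_tele (g : nat -> R) (n : nat) :
  rsum (fun i => g i - g (S i)) n = g O - g n.
Proof. induction n as [|n IH]; simpl; [|rewrite IH]; ring. Qed.

Lemma csum_norm (f : nat -> C) (n : nat) :
  Cmod (csum f n) <= rsum (fun i => Cmod (f i)) n.
Proof.
  induction n as [|n IH]; simpl; [rewrite Cmod_0; lra|].
  eapply Rle_trans; [apply Cmod_triangle|lra].
Qed.

Lemma csum_norm_le (f : nat -> C) (g : nat -> R) (n : nat) :
  (forall i, (i < n)%nat -> Cmod (f i) <= g i) -> Cmod (csum f n) <= rsum g n.
Proof.
  intros H. eapply Rle_trans; [apply csum_norm|apply rsum_le, H].
Qed.

Lemma csum_norm_const (f : nat -> C) (M : R) (n : nat) :
  (forall i, (i < n)%nat -> Cmod (f i) <= M) -> Cmod (csum f n) <= INR n * M.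
Proof.
  intros H. rewrite <- rsum_const. apply csum_norm_le, H.
Qed.

Lemma Cmod_minus_le (x y : C) : Cmod (x - y) <= Cmod x + Cmod y.
Proof.
  unfold Cminus. eapply Rle_trans; [apply Cmod_triangle|].
  rewrite Cmod_opp; lra.
Qed.

Lemma Cmod_minus_sym (x y : C) : Cmod (x - y) = Cmod (y - x).
Proof. rewrite <- Cmod_opp. f_equal. ring. Qed.

Lemma Cmod_minus_ge (x y : C) : Cmod x - Cmod y <= Cmod (x - y).
Proof.
  assert (H : Cmod x <= Cmod (x - y) + Cmod y).
  { replace x with ((x - y) + y)%C at 1 by ring. apply Cmod_triangle. }
  lra.
Qed.

Lemma Cmod_tri3 (x y z : C) : Cmod (x - z) <= Cmod (x - y) + Cmod (y - z).
Proof.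
  replace (x - z)%C with ((x - y) + (y - z))%C by ring. apply Cmod_triangle.
Qed.

(** Summation by parts. Only the total variation of [h] enters, so oscillation of [g] gives
    estimates where absolute values would diverge. For [n = 0] the truncated [n - 1] is harmless,
    since the left side is zero. *)
Lemma abel_bound (g h : nat -> C) (M : R) (n : nat) :
  (forall m, (m <= n)%nat -> Cmod (csum g m) <= M) ->
  Cmod (csum (fun i => g i * h i)%C n) <=
    M * (Cmod (h (n - 1)%nat) + rsum (fun i => Cmod (h i - h (S i))) (n - 1)).
Proof.
  intros HM.
  assert (M0 : 0 <= M).
  { eapply Rle_trans; [apply Cmod_ge_0|apply (HM O); lia]. }
  assert (H : forall k, (S k <= n)%nat ->
    csum (fun i => g i * h i)%C (S k)
    = (csum g (S k) * h k + csum (fun i => csum g (S i) * (h i - h (S i))) k)%C).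
  { induction k as [|k IH]; intros Hk; [simpl; ring|].
    change (csum (fun i => g i * h i)%C (S (S k)))
      with (csum (fun i => g i * h i)%C (S k) + g (S k) * h (S k))%C.
    rewrite IH by lia.
    change (csum g (S (S k))) with (csum g (S k) + g (S k))%C.
    change (csum (fun i => csum g (S i) * (h i - h (S i)))%C (S k))
      with (csum (fun i => csum g (S i) * (h i - h (S i))) k
             + csum g (S k) * (h k - h (S k)))%C. ring. }
  destruct n as [|n].
  - simpl. rewrite Cmod_0. apply Rmult_le_pos; [exact M0|].
    assert (H0 := Cmod_ge_0 (h 0%nat)). lra.
  - rewrite H by lia. replace (S n - 1)%nat with n by lia.
    eapply Rle_trans; [apply Cmod_triangle|].
    rewrite Rmult_plus_distr_l, Cmod_mult. apply Rplus_le_compat.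
    + apply Rmult_le_compat_r; [apply Cmod_ge_0|apply HM; lia].
    + rewrite <- rsum_scal. apply csum_norm_le. intros i Hi.
      rewrite Cmod_mult. apply Rmult_le_compat_r; [apply Cmod_ge_0|apply HM; lia].
Qed.

(** * Limits of complex sequences *)

Definition ctends (u : nat -> C) (l : C) : Prop :=
  forall eps, 0 < eps ->
    exists N, forall n, (N <= n)%nat -> Cmod (u n - l) < eps.

Lemma ctends_ext (u v : nat -> C) (l : C) :
  (forall n, u n = v n) -> ctends u l -> ctends v l.
Proof.
  intros H Hu eps He. destruct (Hu eps He) as [N HN]. exists N.
  intros n Hn. rewrite <- H. auto.
Qed.

Lemma ctends_const (l : C) : ctends (fun _ => l) l.
Proof.
  intros eps He. exists O. intros n _.
  replace (l - l)%C with (RtoC 0) by ring. rewrite Cmod_0; exact He.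
Qed.

Lemma ctends_plus (u v : nat -> C) (l m : C) :
  ctends u l -> ctends v m -> ctends (fun n => u n + v n)%C (l + m)%C.
Proof.
  intros Hu Hv eps He.
  destruct (Hu (eps / 2)) as [N1 H1]; [lra|].
  destruct (Hv (eps / 2)) as [N2 H2]; [lra|].
  exists (N1 + N2)%nat. intros n Hn.
  replace (u n + v n - (l + m))%C with ((u n - l) + (v n - m))%C by ring.
  eapply Rle_lt_trans; [apply Cmod_triangle|].
  specialize (H1 n ltac:(lia)). specialize (H2 n ltac:(lia)). lra.
Qed.

Lemma ctends_le (u : nat -> C) (l : C) (e : nat -> R) :
  (forall n, Cmod (u n - l) <= e n) -> is_lim_seq e 0 -> ctends u l.
Proof.
  intros H He eps Hp.
  apply is_lim_seq_spec in He. destruct (He (mkposreal eps Hp)) as [N HN].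
  exists N. intros n Hn. specialize (HN n Hn). simpl in HN.
  rewrite Rminus_0_r in HN. eapply Rle_lt_trans; [apply H|].
  eapply Rle_lt_trans; [apply Rle_abs|exact HN].
Qed.

Lemma ctends_bounded (u : nat -> C) (l : C) :
  ctends u l -> exists N, forall n, (N <= n)%nat -> Cmod (u n) <= Cmod l + 1.
Proof.
  intros H. destruct (H 1) as [N HN]; [lra|]. exists N. intros n Hn.
  specialize (HN n Hn). assert (H1 := Cmod_minus_ge (u n) l). lra.
Qed.

Lemma ctends_mult (u v : nat -> C) (l m : C) :
  ctends u l -> ctends v m -> ctends (fun n => u n * v n)%C (l * m)%C.
Proof.
  intros Hu Hv eps He.
  destruct (ctends_bounded u l Hu) as [N0 H0].
  assert (Pl : 0 < Cmod l + 1) by (assert (H := Cmod_ge_0 l); lra).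
  assert (Pm : 0 < Cmod m + 1) by (assert (H := Cmod_ge_0 m); lra).
  destruct (Hu (eps / 2 / (Cmod m + 1))) as [N1 H1].
  { apply Rdiv_lt_0_compat; lra. }
  destruct (Hv (eps / 2 / (Cmod l + 1))) as [N2 H2].
  { apply Rdiv_lt_0_compat; lra. }
  exists (N0 + N1 + N2)%nat. intros n Hn.
  specialize (H0 n ltac:(lia)). specialize (H1 n ltac:(lia)).
  specialize (H2 n ltac:(lia)).
  replace (u n * v n - l * m)%C with (u n * (v n - m) + m * (u n - l))%C by ring.
  eapply Rle_lt_trans; [apply Cmod_triangle|]. rewrite !Cmod_mult.
  apply Rlt_div_r in H1; [|lra]. apply Rlt_div_r in H2; [|lra].
  assert (Q1 := Cmod_ge_0 (v n - m)). assert (Q2 := Cmod_ge_0 (u n - l)).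
  assert (Q3 := Cmod_ge_0 m). assert (Q4 := Cmod_ge_0 (u n)).
  nra.
Qed.

Lemma ctends_scal (k : C) (u : nat -> C) (l : C) :
  ctends u l -> ctends (fun n => k * u n)%C (k * l)%C.
Proof. intros H. apply ctends_mult; [apply ctends_const|exact H]. Qed.

Lemma ctends_minus (u v : nat -> C) (l m : C) :
  ctends u l -> ctends v m -> ctends (fun n => u n - v n)%C (l - m)%C.
Proof.
  intros Hu Hv.
  apply (ctends_ext (fun n => u n + (-(1)) * v n)%C); [intros; ring|].
  replace (l - m)%C with (l + (-(1)) * m)%C by ring.
  apply ctends_plus; [exact Hu|apply ctends_scal, Hv].
Qed.

Lemma ctends_inv (u : nat -> C) (l : C) :
  l <> 0 -> ctends u l -> ctends (fun n => / u n)%C (/ l)%C.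
Proof.
  intros Hl Hu eps He. apply Cmod_gt_0 in Hl as Pl.
  destruct (Hu (Cmod l / 2)) as [N1 H1]; [lra|].
  destruct (Hu (eps * (Cmod l * Cmod l / 2))) as [N2 H2].
  { apply Rmult_lt_0_compat; [lra|]. apply Rdiv_lt_0_compat; nra. }
  exists (N1 + N2)%nat. intros n Hn.
  specialize (H1 n ltac:(lia)). specialize (H2 n ltac:(lia)).
  assert (Pu : Cmod l / 2 < Cmod (u n)).
  { assert (H := Cmod_minus_ge l (u n)). rewrite Cmod_minus_sym in H. lra. }
  assert (Hun : u n <> 0) by (apply Cmod_gt_0; lra).
  replace (/ u n - / l)%C with ((l - u n) / (u n * l))%C by (field; auto).
  rewrite Cmod_div by (apply Cmult_neq_0; auto).
  rewrite Cmod_minus_sym, Cmod_mult.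
  apply Rlt_div_l; [nra|]. eapply Rlt_le_trans; [exact H2|].
  apply Rmult_le_compat_l; [lra|].
  assert (H := Rmult_le_compat_r (Cmod l) _ _ (Rlt_le _ _ Pl) (Rlt_le _ _ Pu)). lra.
Qed.

Lemma ctends_unique (u : nat -> C) (l m : C) :
  ctends u l -> ctends u m -> l = m.
Proof.
  intros Hl Hm. apply Ceq_minus, Cmod_eq_0.
  apply Rle_antisym; [|apply Cmod_ge_0].
  apply Rnot_lt_le. intros H.
  destruct (Hl (Cmod (l - m) / 2)) as [N1 H1]; [lra|].
  destruct (Hm (Cmod (l - m) / 2)) as [N2 H2]; [lra|].
  specialize (H1 (N1 + N2)%nat ltac:(lia)).
  specialize (H2 (N1 + N2)%nat ltac:(lia)).
  assert (H3 := Cmod_tri3 l (u (N1 + N2)%nat) m).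
  rewrite (Cmod_minus_sym l (u _)) in H3. lra.
Qed.

Lemma ctends_csum (f : nat -> nat -> C) (l : nat -> C) (m : nat) :
  (forall i, (i < m)%nat -> ctends (fun n => f n i) (l i)) ->
  ctends (fun n => csum (f n) m) (csum l m).
Proof.
  induction m as [|m IH]; intros H; simpl; [apply ctends_const|].
  apply ctends_plus; [apply IH; intros; apply H; lia|apply H; lia].
Qed.

Lemma ctends_le_bound (u : nat -> C) (l x : C) (M : R) (N : nat) :
  ctends u l -> (forall n, (N <= n)%nat -> Cmod (u n - x) <= M) ->
  Cmod (l - x) <= M.
Proof.
  intros Hu H. apply Rnot_lt_le. intros Hlt.
  destruct (Hu (Cmod (l - x) - M)) as [N1 H1]; [lra|].
  specialize (H1 (N + N1)%nat ltac:(lia)).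
  specialize (H (N + N1)%nat ltac:(lia)).
  assert (H3 := Cmod_tri3 l (u (N + N1)%nat) x).
  rewrite (Cmod_minus_sym l (u _)) in H3. lra.
Qed.

Lemma ctends_subseq (u : nat -> C) (l : C) (p : nat -> nat) :
  (forall n, (n <= p n)%nat) -> ctends u l -> ctends (fun n => u (p n)) l.
Proof.
  intros Hp Hu eps He. destruct (Hu eps He) as [N HN]. exists N.
  intros n Hn. apply HN. specialize (Hp n). lia.
Qed.

Lemma ctends_RtoC (u : nat -> R) (l : R) :
  is_lim_seq u l -> ctends (fun n => RtoC (u n)) l.
Proof.
  intros Hu eps He. apply is_lim_seq_spec in Hu.
  destruct (Hu (mkposreal eps He)) as [N HN]. exists N. intros n Hn.
  rewrite <- RtoC_minus, Cmod_R. exact (HN n Hn).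
Qed.

(** * The discrete Fourier transform *)

Lemma ce_plus (x y : C) : ce (x + y)%C = (ce x * ce y)%C.
Proof.
  unfold ce. destruct x as [a b], y as [c d]. unfold Cmult, Cplus, RtoC; simpl.
  replace (-2 * PI * (b + d)) with (-2 * PI * b + -2 * PI * d) by ring.
  replace (2 * PI * (a + c)) with (2 * PI * a + 2 * PI * c) by ring.
  rewrite exp_plus, cos_plus, sin_plus. f_equal; ring.
Qed.

Lemma ce_real (x : R) : ce (RtoC x) = (cos (2 * PI * x), sin (2 * PI * x)).
Proof.
  unfold ce, RtoC, Cmult; simpl. rewrite Rmult_0_r, exp_0. f_equal; ring.
Qed.

Lemma ce_0 : ce (RtoC 0) = RtoC 1.
Proof. rewrite ce_real, Rmult_0_r, cos_0, sin_0. reflexivity. Qed.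

Lemma Cmod_ce (z : C) : Cmod (ce z) = exp (-2 * PI * Im z).
Proof.
  unfold ce. rewrite Cmod_mult, Cmod_R, Rabs_pos_eq by (left; apply exp_pos).
  unfold Cmod at 1; simpl.
  assert (H := sin2_cos2 (2 * PI * Re z)). unfold Rsqr in H.
  replace (cos (2 * PI * Re z) * (cos (2 * PI * Re z) * 1) +
           sin (2 * PI * Re z) * (sin (2 * PI * Re z) * 1)) with 1 by lra.
  rewrite sqrt_1. ring.
Qed.

Lemma ce_neq_0 (z : C) : ce z <> 0.
Proof. apply Cmod_gt_0. rewrite Cmod_ce. apply exp_pos. Qed.

Lemma Cmod_ce_lt (z : C) : 0 < Im z -> Cmod (ce z) < 1.
Proof.
  intros H. rewrite Cmod_ce, <- exp_0. apply exp_increasing.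
  assert (P := PI_RGT_0). nra.
Qed.

Lemma ce_neq_1 (z : C) : 0 < Im z -> (1 - ce z)%C <> 0.
Proof.
  intros H E. assert (L := Cmod_ce_lt z H).
  replace (ce z) with (RtoC 1) in L; [rewrite Cmod_1 in L; lra|].
  apply Ceq_minus. exact E.
Qed.

Lemma ce_IZR (n : Z) : ce (RtoC (IZR n)) = RtoC 1.
Proof.
  assert (H1 : ce (RtoC 1) = RtoC 1).
  { rewrite ce_real, Rmult_1_r, cos_2PI, sin_2PI. reflexivity. }
  induction n as [|n IH|n IH] using Z.peano_ind.
  - apply ce_0.
  - rewrite succ_IZR, RtoC_plus, ce_plus, IH, H1. ring.
  - replace (RtoC (IZR (Z.pred n))) with (RtoC (IZR n) + (- (1)))%C
      by (unfold Z.pred; rewrite plus_IZR, RtoC_plus, <- RtoC_opp; reflexivity).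
    rewrite ce_plus, IH.
    assert (H2 : (ce (RtoC 1) * ce (-(1))%C)%C = RtoC 1).
    { rewrite <- ce_plus, <- ce_0. f_equal. ring. }
    rewrite H1 in H2. exact H2.
Qed.

Lemma ce_nat_mul (n : nat) (z : C) : ce (INR n * z)%C = (ce z ^ n)%C.
Proof.
  induction n as [|n IH].
  - simpl. rewrite Cmult_0_l. apply ce_0.
  - rewrite S_INR, RtoC_plus, Cpow_S, <- IH, <- ce_plus. f_equal. ring.
Qed.

Lemma ce_real_eq_1 (x : R) : ce (RtoC x) = RtoC 1 -> exists k : Z, x = IZR k.
Proof.
  rewrite ce_real. intros H. injection H as Hc _.
  (* The cosine alone suffices: [cos (2 PI x) = 1 - 2 sin^2 (PI x)], so [sin (PI x) = 0]. *)
  replace (2 * PI * x) with (2 * (PI * x)) in Hc by ring.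
  rewrite cos_2a_sin in Hc.
  destruct (sin_eq_0_0 (PI * x)) as [k Hk]; [nra|].
  exists k. assert (P := PI_RGT_0). nra.
Qed.

Definition er (n : nat) (m : Z) : C := ce (RtoC (IZR m / INR n)).

Lemma er_plus (n : nat) (a b : Z) : er n (a + b) = (er n a * er n b)%C.
Proof.
  unfold er. rewrite <- ce_plus, <- RtoC_plus, plus_IZR. f_equal. f_equal.
  unfold Rdiv; ring.
Qed.

Lemma er_0 (n : nat) : er n 0 = RtoC 1.
Proof. unfold er, Rdiv. rewrite Rmult_0_l. apply ce_0. Qed.

Lemma er_opp (n : nat) (a : Z) : (er n (- a) * er n a)%C = RtoC 1.
Proof. rewrite <- er_plus, <- (er_0 n). f_equal. lia. Qed.

Lemma Cmod_er (n : nat) (a : Z) : Cmod (er n a) = 1.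
Proof.
  unfold er. rewrite Cmod_ce. simpl. rewrite Rmult_0_r. apply exp_0.
Qed.

Lemma er_pow (n : nat) (a : Z) (b : nat) :
  (er n a ^ b)%C = er n (a * Z.of_nat b).
Proof.
  unfold er. rewrite <- ce_nat_mul, <- RtoC_mult. f_equal. f_equal.
  rewrite mult_IZR, <- INR_IZR_INZ. unfold Rdiv; ring.
Qed.

Lemma er_1_iff (n : nat) (m : Z) : (0 < n)%nat ->
  er n m = RtoC 1 <-> (Z.of_nat n | m)%Z.
Proof.
  intros Hn. assert (Hr : INR n <> 0) by (apply not_0_INR; lia). split.
  - intros H. destruct (ce_real_eq_1 _ H) as [k Hk]. exists k.
    apply eq_IZR. rewrite mult_IZR, <- INR_IZR_INZ, <- Hk. field. exact Hr.
  - intros [k ->]. unfold er.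
    rewrite mult_IZR, <- INR_IZR_INZ.
    replace (IZR k * INR n / INR n) with (IZR k) by (field; exact Hr).
    apply ce_IZR.
Qed.

Lemma er_orth (n : nat) (m : Z) : (0 < n)%nat ->
  csum (fun j => er n (m * Z.of_nat j)) n
  = if (m mod Z.of_nat n =? 0)%Z then RtoC (INR n) else RtoC 0.
Proof.
  intros Hn. destruct (Z.eqb_spec (m mod Z.of_nat n) 0) as [H|H].
  - apply Z.mod_divide in H; [|lia].
    rewrite (csum_ext _ (fun _ => RtoC 1)).
    + rewrite csum_const. ring.
    + intros i _. apply er_1_iff; [exact Hn|]. apply Z.divide_mul_l, H.
  (* Multiplied by [er n m - 1], the geometric sum telescopes; at [k = n] the right side
     vanishes. *)
  - assert (T : forall k, ((er n m - 1) * csum (fun j => er n (m * Z.of_nat j)) k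
        = er n (m * Z.of_nat k) - 1)%C).
    { induction k as [|k IH].
      - simpl csum. replace (m * Z.of_nat 0)%Z with 0%Z by lia. rewrite er_0. ring.
      - simpl csum. rewrite Cmult_plus_distr_l, IH.
        replace (m * Z.of_nat (S k))%Z with (m + m * Z.of_nat k)%Z by lia.
        rewrite er_plus. ring. }
    specialize (T n).
    rewrite (proj2 (er_1_iff n (m * Z.of_nat n) Hn)) in T
      by (apply Z.divide_factor_r).
    assert (N : (er n m - 1)%C <> 0).
    { intros E. apply Ceq_minus in E. apply er_1_iff in E; [|exact Hn].
      apply H, Z.mod_divide; [lia|exact E]. }
    apply (f_equal (fun w => (/ (er n m - 1) * w)%C)) in T.
    rewrite Cmult_assoc, Cinv_l, Cmult_1_l in T by exact N. rewrite T. ring.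
Qed.

Definition periodic (n : nat) (w : Z -> C) : Prop :=
  forall x, w (x + Z.of_nat n)%Z = w x.

Lemma periodic_cong (n : nat) (w : Z -> C) : periodic n w ->
  forall x y, (Z.of_nat n | x - y)%Z -> w x = w y.
Proof.
  intros H x y [k Hk]. replace x with (y + k * Z.of_nat n)%Z by lia. clear Hk x.
  induction k as [|k IH|k IH] using Z.peano_ind.
  - f_equal. lia.
  - rewrite <- IH, <- (H (y + k * Z.of_nat n)%Z). f_equal. unfold Z.succ; ring.
  - rewrite <- IH, <- (H (y + Z.pred k * Z.of_nat n)%Z). f_equal.
    unfold Z.pred; ring.
Qed.

Lemma er_periodic (n : nat) (a : Z) : (0 < n)%nat ->
  periodic n (fun x => er n (a * x)).
Proof.
  intros Hn x. rewrite Z.mul_add_distr_l, er_plus.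
  rewrite (proj2 (er_1_iff n (a * Z.of_nat n) Hn)) by (apply Z.divide_factor_r).
  ring.
Qed.

Lemma periodic_bounded (n : nat) (w : Z -> C) : (0 < n)%nat -> periodic n w ->
  exists M, 0 < M /\ forall x, Cmod (w x) <= M.
Proof.
  intros Hn H. exists (1 + rsum (fun i => Cmod (w (Z.of_nat i))) n).
  assert (A : forall k, 0 <= rsum (fun i => Cmod (w (Z.of_nat i))) k).
  { induction k as [|k IH]; simpl; [lra|].
    assert (P := Cmod_ge_0 (w (Z.of_nat k))). lra. }
  split; [specialize (A n); lra|]. intros x.
  rewrite (periodic_cong n w H x (x mod Z.of_nat n)).
  2:{ exists (x / Z.of_nat n)%Z.
      assert (E := Z.div_mod x (Z.of_nat n) ltac:(lia)). lia. }
  assert (B := Z.mod_pos_bound x (Z.of_nat n) ltac:(lia)).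
  replace (x mod Z.of_nat n)%Z with (Z.of_nat (Z.to_nat (x mod Z.of_nat n))) by lia.
  assert (L : (Z.to_nat (x mod Z.of_nat n) < n)%nat) by lia.
  revert L. generalize (Z.to_nat (x mod Z.of_nat n)). intros j Hj.
  clear - Hj A. induction n as [|n IH]; [lia|]. simpl.
  destruct (Nat.eq_dec j n) as [->|E].
  - specialize (A n). lra.
  - specialize (IH ltac:(lia)). assert (P := Cmod_ge_0 (w (Z.of_nat n))). lra.
Qed.

(** With the factor [1/n] placed here, inversion carries no constant and the transform does not
    increase the sup norm. *)
Definition dft (n : nat) (w : Z -> C) (y : Z) : C :=
  (/ INR n * csum (fun b => w (Z.of_nat b) * er n (- y * Z.of_nat b)) n)%C.

Lemma RINR_neq_0 (n : nat) : (0 < n)%nat -> RtoC (INR n) <> 0.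
Proof.
  intros Hn E. apply RtoC_inj in E. apply not_0_INR in E; [exact E|lia].
Qed.

Lemma dft_inv (n : nat) (w : Z -> C) (x : Z) : (0 < n)%nat -> periodic n w ->
  w x = csum (fun y => dft n w (Z.of_nat y) * er n (x * Z.of_nat y))%C n.
Proof.
  intros Hn H. assert (NZ := RINR_neq_0 n Hn). unfold dft.
  rewrite (csum_ext _ (fun y => / INR n * csum (fun b =>
     w (Z.of_nat b) * er n ((x - Z.of_nat b) * Z.of_nat y)) n)%C).
  2:{ intros y _. rewrite <- Cmult_assoc. f_equal.
      rewrite Cmult_comm, <- csum_scal. apply csum_ext. intros b _.
      replace ((x - Z.of_nat b) * Z.of_nat y)%Z
        with (x * Z.of_nat y + - Z.of_nat y * Z.of_nat b)%Z by ring.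
      rewrite er_plus. ring. }
  rewrite csum_scal, csum_swap.
  assert (B := Z.mod_pos_bound x (Z.of_nat n) ltac:(lia)).
  assert (E := Z.div_mod x (Z.of_nat n) ltac:(lia)).
  rewrite (csum_single _ n (Z.to_nat (x mod Z.of_nat n))).
  - rewrite csum_scal, er_orth by exact Hn.
    rewrite Z2Nat.id by lia.
    replace ((x - x mod Z.of_nat n) mod Z.of_nat n)%Z with 0%Z.
    2:{ symmetry. apply Z.mod_divide; [lia|]. exists (x / Z.of_nat n)%Z. lia. }
    simpl. rewrite (periodic_cong n w H x (x mod Z.of_nat n)).
    2:{ exists (x / Z.of_nat n)%Z. lia. }
    field. exact NZ.
  - lia.
  - intros b Hb Hne. rewrite csum_scal, er_orth by exact Hn.
    destruct (Z.eqb_spec ((x - Z.of_nat b) mod Z.of_nat n) 0) as [E0|E0]; [|ring].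
    exfalso. apply Hne. apply Z.mod_divide in E0; [|lia]. destruct E0 as [k Hk].
    assert (x mod Z.of_nat n = Z.of_nat b)%Z; [|lia].
    symmetry. apply Z.mod_unique with k; lia.
Qed.

Lemma dft_periodic (n : nat) (w : Z -> C) : (0 < n)%nat -> periodic n (dft n w).
Proof.
  intros Hn y. unfold dft. f_equal. apply csum_ext. intros b _. f_equal.
  replace (- (y + Z.of_nat n) * Z.of_nat b)%Z
    with (- y * Z.of_nat b + (- Z.of_nat b) * Z.of_nat n)%Z by ring.
  rewrite er_plus, (proj2 (er_1_iff n (_ * Z.of_nat n) Hn))
    by (apply Z.divide_factor_r). ring.
Qed.

Lemma dft_norm (n : nat) (w : Z -> C) (M : R) (y : Z) : (0 < n)%nat ->
  (forall x, Cmod (w x) <= M) -> Cmod (dft n w y) <= M.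
Proof.
  intros Hn H. unfold dft.
  assert (P : 0 < INR n) by (apply lt_0_INR, Hn).
  rewrite Cmod_mult, Cmod_inv by (apply RINR_neq_0, Hn).
  rewrite Cmod_R, Rabs_pos_eq by lra.
  apply (Rmult_le_reg_l (INR n)); [exact P|].
  rewrite <- Rmult_assoc, Rinv_r, Rmult_1_l by lra.
  apply csum_norm_const. intros i _. rewrite Cmod_mult, Cmod_er, Rmult_1_r.
  apply H.
Qed.

(** Any reindexing under which the additive characters keep their sums is a
    legitimate reindexing of every periodic sum, by Fourier inversion. *)
Lemma csum_reindex (n : nat) (w : Z -> C) (g : nat -> Z) :
  (0 < n)%nat -> periodic n w ->
  (forall y, csum (fun b => er n (g b * y)) n
             = csum (fun b => er n (Z.of_nat b * y)) n) ->
  csum (fun b => w (g b)) n = csum (fun b => w (Z.of_nat b)) n.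
Proof.
  intros Hn H Hg.
  rewrite (csum_ext _ (fun b => csum (fun y => dft n w (Z.of_nat y)
     * er n (g b * Z.of_nat y))%C n)) by (intros; apply dft_inv; assumption).
  rewrite (csum_ext (fun b => w (Z.of_nat b)) (fun b => csum (fun y =>
     dft n w (Z.of_nat y) * er n (Z.of_nat b * Z.of_nat y))%C n))
    by (intros; apply dft_inv; assumption).
  rewrite csum_swap. symmetry. rewrite csum_swap. symmetry.
  apply csum_ext. intros y _. rewrite !csum_scal, Hg. reflexivity.
Qed.

Lemma csum_er_orth (n : nat) (m : Z) : (0 < n)%nat ->
  csum (fun j => er n (Z.of_nat j * m)) n
  = if (m mod Z.of_nat n =? 0)%Z then RtoC (INR n) else RtoC 0.
Proof.
  intros Hn. rewrite <- er_orth by exact Hn. apply csum_ext. intros; f_equal; lia.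
Qed.

Lemma csum_shift (n : nat) (w : Z -> C) (x : Z) : (0 < n)%nat -> periodic n w ->
  csum (fun b => w (x + Z.of_nat b)%Z) n = csum (fun b => w (Z.of_nat b)) n.
Proof.
  intros Hn H. apply (csum_reindex n w (fun b => x + Z.of_nat b)%Z Hn H). intros y.
  rewrite (csum_ext _ (fun b => er n (x * y) * er n (Z.of_nat b * y))%C).
  2:{ intros; rewrite <- er_plus; f_equal; ring. }
  rewrite csum_scal, csum_er_orth by exact Hn.
  (* The phase [er n (x * y)] matters only where the character sum is nonzero, that is for [n | y],
     and there it is 1. *)
  destruct (Z.eqb_spec (y mod Z.of_nat n) 0) as [E|E]; [|ring].
  apply Z.mod_divide in E; [|lia].
  rewrite (proj2 (er_1_iff n _ Hn)) by (apply Z.divide_mul_r, E). ring.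
Qed.

Lemma csum_dilate (n : nat) (w : Z -> C) (x : Z) : (0 < n)%nat -> periodic n w ->
  Z.gcd x (Z.of_nat n) = 1%Z ->
  csum (fun b => w (x * Z.of_nat b)%Z) n = csum (fun b => w (Z.of_nat b)) n.
Proof.
  intros Hn H G. apply (csum_reindex n w (fun b => x * Z.of_nat b)%Z Hn H). intros y.
  rewrite (csum_ext _ (fun b => er n (Z.of_nat b * (x * y)))).
  2:{ intros; f_equal; ring. }
  rewrite !csum_er_orth by exact Hn.
  assert (E : ((x * y) mod Z.of_nat n = 0 <-> y mod Z.of_nat n = 0)%Z).
  { rewrite !Z.mod_divide by lia. split; intros D.
    - apply Z.gauss with x; [exact D|]. rewrite Z.gcd_comm. exact G.
    - apply Z.divide_mul_r, D. }
  destruct (Z.eqb_spec ((x * y) mod Z.of_nat n) 0),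
    (Z.eqb_spec (y mod Z.of_nat n) 0); tauto.
Qed.

Lemma csum_blocks (n k : nat) (w : Z -> C) : (0 < n)%nat -> periodic n w ->
  csum (fun b => w (Z.of_nat b)) (k * n)
  = (INR k * csum (fun b => w (Z.of_nat b)) n)%C.
Proof.
  intros Hn H. rewrite csum_mul, <- csum_const. apply csum_ext. intros j _.
  rewrite <- (csum_shift n w (Z.of_nat (j * n))) by assumption.
  apply csum_ext. intros i _. f_equal. lia.
Qed.

(** * Partial fractions of the cotangent *)

(** The symmetric window from [-K] to [K]: the cotangent series is not absolutely convergent, so the
    shape of its partial sums matters. *)
Definition zsum (F : Z -> C) (K : nat) : C :=
  csum (fun i => F (Z.of_nat i - Z.of_nat K)%Z) (2 * K + 1).

Lemma zsum_ext (F G : Z -> C) (K : nat) : (forall k, F k = G k) -> zsum F K = zsum G K.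
Proof. intros H. apply csum_ext. intros; apply H. Qed.

Lemma zsum_pair (F : Z -> C) (K : nat) :
  zsum F K = (F 0%Z + csum (fun j => F (Z.of_nat (S j)) + F (- Z.of_nat (S j))%Z) K)%C.
Proof.
  unfold zsum. replace (2 * K + 1)%nat with (K + (1 + K))%nat by lia.
  rewrite csum_app, (csum_app _ 1 K), csum_plus, csum_rev. simpl csum at 2.
  replace (Z.of_nat (K + 0) - Z.of_nat K)%Z with 0%Z by lia.
  rewrite (csum_ext _ (fun j => F (- Z.of_nat (S j))%Z))
    by (intros; f_equal; lia).
  rewrite (csum_ext (fun i => F (Z.of_nat (K + (1 + i)) - Z.of_nat K)%Z)
    (fun j => F (Z.of_nat (S j)))) by (intros; f_equal; lia).
  ring.
Qed.

Definition miPi : C := (0, - PI)%R.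

(** This is [PI * cot (PI * s)]. *)
Definition Ccot (s : C) : C := (miPi * ((1 + ce s) / (1 - ce s)))%C.

Lemma Im_div_nat (s : C) (n : nat) : (0 < n)%nat ->
  Im (s / INR n)%C = Im s / INR n.
Proof.
  intros Hn. assert (INR n <> 0) by (apply not_0_INR; lia).
  unfold Cdiv. rewrite <- RtoC_inv by assumption. rewrite im_scal_r. reflexivity.
Qed.

Lemma Im_plus_Z (s : C) (k : Z) : Im (s + ZtoC k)%C = Im s.
Proof. unfold ZtoC. destruct s; simpl. ring. Qed.

Lemma ce_shift_Z (s : C) (k : Z) : ce (s + ZtoC k)%C = ce s.
Proof. unfold ZtoC. rewrite ce_plus, ce_IZR. ring. Qed.

Lemma ce_split (n : nat) (s : C) (m : Z) : (0 < n)%nat ->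
  ce ((s + ZtoC m) / INR n)%C = (ce (s / INR n) * er n m)%C.
Proof.
  intros Hn. assert (INR n <> 0) by (apply not_0_INR; lia).
  unfold er. rewrite <- ce_plus. f_equal. unfold ZtoC.
  rewrite RtoC_div by assumption. field. apply RINR_neq_0, Hn.
Qed.

Lemma geom (x : C) (n : nat) : (1 - x)%C <> 0 ->
  csum (fun b => x ^ b)%C n = ((1 - x ^ n) / (1 - x))%C.
Proof.
  intros Hx. induction n as [|n IH].
  - simpl csum. change (x ^ 0)%C with (RtoC 1). field. exact Hx.
  - simpl csum. rewrite IH, Cpow_S. field. exact Hx.
Qed.

(** The points are [x zeta^i] with [x^n = ce s]. Each [1/(1 - x zeta^i)] is a finite geometric sum
    of [n] terms over the common denominator [1 - x^n], and orthogonality in [i] leaves only the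
    exponent 0. *)
Lemma csum_inv_roots (n : nat) (s : C) : (0 < n)%nat -> 0 < Im s ->
  csum (fun i => / (1 - ce ((s + ZtoC (Z.of_nat i)) / INR n)))%C n
  = (INR n / (1 - ce s))%C.
Proof.
  intros Hn Hs. assert (NZ := RINR_neq_0 n Hn).
  assert (Hr : 0 < INR n) by (apply lt_0_INR, Hn).
  assert (N1 := ce_neq_1 s Hs).
  set (x := ce (s / INR n)%C).
  assert (Hxn : (x ^ n)%C = ce s).
  { unfold x. rewrite <- ce_nat_mul. f_equal. field. exact NZ. }
  rewrite (csum_ext _ (fun i => / (1 - ce s) *
     csum (fun b => x ^ b * er n (Z.of_nat b * Z.of_nat i)) n)%C).
  - rewrite csum_scal, csum_swap.
    rewrite (csum_single _ n 0); [|exact Hn|].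
    + rewrite csum_scal, er_orth by exact Hn.
      change (Z.of_nat 0) with 0%Z. rewrite Zmod_0_l. simpl.
      field. exact N1.
    + intros b Hb Hb0. rewrite csum_scal, er_orth by exact Hn.
      rewrite Z.mod_small by lia.
      destruct (Z.eqb_spec (Z.of_nat b) 0); [lia|]. ring.
  - intros i _.
    assert (N2 : (1 - ce ((s + ZtoC (Z.of_nat i)) / INR n))%C <> 0).
    { apply ce_neq_1. rewrite Im_div_nat, Im_plus_Z by exact Hn.
      apply Rdiv_lt_0_compat; assumption. }
    rewrite ce_split in * by exact Hn. fold x in N2 |- *.
    rewrite (csum_ext (fun b => x ^ b * er n (Z.of_nat b * Z.of_nat i))%C
      (fun b => (x * er n (Z.of_nat i)) ^ b)%C).
    + rewrite geom, Cpow_mult_l, er_pow, Hxn by exact N2.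
      rewrite (proj2 (er_1_iff n (_ * Z.of_nat n) Hn)) by apply Z.divide_factor_r.
      field. split; assumption.
    + intros b _. rewrite Cpow_mult_l, er_pow. do 2 f_equal. ring.
Qed.

Lemma Ccot_inv (s : C) : 0 < Im s -> Ccot s = (miPi * (2 * / (1 - ce s) - 1))%C.
Proof.
  intros H. unfold Ccot. f_equal. field. apply ce_neq_1, H.
Qed.

(** The multiplication formula of the cotangent. The modulus is odd so that the residues form a
    symmetric window; as [K] grows, each term tends to [1/(s + k)]. *)
Lemma Ccot_euler (K : nat) (s : C) : 0 < Im s ->
  Ccot s = (/ INR (2 * K + 1) *
            zsum (fun k => Ccot ((s + ZtoC k) / INR (2 * K + 1))) K)%C.
Proof.
  intros Hs. set (n := (2 * K + 1)%nat).
  assert (Hn : (0 < n)%nat) by (unfold n; lia).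
  assert (Hr : 0 < INR n) by (apply lt_0_INR, Hn).
  assert (NZ := RINR_neq_0 n Hn).
  assert (Hs' : 0 < Im (s + ZtoC (- Z.of_nat K))%C) by (rewrite Im_plus_Z; exact Hs).
  assert (R := csum_inv_roots n _ Hn Hs'). rewrite ce_shift_Z in R.
  unfold zsum. fold n.
  rewrite (csum_ext _ (fun i => miPi * (2 * / (1 - ce
    ((s + ZtoC (- Z.of_nat K) + ZtoC (Z.of_nat i)) / INR n)) - 1))%C).
  - rewrite csum_scal, csum_minus, csum_scal, R, csum_const, Ccot_inv by exact Hs.
    field. split; [apply ce_neq_1, Hs|exact NZ].
  - intros i _.
    replace (s + ZtoC (- Z.of_nat K) + ZtoC (Z.of_nat i))%C
      with (s + ZtoC (Z.of_nat i - Z.of_nat K))%C.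
    + apply Ccot_inv. rewrite Im_div_nat, Im_plus_Z by exact Hn.
      apply Rdiv_lt_0_compat; assumption.
    + unfold ZtoC. rewrite minus_IZR, opp_IZR, RtoC_minus, RtoC_opp. ring.
Qed.

Lemma er_pair (n : nat) (k : Z) :
  (2 - er n k - er n (- k))%C = RtoC (4 * (sin (PI * IZR k / INR n)) ^ 2).
Proof.
  unfold er. rewrite !ce_real, opp_IZR.
  replace (2 * PI * (- IZR k / INR n)) with (- (2 * PI * (IZR k / INR n)))
    by (unfold Rdiv; ring).
  rewrite cos_neg, sin_neg.
  replace (2 * PI * (IZR k / INR n)) with (2 * (PI * IZR k / INR n))
    by (unfold Rdiv; ring).
  rewrite cos_2a_sin. unfold Cminus, Cplus, Copp, RtoC; simpl. f_equal; ring.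
Qed.

(** Scaled so that each factor on the right has a limit as [n] grows. *)
Lemma Ccot_pair (n : nat) (s : C) (k : Z) : (0 < n)%nat -> 0 < Im s ->
  let x := ce (s / INR n)%C in
  let d := (INR n * (1 - x))%C in
  let t := RtoC (INR n * sin (PI * IZR k / INR n)) in
  (/ INR n * (Ccot ((s + ZtoC k) / INR n) + Ccot ((s + ZtoC (- k)) / INR n)))%C
  = (2 * miPi * d * (1 + x) * / (d * d + 4 * x * (t * t)))%C.
Proof.
  intros Hn Hs x d t. assert (NZ := RINR_neq_0 n Hn).
  assert (Hr : 0 < INR n) by (apply lt_0_INR, Hn).
  assert (N : forall m, (1 - ce ((s + ZtoC m) / INR n))%C <> 0).
  { intros m. apply ce_neq_1. rewrite Im_div_nat, Im_plus_Z by exact Hn.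
    apply Rdiv_lt_0_compat; assumption. }
  assert (N1 := N k). assert (N2 := N (- k)%Z).
  unfold Ccot. rewrite ce_split in * by exact Hn. rewrite ce_split in * by exact Hn.
  fold x in N1, N2 |- *.
  assert (E : (d * d + 4 * x * (t * t)
     = INR n * INR n * ((1 - x * er n k) * (1 - x * er n (- k))))%C).
  { assert (P := er_pair n k). assert (Q := er_opp n k).
    unfold t. rewrite RtoC_mult.
    set (sn := RtoC (sin (PI * IZR k / INR n))) in *.
    replace (RtoC (4 * sin (PI * IZR k / INR n) ^ 2)) with (4 * (sn * sn))%C in P
      by (unfold sn; rewrite RtoC_mult, RtoC_pow; simpl; ring).
    transitivity (INR n * INR n * ((1 - x) * (1 - x) + x * (4 * (sn * sn))))%C.
    - unfold d. ring.
    - rewrite <- P.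
      replace ((1 - x * er n k) * (1 - x * er n (- k)))%C with
        (1 - x * er n k - x * er n (- k) + x * x * (er n (- k) * er n k))%C by ring.
      rewrite Q. ring. }
  rewrite E.
  assert (Q := er_opp n k).
  unfold d.
  transitivity (miPi * / INR n * (2 - 2 * x * x * (er n (- k) * er n k))
     * / ((1 - x * er n k) * (1 - x * er n (- k))))%C.
  - field. repeat split; assumption.
  - rewrite Q. field. repeat split; assumption.
Qed.

Lemma is_lim_seq_inv_INR (p : nat -> nat) : (forall n, (n <= p n)%nat) ->
  is_lim_seq (fun n => / INR (p n)) 0.
Proof.
  intros Hp. apply is_lim_seq_spec. intros eps.
  destruct (archimed_cor1 eps (cond_pos eps)) as [N [HN HN0]].
  exists N. intros n Hn. specialize (Hp n).
  assert (P : 0 < INR N) by (apply lt_0_INR, HN0).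
  assert (Q : INR N <= INR (p n)) by (apply le_INR; lia).
  rewrite Rminus_0_r, Rabs_pos_eq by (left; apply Rinv_0_lt_compat; lra).
  eapply Rle_lt_trans; [apply Rinv_le_contravar; eassumption|exact HN].
Qed.

(** Dominated convergence for series whose terms and length both depend on [K]. Stating it as a
    difference that tends to 0 avoids having to know beforehand that the limit series converges. *)
Lemma tannery (f : nat -> nat -> C) (l : nat -> C) (M : R) (K0 J0 : nat) :
  (forall j, ctends (fun K => f K j) (l j)) ->
  (forall K j, (K0 <= K)%nat -> (J0 <= j)%nat -> (j < K)%nat ->
     Cmod (f K j) <= M / (INR (S j)) ^ 2) ->
  ctends (fun K => csum (f K) K - csum l K)%C 0.
Proof.
  intros Hl Hb.
  assert (Hlb : forall j, (J0 <= j)%nat -> Cmod (l j) <= M / (INR (S j)) ^ 2).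
  { intros j Hj. replace (l j) with (l j - 0)%C by ring.
    apply (ctends_le_bound _ _ _ _ (K0 + S j)%nat (Hl j)).
    intros n Hn. replace (f n j - 0)%C with (f n j) by ring. apply Hb; lia. }
  assert (HM : 0 <= M).
  { specialize (Hlb J0 (le_n _)). assert (P := Cmod_ge_0 (l J0)).
    assert (Q : 0 < INR (S J0)) by (apply lt_0_INR; lia).
    apply Rmult_le_reg_r with (/ INR (S J0) ^ 2).
    - apply Rinv_0_lt_compat. apply pow_lt, Q.
    - unfold Rdiv in Hlb. lra. }
  intros eps He.
  assert (L := is_lim_seq_inv_INR (fun n => S n) (fun n => le_S _ _ (le_n n))).
  apply is_lim_seq_spec in L.
  assert (Pe : 0 < eps / (4 * (M + 1))) by (apply Rdiv_lt_0_compat; lra).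
  destruct (L (mkposreal _ Pe)) as [J1 HJ1]. simpl pos in HJ1.
  set (J := S (J0 + J1)).
  assert (HJ : 2 * M / INR J < eps / 2).
  { specialize (HJ1 (J0 + J1)%nat ltac:(lia)). fold J in HJ1.
    assert (P : 0 < INR J) by (apply lt_0_INR; unfold J; lia).
    rewrite Rminus_0_r, Rabs_pos_eq in HJ1 by (left; apply Rinv_0_lt_compat, P).
    unfold Rdiv. assert (P' := Rinv_0_lt_compat _ P).
    apply Rle_lt_trans with (2 * (M + 1) * / INR J); [nra|].
    apply Rmult_lt_compat_l with (r := 2 * (M + 1)) in HJ1; [|lra].
    eapply Rlt_le_trans; [exact HJ1|]. right. field. lra. }
  destruct (ctends_csum f l J (fun i _ => Hl i) (eps / 2)) as [K1 HK1]; [lra|].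
  exists (K0 + J + K1)%nat. intros K HK.
  specialize (HK1 K ltac:(lia)).
  replace K with (J + (K - J))%nat at 2 3 by lia.
  rewrite !csum_app.
  set (t1 := csum (fun i => f K (J + i)%nat) (K - J)).
  set (t2 := csum (fun i => l (J + i)%nat) (K - J)).
  replace (csum (f K) J + t1 - (csum l J + t2) - 0)%C
    with ((csum (f K) J - csum l J) + (t1 - t2))%C by ring.
  eapply Rle_lt_trans; [apply Cmod_triangle|].
  assert (T : Cmod (t1 - t2) <= 2 * M / INR J); [|lra].
  unfold t1, t2. rewrite <- csum_minus.
  assert (PJ : 0 < INR J) by (apply lt_0_INR; unfold J; lia).
  (* The tails of [f K] and of [l] each contribute [M], and [1/(a+1)^2 <= 1/a - 1/(a+1)] makes the
     majorant telescope. *)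
  apply Rle_trans with (rsum (fun i => 2 * M * (/ INR (J + i) - / INR (J + S i))) (K - J)).
  - apply csum_norm_le. intros i Hi.
    eapply Rle_trans; [apply Cmod_minus_le|].
    assert (H1 := Hb K (J + i)%nat ltac:(lia) ltac:(lia) ltac:(lia)).
    assert (H2 := Hlb (J + i)%nat ltac:(lia)).
    assert (P : 0 < INR (J + i)) by (apply lt_0_INR; lia).
    replace (J + S i)%nat with (S (J + i)) by lia.
    rewrite S_INR in *.
    set (a := INR (J + i)) in *.
    assert (E : / (a + 1) ^ 2 <= / a - / (a + 1)).
    { replace (/ a - / (a + 1)) with (/ (a * (a + 1))) by (field; lra).
      apply Rinv_le_contravar; nra. }
    unfold Rdiv in H1, H2. nra.
  - rewrite rsum_scal, (rsum_tele (fun i => / INR (J + i))), Nat.add_0_r.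
    assert (P : 0 < INR (J + (K - J))) by (apply lt_0_INR; lia).
    apply Rinv_0_lt_compat in P. unfold Rdiv. apply Rmult_le_compat_l; lra.
Qed.

(** The derivative at 0 sampled at [h = 1/(2K+1)]; it supplies the limits of all the scaled factors
    in [Ccot_pair]. *)
Lemma lim_difference_quotient (f : R -> R) (l : R) :
  is_derive f 0 l ->
  is_lim_seq (fun K => INR (2 * K + 1) * (f (/ INR (2 * K + 1)) - f 0)) l.
Proof.
  intros H. apply is_derive_Reals in H. apply is_lim_seq_spec. intros eps.
  destruct (H eps (cond_pos eps)) as [delta Hd].
  assert (L := is_lim_seq_inv_INR (fun K => 2 * K + 1)%nat ltac:(intros; cbv beta; lia)).
  apply is_lim_seq_spec in L. destruct (L delta) as [N HN].
  exists N. intros n Hn. specialize (HN n Hn). rewrite Rminus_0_r in HN.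
  assert (P : 0 < INR (2 * n + 1)) by (apply lt_0_INR; lia).
  assert (P' := Rinv_0_lt_compat _ P).
  specialize (Hd (/ INR (2 * n + 1)) ltac:(lra) HN).
  rewrite Rplus_0_l in Hd.
  replace (INR (2 * n + 1) * (f (/ INR (2 * n + 1)) - f 0))
    with ((f (/ INR (2 * n + 1)) - f 0) / / INR (2 * n + 1)); [exact Hd|].
  field. lra.
Qed.

Lemma ctends_Re_Im (u : nat -> C) (a b : R) :
  is_lim_seq (fun n => Re (u n)) a -> is_lim_seq (fun n => Im (u n)) b ->
  ctends u (a, b).
Proof.
  intros Ha Hb. apply (ctends_ext (fun n => Re (u n) + Ci * Im (u n))%C).
  - intros n. destruct (u n) as [x y]. unfold Ci, Cmult, Cplus, RtoC; simpl.
    f_equal; ring.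
  - replace (a, b) with (a + Ci * b)%C.
    + apply ctends_plus; [|apply ctends_scal]; apply ctends_RtoC; assumption.
    + unfold Ci, Cmult, Cplus, RtoC; simpl. f_equal; ring.
Qed.

Lemma lim_one_minus_ce (s : C) :
  ctends (fun K => INR (2 * K + 1) * (1 - ce (s / INR (2 * K + 1))))%C (2 * miPi * s)%C.
Proof.
  destruct s as [u v].
  replace (2 * miPi * (u, v))%C with ((- (-2 * PI * v)), (- (2 * PI * u)))%R.
  2:{ unfold miPi, Cmult, RtoC; simpl. f_equal; ring. }
  assert (E : forall K, ce ((u, v) / INR (2 * K + 1))%C
    = (exp (-2 * PI * v * / INR (2 * K + 1)) * cos (2 * PI * u * / INR (2 * K + 1)),
       exp (-2 * PI * v * / INR (2 * K + 1)) * sin (2 * PI * u * / INR (2 * K + 1)))).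
  { intros K. assert (N : INR (2 * K + 1) <> 0) by (apply not_0_INR; lia).
    unfold Cdiv. rewrite <- RtoC_inv by exact N. unfold ce.
    rewrite re_scal_r, im_scal_r. simpl Re. simpl Im.
    unfold Cmult, RtoC; simpl.
    rewrite <- !Rmult_assoc. f_equal; ring. }
  apply ctends_Re_Im.
  - apply is_lim_seq_ext with (fun K => - (INR (2 * K + 1) *
      ((fun h => exp (-2 * PI * v * h) * cos (2 * PI * u * h)) (/ INR (2 * K + 1))
       - (fun h => exp (-2 * PI * v * h) * cos (2 * PI * u * h)) 0))).
    + intros K. rewrite E, re_scal_l. generalize (INR (2 * K + 1)). intros n.
      unfold Cminus, Cplus, Copp, RtoC; simpl.
      rewrite !Rmult_0_r, exp_0, cos_0. ring.
    + change (Finite (- (-2 * PI * v))) with (Rbar_opp (-2 * PI * v)).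
      apply (proj1 (is_lim_seq_opp _ _)).
      apply (lim_difference_quotient
        (fun h => exp (-2 * PI * v * h) * cos (2 * PI * u * h))).
      auto_derive; [trivial|]. rewrite !Rmult_0_r, exp_0, cos_0, sin_0. ring.
  - apply is_lim_seq_ext with (fun K => - (INR (2 * K + 1) *
      ((fun h => exp (-2 * PI * v * h) * sin (2 * PI * u * h)) (/ INR (2 * K + 1))
       - (fun h => exp (-2 * PI * v * h) * sin (2 * PI * u * h)) 0))).
    + intros K. rewrite E, im_scal_l. generalize (INR (2 * K + 1)). intros n.
      unfold Cminus, Cplus, Copp, RtoC; simpl.
      rewrite !Rmult_0_r, exp_0, sin_0. ring.
    + change (Finite (- (2 * PI * u))) with (Rbar_opp (2 * PI * u)).
      apply (proj1 (is_lim_seq_opp _ _)).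
      apply (lim_difference_quotient
        (fun h => exp (-2 * PI * v * h) * sin (2 * PI * u * h))).
      auto_derive; [trivial|]. rewrite !Rmult_0_r, exp_0, cos_0, sin_0. ring.
Qed.

Lemma lim_sin_scaled (k : Z) :
  is_lim_seq (fun K => INR (2 * K + 1) * sin (PI * IZR k / INR (2 * K + 1))) (PI * IZR k).
Proof.
  apply is_lim_seq_ext with (fun K => INR (2 * K + 1) *
    ((fun h => sin (PI * IZR k * h)) (/ INR (2 * K + 1)) - (fun h => sin (PI * IZR k * h)) 0)).
  - intros K. simpl. rewrite Rmult_0_r, sin_0. unfold Rdiv. ring.
  - apply (lim_difference_quotient (fun h => sin (PI * IZR k * h))).
    auto_derive; [trivial|]. rewrite Rmult_0_r, cos_0. ring.
Qed.

Lemma lim_ce_div (s : C) : ctends (fun K => ce (s / INR (2 * K + 1))%C) 1.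
Proof.
  assert (L := is_lim_seq_inv_INR (fun K => 2 * K + 1)%nat ltac:(intros; cbv beta; lia)).
  apply ctends_RtoC in L.
  assert (H := ctends_mult _ _ _ _ L (lim_one_minus_ce s)).
  assert (H2 := ctends_minus _ _ _ _ (ctends_const 1) H).
  rewrite Cmult_0_l in H2. replace (1 - 0)%C with (RtoC 1) in H2 by ring.
  eapply ctends_ext; [|exact H2]. intros K. cbv beta.
  assert (N : INR (2 * K + 1) <> 0) by (apply not_0_INR; lia).
  rewrite RtoC_inv by exact N. field. apply RINR_neq_0. lia.
Qed.

(** From [sin t >= t - t^3/6] and [t <= 2], so that [1 - t^2/6 >= 1/3]. The constant 3 suffices
    because [PI > 3]. *)
Lemma sin_ge_third (t : R) : 0 <= t <= PI / 2 -> t / 3 <= sin t.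
Proof.
  intros [H0 H1]. assert (P4 := PI_4). assert (P := PI_RGT_0).
  destruct (sin_bound t 0 H0 ltac:(lra)) as [H _].
  eapply Rle_trans; [|exact H].
  unfold sin_approx, sin_term; simpl. nra.
Qed.

Lemma miPi_sqr : (miPi * miPi)%C = (- (RtoC PI * RtoC PI))%C.
Proof. unfold miPi, Cmult, Copp, RtoC; simpl. f_equal; ring. Qed.

Lemma Cmod_miPi : Cmod miPi = PI.
Proof.
  unfold miPi, Cmod; simpl. assert (P := PI_RGT_0).
  replace (0 * (0 * 1) + - PI * (- PI * 1)) with (PI * PI) by ring.
  apply sqrt_square. lra.
Qed.

Lemma miPi_neq_0 : miPi <> 0.
Proof. apply Cmod_gt_0. rewrite Cmod_miPi. apply PI_RGT_0. Qed.

Lemma Im_neq_0 (s : C) : Im s <> 0 -> s <> 0.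
Proof. intros H E. apply H. rewrite E. reflexivity. Qed.

Lemma add_Z_neq_0 (s : C) (k : Z) : Im s <> 0 -> (s + ZtoC k)%C <> 0.
Proof. intros H. apply Im_neq_0. rewrite Im_plus_Z. exact H. Qed.

Lemma ctends_Ccot_pair (s : C) (k : Z) : 0 < Im s ->
  ctends (fun K => / INR (2 * K + 1) * (Ccot ((s + ZtoC k) / INR (2 * K + 1))
            + Ccot ((s + ZtoC (- k)) / INR (2 * K + 1))))%C
         (/ (s + ZtoC k) + / (s + ZtoC (- k)))%C.
Proof.
  intros Hs.
  assert (N1 : (s + ZtoC k)%C <> 0) by (apply add_Z_neq_0; lra).
  assert (N2 : (s + ZtoC (- k))%C <> 0) by (apply add_Z_neq_0; lra).
  assert (NP : RtoC PI <> 0).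
  { intros E. apply RtoC_inj in E. assert (P := PI_RGT_0). lra. }
  eapply ctends_ext.
  { intros K. symmetry. apply Ccot_pair; [lia|exact Hs]. }
  cbv zeta.
  assert (E : ((2 * miPi * s) * (2 * miPi * s) + 4 * 1 * (RtoC (PI * IZR k) * RtoC (PI * IZR k))
     = - 4 * (PI * PI) * ((s + ZtoC k) * (s + ZtoC (- k))))%C).
  { transitivity (4 * (miPi * miPi) * s * s + 4 * 1 * (RtoC (PI * IZR k) * RtoC (PI * IZR k)))%C.
    - ring.
    - rewrite miPi_sqr. unfold ZtoC. rewrite opp_IZR, RtoC_opp, RtoC_mult. ring. }
  replace (/ (s + ZtoC k) + / (s + ZtoC (- k)))%C with
    (2 * miPi * (2 * miPi * s) * (1 + 1) * / ((2 * miPi * s) * (2 * miPi * s)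
       + 4 * 1 * (RtoC (PI * IZR k) * RtoC (PI * IZR k))))%C.
  - apply ctends_mult.
    + apply ctends_mult; [apply ctends_mult; [apply ctends_const|apply lim_one_minus_ce]|].
      apply ctends_plus; [apply ctends_const|apply lim_ce_div].
    + apply ctends_inv.
      * rewrite E. apply Cmult_neq_0; [|apply Cmult_neq_0; assumption].
        apply Cmult_neq_0; [|apply Cmult_neq_0; assumption].
        intros F. apply RtoC_inj in F. lra.
      * apply ctends_plus; [apply ctends_mult; apply lim_one_minus_ce|].
        apply ctends_mult; [apply ctends_mult; [apply ctends_const|apply lim_ce_div]|].
        apply ctends_mult; apply ctends_RtoC, lim_sin_scaled.
  - rewrite E.
    transitivity (8 * (miPi * miPi) * s *
       / (-4 * (PI * PI) * ((s + ZtoC k) * (s + ZtoC (- k)))))%C; [ring|].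
    rewrite miPi_sqr.
    replace (RtoC (-4)) with (- (4))%C by (rewrite <- RtoC_opp; reflexivity).
    unfold ZtoC in *. rewrite opp_IZR, RtoC_opp in *. field. repeat split; assumption.
Qed.

(** The majorant for [tannery]. In the denominator [d*d + 4*x*sn*sn] of [Ccot_pair], [|x| >= 1/2]
    and [sn >= a = j+1] give [|4 x sn^2| >= 2 a^2], while [|d| <= D <= a] once [j] is large; hence
    it is at least [a^2]. The numerator is bounded using [|d| <= D] and [|1 + x| <= 2]. *)
Lemma Ccot_pair_bound (s : C) : 0 < Im s ->
  exists K0 J0, forall K j, (K0 <= K)%nat -> (J0 <= j)%nat -> (j < K)%nat ->
   Cmod (/ INR (2 * K + 1) * (Ccot ((s + ZtoC (Z.of_nat (S j))) / INR (2 * K + 1))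
            + Ccot ((s + ZtoC (- Z.of_nat (S j))) / INR (2 * K + 1))))%C
   <= (2 * PI * (Cmod (2 * miPi * s) + 1) * 2) / (INR (S j)) ^ 2.
Proof.
  intros Hs.
  destruct (ctends_bounded _ _ (lim_one_minus_ce s)) as [K1 H1].
  destruct (lim_ce_div s (1 / 2)) as [K2 H2]; [lra|].
  set (D := Cmod (2 * miPi * s) + 1) in *.
  assert (HD : 1 <= D) by (unfold D; assert (P := Cmod_ge_0 (2 * miPi * s)); lra).
  destruct (INR_unbounded D) as [J0 HJ0].
  exists (K1 + K2)%nat, J0. intros K j HK Hj HjK.
  specialize (H1 K ltac:(lia)). specialize (H2 K ltac:(lia)).
  set (n := (2 * K + 1)%nat) in *.
  assert (Hn : (0 < n)%nat) by (unfold n; lia).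
  assert (Hr : 0 < INR n) by (apply lt_0_INR, Hn).
  rewrite (Ccot_pair n s (Z.of_nat (S j)) Hn Hs).
  set (x := ce (s / INR n)%C) in *.
  set (d := (INR n * (1 - x))%C) in *.
  set (sn := INR n * sin (PI * IZR (Z.of_nat (S j)) / INR n)).
  assert (Hx1 : Cmod x < 1).
  { apply Cmod_ce_lt. rewrite Im_div_nat by exact Hn.
    apply Rdiv_lt_0_compat; assumption. }
  assert (Hx2 : 1 / 2 <= Cmod x).
  { assert (T := Cmod_minus_ge 1 x). rewrite Cmod_1, Cmod_minus_sym in T. lra. }
  assert (PP := PI_RGT_0).
  set (a := INR (S j)) in *.
  assert (Ha : D <= a).
  { unfold a. apply Rle_trans with (INR J0); [lra|]. apply le_INR. lia. }
  assert (Hsn : a <= sn).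
  { unfold sn. rewrite <- INR_IZR_INZ. fold a.
    assert (Q : 0 <= PI * a / INR n <= PI / 2).
    { split.
      - apply Rmult_le_pos; [nra|]. left. apply Rinv_0_lt_compat, Hr.
      - apply Rle_div_l; [exact Hr|].
        assert (2 * a <= INR n); [|nra].
        unfold a. replace 2 with (INR 2) by (simpl; ring).
        rewrite <- mult_INR. apply le_INR. unfold n. lia. }
    assert (T := sin_ge_third _ Q).
    apply Rmult_le_compat_l with (r := INR n) in T; [|lra].
    replace (INR n * (PI * a / INR n / 3)) with (PI / 3 * a) in T by (field; lra).
    assert (P3 := PI2_3_2). nra. }
  assert (HE : a ^ 2 <= Cmod (d * d + 4 * x * (sn * sn))).
  { rewrite Cplus_comm.
    replace (4 * x * (sn * sn) + d * d)%C with (4 * x * (sn * sn) - - (d * d))%C by ring.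
    eapply Rle_trans; [|apply Cmod_minus_ge].
    rewrite Cmod_opp, !Cmod_mult, !Cmod_R, (Rabs_pos_eq 4), (Rabs_pos_eq sn) by lra.
    assert (0 <= Cmod d) by apply Cmod_ge_0.
    assert (Cmod d * Cmod d <= a * a) by nra.
    assert (a * a <= sn * sn) by nra.
    assert (2 * (sn * sn) <= 4 * Cmod x * (sn * sn)) by nra.
    simpl. nra. }
  assert (Pa : 0 < a ^ 2) by (apply pow_lt; lra).
  assert (NE : (d * d + 4 * x * (sn * sn))%C <> 0) by (apply Cmod_gt_0; lra).
  rewrite !Cmod_mult, Cmod_inv by exact NE.
  rewrite Cmod_miPi, Cmod_R, (Rabs_pos_eq 2) by lra.
  unfold Rdiv. apply Rmult_le_compat.
  - apply Rmult_le_pos; [|apply Cmod_ge_0]. apply Rmult_le_pos; [nra|apply Cmod_ge_0].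
  - left. apply Rinv_0_lt_compat. lra.
  - apply Rmult_le_compat; [|apply Cmod_ge_0| |].
    + apply Rmult_le_pos; [nra|apply Cmod_ge_0].
    + apply Rmult_le_compat_l; [nra|exact H1].
    + eapply Rle_trans; [apply Cmod_triangle|]. rewrite Cmod_1. lra.
  - apply Rinv_le_contravar; assumption.
Qed.

Theorem Ccot_partial_fractions (s : C) : 0 < Im s ->
  ctends (fun K => zsum (fun k => / (s + ZtoC k))%C K) (Ccot s).
Proof.
  intros Hs. assert (N0 : s <> 0) by (apply Im_neq_0; lra).
  destruct (Ccot_pair_bound s Hs) as (K0 & J0 & HB).
  assert (T := tannery _ _ _ K0 J0 (fun j => ctends_Ccot_pair s (Z.of_nat (S j)) Hs) HB).
  assert (L0 : ctends (fun K => / INR (2 * K + 1) * Ccot (s / INR (2 * K + 1)))%C (/ s)%C).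
  { assert (NM := miPi_neq_0).
    assert (N2 : RtoC 2 <> 0) by (intros F; apply RtoC_inj in F; lra).
    replace (/ s)%C with (miPi * (1 + 1) * / (2 * miPi * s))%C
      by (field; repeat split; assumption).
    apply ctends_ext with (fun K => miPi * (1 + ce (s / INR (2 * K + 1)))
      * / (INR (2 * K + 1) * (1 - ce (s / INR (2 * K + 1)))))%C.
    - intros K. unfold Ccot. field. split; [|apply RINR_neq_0; lia].
      apply ce_neq_1. rewrite Im_div_nat by lia.
      apply Rdiv_lt_0_compat; [exact Hs|]. apply lt_0_INR; lia.
    - apply ctends_mult.
      + apply ctends_scal, ctends_plus; [apply ctends_const|apply lim_ce_div].
      + apply ctends_inv; [|apply lim_one_minus_ce].
        apply Cmult_neq_0; [apply Cmult_neq_0|]; assumption. }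
  (* By [Ccot_euler], [Ccot s + 1/s], minus the [k = 0] term, minus the difference in [tannery], is
     exactly the symmetric partial sum. *)
  assert (L := ctends_minus _ _ _ _ (ctends_minus _ _ _ _
     (ctends_const (Ccot s + / s)%C) L0) T).
  replace (Ccot s + / s - / s - 0)%C with (Ccot s) in L by ring.
  eapply ctends_ext; [|exact L]. intros K. cbv beta.
  rewrite (Ccot_euler K s Hs) at 1. rewrite !zsum_pair.
  replace (ZtoC 0) with (RtoC 0) by reflexivity.
  rewrite !Cplus_0_r, csum_scal. ring.
Qed.

(** * The lattice sum *)

Definition w32 (x : R) : R := / (x * sqrt x).

Lemma w32_pos (x : R) : 0 < x -> 0 < w32 x.
Proof.
  intros H. apply Rinv_0_lt_compat, Rmult_lt_0_compat; [exact H|].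
  apply sqrt_lt_R0, H.
Qed.

(** With [s], [t] the two square roots, [t^2 - s^2 = 1] gives [1/s - 1/t = 1/(s t (s + t))], and
    [s (s + t) <= 2 t^2]. *)
Lemma w32_tele (x : R) : 0 < x -> w32 (x + 1) <= 2 * (/ sqrt x - / sqrt (x + 1)).
Proof.
  intros H. unfold w32.
  assert (Hs := sqrt_lt_R0 x H). assert (Ht := sqrt_lt_R0 (x + 1) ltac:(lra)).
  assert (Es := sqrt_sqrt x ltac:(lra)). assert (Et := sqrt_sqrt (x + 1) ltac:(lra)).
  assert (Hst : sqrt x <= sqrt (x + 1)) by (apply sqrt_le_1; lra).
  set (s := sqrt x) in *. set (t := sqrt (x + 1)) in *. rewrite <- Et.
  replace (/ s - / t) with (/ (s * t * (s + t))).
  - replace (2 * / (s * t * (s + t))) with (/ (s * t * (s + t) / 2)).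
    2:{ field. repeat split; nra. }
    apply Rinv_le_contravar.
    + apply Rdiv_lt_0_compat; [|lra]. repeat apply Rmult_lt_0_compat; lra.
    + assert (s * (s + t) <= 2 * t * t) by nra. nra.
  - assert (E : t * t - s * s = 1) by lra.
    replace (/ (s * t * (s + t))) with ((t * t - s * s) / (s * t * (s + t)))
      by (rewrite E; unfold Rdiv; ring).
    field. repeat split; nra.
Qed.

Lemma rsum_w32_tail (Y n : nat) : (1 <= Y)%nat ->
  rsum (fun j => w32 (INR (Y + S j))) n <= 2 / sqrt (INR Y).
Proof.
  intros HY.
  apply Rle_trans with (rsum (fun j => 2 * (/ sqrt (INR (Y + j)) - / sqrt (INR (Y + S j)))) n).
  - apply rsum_le. intros i _.
    replace (Y + S i)%nat with (S (Y + i)) by lia. rewrite S_INR.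
    apply w32_tele. apply lt_0_INR. lia.
  - rewrite rsum_scal, (rsum_tele (fun j => / sqrt (INR (Y + j)))), Nat.add_0_r.
    assert (P : 0 < / sqrt (INR (Y + n))).
    { apply Rinv_0_lt_compat, sqrt_lt_R0, lt_0_INR. lia. }
    unfold Rdiv. lra.
Qed.

Lemma rsum_w32 (n : nat) : rsum (fun i => w32 (INR (S i))) n <= 3.
Proof.
  destruct n as [|n]; [simpl; lra|].
  assert (E : forall f m, rsum f (S m) = f O + rsum (fun i => f (S i)) m).
  { intros f m. induction m as [|m IH]; [simpl; ring|].
    change (rsum f (S (S m))) with (rsum f (S m) + f (S m)). rewrite IH. simpl. ring. }
  rewrite E.
  assert (T := rsum_w32_tail 1 n (le_n _)). simpl INR in T at 2.
  rewrite sqrt_1 in T.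
  assert (A : w32 (INR 1) = 1) by (unfold w32; simpl; rewrite sqrt_1; field).
  rewrite A. simpl (1 + _)%nat in T. lra.
Qed.

Section quadratic.
Variables (a y : R).
Hypotheses (Ha : 0 < a) (Hy : 0 < y).

Lemma sqr_sum_ge_mul : a * y <= a ^ 2 + y ^ 2.
Proof. assert (H := pow2_ge_0 (a - y)). nra. Qed.

(** The split 1/2 + 3/2 is chosen for the double sum: [y^(-3/2)] is summable, and the remaining
    [a^(-1/2)] becomes summable with the factor [1/a] of the lattice terms. *)
Lemma sqr_sum_ge_32 : sqrt a * (y * sqrt y) <= a ^ 2 + y ^ 2.
Proof.
  assert (A := sqrt_sqrt a ltac:(lra)). assert (B := sqrt_sqrt y ltac:(lra)).
  assert (A' := sqrt_lt_R0 a Ha). assert (B' := sqrt_lt_R0 y Hy).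
  set (s := sqrt a) in *. set (t := sqrt y) in *.
  destruct (Rle_dec s t) as [H|H].
  - assert (s * t <= y) by (rewrite <- B; nra).
    assert (s * t * y <= y * y) by (apply Rmult_le_compat_r; lra).
    assert (0 <= a ^ 2) by apply pow2_ge_0. nra.
  - assert (t * t <= s * s) by nra. assert (t * s <= s * s) by nra.
    assert (s * (y * t) <= a * a).
    { rewrite <- A at 1. rewrite <- A, <- B.
      replace (s * (t * t * t)) with ((t * t) * (t * s)) by ring.
      apply Rmult_le_compat; nra. }
    assert (0 <= y ^ 2) by apply pow2_ge_0. nra.
Qed.

End quadratic.

Lemma lattice_norm (w : C) : 0 < Im w ->
  exists d, 0 < d /\ forall a t : R, d * (a ^ 2 + t ^ 2) <= Cmod (a * w + t) ^ 2.
Proof.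
  intros Hw. destruct w as [x v]. simpl in Hw.
  assert (P : 0 < 1 + x ^ 2 + v ^ 2).
  { assert (0 <= x ^ 2) by apply pow2_ge_0. assert (0 <= v ^ 2) by apply pow2_ge_0. lra. }
  (* Determinant over trace: a lower bound for the least eigenvalue. *)
  set (d := v ^ 2 / (1 + x ^ 2 + v ^ 2)).
  assert (E : d * (1 + x ^ 2 + v ^ 2) = v ^ 2) by (unfold d; field; lra).
  assert (Pd : 0 < d) by (apply Rdiv_lt_0_compat; nra).
  assert (Pd1 : d < 1).
  { unfold d. apply Rlt_div_l; [exact P|]. assert (0 <= x ^ 2) by apply pow2_ge_0. lra. }
  exists d. split; [exact Pd|]. intros a t.
  rewrite Cmod2_alt. simpl Re. simpl Im.
  (* Completing the square in [t]: its coefficient is [1 - d], so multiplying by it gives a sum of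
     two squares. *)
  assert (Q : (1 - d) * ((a * x - 0 * v + t) ^ 2 + (a * v + 0 * x + 0) ^ 2 - d * (a ^ 2 + t ^ 2))
     = ((1 - d) * t + a * x) ^ 2 + d ^ 2 * a ^ 2).
  { transitivity (((1 - d) * t + a * x) ^ 2 + (v ^ 2 - d * (1 + x ^ 2 + v ^ 2) + d ^ 2) * a ^ 2);
      [ring|]. rewrite E. ring. }
  assert (0 <= ((1 - d) * t + a * x) ^ 2) by apply pow2_ge_0.
  assert (0 <= d ^ 2 * a ^ 2) by (apply Rmult_le_pos; apply pow2_ge_0).
  nra.
Qed.

Lemma sqr_le_sqr_inv (x y : R) : 0 < y -> 0 <= x -> y ^ 2 <= x ^ 2 -> / x <= / y.
Proof.
  intros Hy Hx H. apply Rinv_le_contravar; [exact Hy|]. nra.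
Qed.

Section tail.
Variables (w : C) (d : R).
Hypotheses (Hd : 0 < d)
  (Hlow : forall a t : R, d * (a ^ 2 + t ^ 2) <= Cmod (a * w + t) ^ 2).

Lemma lattice_neq_0 (a t : R) : 0 < a -> (a * w + t)%C <> 0.
Proof.
  intros Ha E. specialize (Hlow a t). rewrite E, Cmod_0 in Hlow.
  assert (0 <= t ^ 2) by apply pow2_ge_0. assert (0 < a ^ 2) by (apply pow_lt, Ha).
  assert (0 < d * (a ^ 2 + t ^ 2)) by (apply Rmult_lt_0_compat; lra). simpl in *. lra.
Qed.

Lemma inv_mul_bound (a t t' : R) : 0 < a -> t ^ 2 <= t' ^ 2 ->
  Cmod (/ ((a * w + t) * (a * w + t'))) <= / (d * (a ^ 2 + t ^ 2)).
Proof.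
  intros Ha Ht. assert (N := lattice_neq_0 a t Ha). assert (N' := lattice_neq_0 a t' Ha).
  rewrite Cmod_inv by (apply Cmult_neq_0; assumption). rewrite Cmod_mult.
  assert (H1 := Hlow a t). assert (H2 := Hlow a t').
  assert (P : 0 < d * (a ^ 2 + t ^ 2)).
  { apply Rmult_lt_0_compat; [exact Hd|]. assert (0 <= t ^ 2) by apply pow2_ge_0.
    assert (0 < a ^ 2) by (apply pow_lt, Ha). lra. }
  apply Rinv_le_contravar; [exact P|].
  assert (G1 := Cmod_ge_0 (a * w + t)). assert (G2 := Cmod_ge_0 (a * w + t')).
  set (m := Cmod (a * w + t)) in *. set (m' := Cmod (a * w + t')) in *.
  assert (d * (a ^ 2 + t ^ 2) <= d * (a ^ 2 + t' ^ 2)) by (apply Rmult_le_compat_l; lra).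
  set (b := d * (a ^ 2 + t ^ 2)) in *.
  assert (Hb : b ^ 2 <= (m * m') ^ 2).
  { rewrite Rpow_mult_distr. simpl. simpl in H1, H2. nra. }
  assert (0 <= m * m') by nra. nra.
Qed.

(** Summation by parts in [y], with [e] the sign of [y]. The boundary term uses [a y <= a^2 + y^2];
    the variation is a sum of products of consecutive inverses, each at most [1/(d (a^2 + y^2))], to
    which [sqr_sum_ge_32] applies. *)
Lemma tail_in_y (g : nat -> C) (M e : R) (A Y n : nat) :
  0 <= M -> e ^ 2 = 1 -> (1 <= A)%nat -> (1 <= Y)%nat ->
  (forall m, Cmod (csum g m) <= M) ->
  Cmod (csum (fun j => g j * / (INR A * w + e * INR (Y + S j)))%C n)
    <= M * (/ sqrt d + 2 / d) * (/ sqrt (INR A) * / sqrt (INR Y)).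
Proof.
  intros HM He HA HY Hg.
  assert (PA : 0 < INR A) by (apply lt_0_INR; lia).
  assert (PY : 0 < INR Y) by (apply lt_0_INR; lia).
  assert (sA := sqrt_lt_R0 _ PA). assert (sY := sqrt_lt_R0 _ PY).
  assert (sd := sqrt_lt_R0 _ Hd).
  assert (N : forall j, (INR A * w + e * INR (Y + S j))%C <> 0).
  { intros j. rewrite <- RtoC_mult. apply lattice_neq_0, PA. }
  eapply Rle_trans; [apply (abel_bound g _ M n); intros; apply Hg|].
  rewrite Rmult_assoc. apply Rmult_le_compat_l; [exact HM|].
  rewrite Rmult_plus_distr_r. apply Rplus_le_compat.
  - rewrite Cmod_inv by apply N.
    rewrite <- !Rinv_mult. set (t := INR (Y + S (n - 1))).
    assert (Ht : INR Y <= t) by (apply le_INR; lia).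
    apply sqr_le_sqr_inv; [|apply Cmod_ge_0|].
    { repeat apply Rmult_lt_0_compat; assumption. }
    rewrite !Rpow_mult_distr. simpl pow. rewrite !Rmult_1_r.
    rewrite !sqrt_sqrt by lra.
    rewrite <- RtoC_mult. eapply Rle_trans; [|generalize (Hlow (INR A) (e * t)); simpl; rewrite !Rmult_1_r; intros Q; exact Q].
    apply Rmult_le_compat_l; [lra|].
    replace (e * t * (e * t)) with (t ^ 2) by (rewrite <- (Rmult_1_l (t ^ 2)), <- He; ring).
    assert (Q := sqr_sum_ge_mul (INR A) t). simpl in *. nra.
  - apply Rle_trans with (rsum (fun j => / d * / sqrt (INR A) * w32 (INR (Y + S j))) (n - 1)).
    + apply rsum_le. intros j _.
      assert (N1 := N j). assert (N2 := N (S j)).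
      set (t := INR (Y + S j)) in *.
      assert (Et : INR (Y + S (S j)) = t + 1).
      { unfold t. rewrite <- S_INR. f_equal. lia. }
      rewrite Et in *.
      assert (Pt : 0 < t) by (apply lt_0_INR; lia).
      replace (/ (INR A * w + e * t) - / (INR A * w + e * RtoC (t + 1)))%C
        with (e * / ((INR A * w + RtoC (e * t)) * (INR A * w + RtoC (e * (t + 1)))))%C.
      2:{ rewrite !RtoC_mult, !RtoC_plus in *. field. split; assumption. }
      rewrite Cmod_mult, Cmod_R.
      replace (Rabs e) with 1.
      2:{ rewrite <- (sqrt_1), <- He. rewrite <- Rsqr_pow2. apply sqrt_Rsqr_abs. }
      rewrite Rmult_1_l. eapply Rle_trans.
      { apply inv_mul_bound; [exact PA|]. rewrite !Rpow_mult_distr, He. nra. }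
      unfold w32. rewrite Rinv_mult, Rmult_assoc.
      apply Rmult_le_compat_l; [left; apply Rinv_0_lt_compat, Hd|].
      rewrite <- Rinv_mult. apply Rinv_le_contravar.
      * assert (sT := sqrt_lt_R0 _ Pt). repeat apply Rmult_lt_0_compat; assumption.
      * rewrite Rpow_mult_distr, He, Rmult_1_l. apply sqr_sum_ge_32; assumption.
    + rewrite rsum_scal.
      eapply Rle_trans; [apply Rmult_le_compat_l|].
      * apply Rmult_le_pos; left; apply Rinv_0_lt_compat; assumption.
      * apply rsum_w32_tail, HY.
      * right. field. repeat split; lra.
Qed.

(** Here [2w/((aw + y)(aw - y))] is the sum of [1/(a(aw + y))] and [1/(a(aw - y))], so pairing [y]
    with [-y] removes the factor [1/a]. Summation by parts in [a] then gives a decay [y^(-3/2)] that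
    does not depend on [A]. *)
Lemma tail_in_a (g : nat -> C) (M y : R) (A : nat) :
  0 <= M -> 0 < y -> (forall m, Cmod (csum g m) <= M) ->
  Cmod (csum (fun i => g i * (2 * w * / ((INR (S i) * w + y) * (INR (S i) * w + - y))))%C A)
    <= M * (2 * Cmod w / d + 18 * Cmod w ^ 3 / d ^ 2) * w32 y.
Proof.
  intros HM Hy Hg.
  assert (sy := sqrt_lt_R0 _ Hy). assert (Py := w32_pos y Hy).
  assert (Gw := Cmod_ge_0 w).
  assert (N : forall i (t : R), (INR (S i) * w + t)%C <> 0).
  { intros i t. apply lattice_neq_0, lt_0_INR. lia. }
  assert (B : forall i, Cmod (/ ((INR (S i) * w + y) * (INR (S i) * w + RtoC (- y))))
      <= / (d * (INR (S i) ^ 2 + y ^ 2))).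
  { intros i. apply inv_mul_bound; [apply lt_0_INR; lia|]. right; ring. }
  eapply Rle_trans; [apply (abel_bound g _ M A); intros; apply Hg|].
  rewrite Rmult_assoc. apply Rmult_le_compat_l; [exact HM|].
  rewrite Rmult_plus_distr_r. apply Rplus_le_compat.
  - rewrite !Cmod_mult, Cmod_R, (Rabs_pos_eq 2) by lra.
    unfold Rdiv. rewrite Rmult_assoc. rewrite (Rmult_assoc _ (/ d)).
    rewrite <- !Rmult_assoc, (Rmult_assoc _ (/ d)).
    apply Rmult_le_compat_l; [lra|].
    set (i := (A - 1)%nat). specialize (B i). rewrite RtoC_opp in B.
    eapply Rle_trans; [exact B|]. unfold w32. rewrite <- Rinv_mult.
    apply Rinv_le_contravar; [repeat apply Rmult_lt_0_compat; assumption|].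
    apply Rmult_le_compat_l; [lra|].
    assert (P1 : 1 <= INR (S i)).
    { rewrite S_INR. assert (Q := pos_INR i). lra. }
    assert (Q := sqr_sum_ge_32 (INR (S i)) y ltac:(lra) Hy).
    assert (1 <= sqrt (INR (S i))) by (rewrite <- sqrt_1; apply sqrt_le_1; lra).
    assert (0 < y * sqrt y) by (apply Rmult_lt_0_compat; assumption). nra.
  - apply Rle_trans with (rsum (fun i => 6 * Cmod w ^ 3 / d ^ 2 * w32 y * w32 (INR (S i))) (A - 1)).
    + apply rsum_le. intros i _.
      set (a := INR (S i)).
      assert (Ea : INR (S (S i)) = a + 1) by (unfold a; rewrite <- S_INR; reflexivity).
      assert (Pa : 1 <= a).
      { unfold a. rewrite S_INR. assert (Q := pos_INR i). lra. }
      assert (B1 := B i). assert (B2 := B (S i)). rewrite Ea in B2. fold a in B1.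
      assert (N1 := N i y). assert (N2 := N i (- y)).
      assert (N3 := N (S i) y). assert (N4 := N (S i) (- y)).
      rewrite Ea in *. fold a in N1, N2.
      rewrite RtoC_opp in *.
      replace (2 * w * / ((a * w + y) * (a * w + - y))
         - 2 * w * / ((RtoC (a + 1) * w + y) * (RtoC (a + 1) * w + - y)))%C
        with (2 * (w * w * w) * RtoC (2 * a + 1) * / ((a * w + y) * (a * w + - y))
               * / ((RtoC (a + 1) * w + y) * (RtoC (a + 1) * w + - y)))%C.
      2:{ rewrite !RtoC_plus, !RtoC_mult in *. field. repeat split; assumption. }
      rewrite !Cmod_mult, !Cmod_R, (Rabs_pos_eq 2), (Rabs_pos_eq (2 * a + 1)) by lra.
      assert (Pq : 0 < d * (a ^ 2 + y ^ 2)).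
      { apply Rmult_lt_0_compat; [exact Hd|]. nra. }
      assert (B3 : / (d * ((a + 1) ^ 2 + y ^ 2)) <= / (d * (a ^ 2 + y ^ 2))).
      { apply Rinv_le_contravar; [exact Pq|]. apply Rmult_le_compat_l; nra. }
      set (v1 := Cmod (/ ((a * w + y) * (a * w + - y)))) in *.
      set (v2 := Cmod (/ ((RtoC (a + 1) * w + y) * (RtoC (a + 1) * w + - y)))) in *.
      assert (G1 : 0 <= v1) by apply Cmod_ge_0.
      assert (G2 : 0 <= v2) by apply Cmod_ge_0.
      set (m := Cmod w) in *.
      apply Rle_trans with (2 * (m * m * m) * (3 * a) * (/ (d * (a ^ 2 + y ^ 2)) * / (d * (a ^ 2 + y ^ 2)))).
      * rewrite Rmult_assoc. assert (Gm : 0 <= m * m * m) by (repeat apply Rmult_le_pos; lra).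
        apply Rmult_le_compat.
        -- apply Rmult_le_pos; lra.
        -- apply Rmult_le_pos; lra.
        -- apply Rmult_le_compat_l; lra.
        -- apply Rmult_le_compat; lra.
      * assert (sa := sqrt_lt_R0 a ltac:(lra)).
        assert (W : a * / ((a ^ 2 + y ^ 2) * (a ^ 2 + y ^ 2)) <= w32 y * w32 a).
        { unfold w32. rewrite <- Rinv_mult.
          assert (PP : 0 < a ^ 2 + y ^ 2) by nra.
          apply Rmult_le_reg_r with ((a ^ 2 + y ^ 2) * (a ^ 2 + y ^ 2)); [nra|].
          rewrite Rmult_assoc, Rinv_l, Rmult_1_r by nra.
          assert (PR : 0 < y * sqrt y * (a * sqrt a)) by (repeat apply Rmult_lt_0_compat; lra).
          apply Rmult_le_reg_l with (y * sqrt y * (a * sqrt a)); [exact PR|].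
          rewrite <- (Rmult_assoc _ (/ _)), Rinv_r, Rmult_1_l by lra.
          replace (y * sqrt y * (a * sqrt a) * a) with ((a * y) * (sqrt y * (a * sqrt a))) by ring.
          assert (Q1 := sqr_sum_ge_mul a y).
          assert (Q2 := sqr_sum_ge_32 y a Hy ltac:(lra)).
          apply Rmult_le_compat; try lra.
          - nra.
          - apply Rmult_le_pos; [lra|]. nra. }
        replace (2 * (m * m * m) * (3 * a) * (/ (d * (a ^ 2 + y ^ 2)) * / (d * (a ^ 2 + y ^ 2))))
          with (6 * m ^ 3 / d ^ 2 * (a * / ((a ^ 2 + y ^ 2) * (a ^ 2 + y ^ 2)))).
        2:{ field. split; [nra|lra]. }
        rewrite Rmult_assoc. apply Rmult_le_compat_l; [|exact W].
        apply Rmult_le_pos; [|left; apply Rinv_0_lt_compat, pow_lt, Hd].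
        apply Rmult_le_pos; [lra|]. apply pow_le, Gw.
    + rewrite rsum_scal.
      eapply Rle_trans; [apply Rmult_le_compat_l; [|apply rsum_w32]|].
      * apply Rmult_le_pos; [|lra]. apply Rmult_le_pos.
        -- apply Rmult_le_pos; [lra|]. apply pow_le, Gw.
        -- left; apply Rinv_0_lt_compat, pow_lt, Hd.
      * right. field. lra.
Qed.

End tail.

(** Complete periods cancel, and fewer than [n] terms remain. *)
Lemma partial_sum_bound (n : nat) (w : Z -> C) (B : R) (x : Z) (m : nat) :
  (0 < n)%nat -> periodic n w -> csum (fun b => w (Z.of_nat b)) n = 0 ->
  (forall y, Cmod (w y) <= B) ->
  Cmod (csum (fun i => w (x + Z.of_nat i)%Z) m) <= INR n * B.
Proof.
  intros Hn H H0 HB.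
  assert (E := Nat.div_mod m n ltac:(lia)).
  assert (L := Nat.mod_upper_bound m n ltac:(lia)).
  rewrite E, Nat.mul_comm, csum_app, csum_mul, csum_zero.
  - rewrite Cplus_0_l. eapply Rle_trans; [apply csum_norm_const; intros; apply HB|].
    apply Rmult_le_compat_r.
    + eapply Rle_trans; [apply Cmod_ge_0|apply (HB 0%Z)].
    + apply le_INR. lia.
  - intros k _. rewrite <- H0, <- (csum_shift n w (x + Z.of_nat (k * n))%Z) by assumption.
    apply csum_ext. intros i _. f_equal. lia.
Qed.

Definition null_at_infinity (v : Z -> C) : Prop :=
  forall eps, 0 < eps -> exists B, forall y, (B <= Z.abs y)%Z -> Cmod (v y) < eps.

Lemma null_over_linear (v : Z -> C) (M : R) (X : C) :
  (forall y, Cmod (v y) <= M) -> (forall y, (X + ZtoC y)%C <> 0) ->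
  null_at_infinity (fun y => v y * / (X + ZtoC y))%C.
Proof.
  intros HM N eps He.
  assert (M0 : 0 <= M) by (eapply Rle_trans; [apply Cmod_ge_0|apply (HM 0%Z)]).
  exists (up (M / eps + Cmod X + 1)). intros y Hy.
  destruct (archimed (M / eps + Cmod X + 1)) as [U _].
  apply IZR_le in Hy. rewrite abs_IZR in Hy.
  rewrite Cmod_mult, Cmod_inv by apply N.
  assert (L : M / eps < Cmod (X + ZtoC y)).
  { rewrite Cplus_comm. replace (ZtoC y + X)%C with (ZtoC y - - X)%C by ring.
    eapply Rlt_le_trans; [|apply Cmod_minus_ge].
    unfold ZtoC. rewrite Cmod_R, Cmod_opp. lra. }
  assert (P : 0 < Cmod (X + ZtoC y)) by (apply Cmod_gt_0, N).
  apply Rle_lt_trans with (M * / Cmod (X + ZtoC y)).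
  - apply Rmult_le_compat_r; [left; apply Rinv_0_lt_compat, P|apply HM].
  - apply Rlt_div_l; [exact P|]. apply Rlt_div_l in L; [|exact He]. lra.
Qed.

Lemma null_ctends (v : Z -> C) (p : nat -> Z) (m : Z) : null_at_infinity v ->
  (forall n, (Z.of_nat n <= Z.abs (p n) + m)%Z) -> ctends (fun n => v (p n)) 0.
Proof.
  intros Hv Hp eps He. destruct (Hv eps He) as [B HB].
  exists (Z.to_nat (Z.max 0 (B + m))). intros n Hn.
  replace (v (p n) - 0)%C with (v (p n)) by ring. apply HB.
  specialize (Hp n). lia.
Qed.

Lemma zsum_minus (F G : Z -> C) (K : nat) :
  zsum (fun k => F k - G k)%C K = (zsum F K - zsum G K)%C.
Proof. apply csum_minus. Qed.

Lemma zsum_step (v : Z -> C) (h : Z) : null_at_infinity v ->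
  ctends (zsum (fun a => v (a + h)%Z - v (a + h + 1)%Z)%C) 0.
Proof.
  intros Hv.
  apply (ctends_ext (fun A => v (h - Z.of_nat A)%Z - v (Z.of_nat A + h + 1)%Z)%C).
  - intros A. unfold zsum.
    assert (T : forall n, csum (fun i => v (Z.of_nat i - Z.of_nat A + h)%Z
        - v (Z.of_nat i - Z.of_nat A + h + 1)%Z)%C n
       = (v (h - Z.of_nat A)%Z - v (Z.of_nat n - Z.of_nat A + h)%Z)%C).
    { induction n as [|n IH].
      - simpl csum. replace (Z.of_nat 0 - Z.of_nat A + h)%Z with (h - Z.of_nat A)%Z by lia.
        ring.
      - simpl csum. rewrite IH.
        replace (Z.of_nat (S n) - Z.of_nat A + h)%Z
          with (Z.of_nat n - Z.of_nat A + h + 1)%Z by lia. ring. }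
    rewrite T. replace (Z.of_nat (2 * A + 1) - Z.of_nat A + h)%Z
      with (Z.of_nat A + h + 1)%Z by lia. reflexivity.
  - replace (RtoC 0) with (0 - 0)%C by ring. apply ctends_minus.
    + apply (null_ctends v _ (Z.abs h)); [exact Hv|]. intros; lia.
    + apply (null_ctends v _ (Z.abs h + 1)); [exact Hv|]. intros; lia.
Qed.

(** A fixed shift changes a symmetric window only by boundedly many terms at its two ends. The
    series of [v] itself is not assumed to converge. *)
Lemma zsum_shift_null (v : Z -> C) (H : Z) : null_at_infinity v ->
  ctends (zsum (fun a => v a - v (a + H)%Z)%C) 0.
Proof.
  intros Hv. induction H as [|H IH|H IH] using Z.peano_ind.
  - apply (ctends_ext (fun _ => RtoC 0)); [|apply ctends_const].
    intros n. symmetry. apply csum_zero. intros i _. rewrite Z.add_0_r. ring.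
  - assert (L := ctends_plus _ _ _ _ IH (zsum_step v H Hv)).
    rewrite Cplus_0_l in L. eapply ctends_ext; [|exact L].
    intros n. cbv beta. unfold zsum. rewrite <- csum_plus. apply csum_ext.
    intros i _. rewrite <- Z.add_1_r, Z.add_assoc. ring.
  - assert (L := ctends_minus _ _ _ _ IH (zsum_step v (Z.pred H) Hv)).
    replace (0 - 0)%C with (RtoC 0) in L by ring. eapply ctends_ext; [|exact L].
    intros n. cbv beta. rewrite <- zsum_minus. apply zsum_ext.
    intros a. replace (a + Z.pred H + 1)%Z with (a + H)%Z by lia. ring.
Qed.

(** The sum is split by residues modulo [P], and partial fractions apply to each class. *)
Lemma Ccot_periodic_sum (P : nat) (g : Z -> C) (t : C) :
  (0 < P)%nat -> periodic P g -> 0 < Im t ->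
  ctends (fun K => zsum (fun y => g y * / (t + ZtoC y))%C (P * K))
    (/ INR P * csum (fun j => g (Z.of_nat j) * Ccot ((t + ZtoC (Z.of_nat j)) / INR P)) P)%C.
Proof.
  intros HP Hg Ht.
  assert (NP := RINR_neq_0 P HP). assert (RP : 0 < INR P) by (apply lt_0_INR, HP).
  set (F := fun y => (g y * / (t + ZtoC y))%C).
  destruct (periodic_bounded P g HP Hg) as (M & HM & Hb).
  assert (HF : null_at_infinity F).
  { apply (null_over_linear g M); [exact Hb|]. intros y. apply add_Z_neq_0. lra. }
  assert (L1 : ctends (fun K => csum (fun i => F (Z.of_nat i - Z.of_nat (P * K))%Z)
      ((2 * K + 1) * P))
     (/ INR P * csum (fun j => g (Z.of_nat j) * Ccot ((t + ZtoC (Z.of_nat j)) / INR P)) P)%C).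
  { rewrite <- csum_scal.
    apply (ctends_ext (fun K => csum (fun j => / INR P * g (Z.of_nat j) *
       zsum (fun k => / ((t + ZtoC (Z.of_nat j)) / INR P + ZtoC k))%C K)%C P)).
    - intros K. rewrite csum_mul, csum_swap. apply csum_ext. intros i _.
      unfold zsum. rewrite <- csum_scal. apply csum_ext. intros k _. unfold F.
      replace (Z.of_nat (k * P + i) - Z.of_nat (P * K))%Z
        with (Z.of_nat i + (Z.of_nat k - Z.of_nat K) * Z.of_nat P)%Z by lia.
      rewrite (periodic_cong P g Hg (_ + _) (Z.of_nat i)).
      2:{ exists (Z.of_nat k - Z.of_nat K)%Z. ring. }
      assert (N : (t + ZtoC (Z.of_nat i + (Z.of_nat k - Z.of_nat K) * Z.of_nat P))%C <> 0)
        by (apply add_Z_neq_0; lra).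
      unfold ZtoC in *. rewrite plus_IZR, mult_IZR, <- (INR_IZR_INZ P) in *.
      rewrite RtoC_plus, RtoC_mult in *. field. split; [|exact NP].
      intros E. apply N. rewrite <- E. ring.
    - apply ctends_csum. intros j _. rewrite Cmult_assoc. apply ctends_scal.
      apply Ccot_partial_fractions. rewrite Im_div_nat, Im_plus_Z by exact HP.
      apply Rdiv_lt_0_compat; assumption. }
  (* Symmetric windows in every residue class cover [-PK] to [PK + P - 1]. The last [P - 1] terms
     exceed the symmetric window and tend to 0. *)
  assert (L2 : ctends (fun K => csum (fun i => F (Z.of_nat (P * K + 1 + i))) (P - 1)) 0).
  { replace (RtoC 0) with (csum (fun _ => RtoC 0) (P - 1)) by (apply csum_zero; reflexivity).
    apply (ctends_csum (fun K i => F (Z.of_nat (P * K + 1 + i)))). intros i _.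
    apply (null_ctends F _ 0); [exact HF|]. intros n. nia. }
  assert (L := ctends_minus _ _ _ _ L1 L2).
  match type of L with ctends _ ?l => match goal with |- ctends _ ?m =>
    replace m with l by ring end end.
  eapply ctends_ext; [|exact L]. intros K. cbv beta.
  replace ((2 * K + 1) * P)%nat with ((2 * (P * K) + 1) + (P - 1))%nat by nia.
  rewrite csum_app. unfold zsum.
  rewrite (csum_ext (fun i => F (Z.of_nat (2 * (P * K) + 1 + i) - Z.of_nat (P * K))%Z)
    (fun i => F (Z.of_nat (P * K + 1 + i)))) by (intros; f_equal; lia).
  ring.
Qed.

(** * The conditionally convergent double series and its invariance *)

Section lattice.
Variables (P : nat) (chi : Z -> C) (W : Z -> Z -> C) (M : R) (kappa : C).
Hypotheses (HP : (0 < P)%nat)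
  (Hchi : forall a, Cmod (chi a) <= M)
  (Hchisum : forall m, Cmod (csum (fun i => chi (Z.of_nat (S i))) m) <= M)
  (HW : forall a y, Cmod (W a y) <= M)
  (HWper : forall a, periodic P (W a))
  (HWsum : forall a, csum (fun j => W a (Z.of_nat j)) P = kappa)
  (HW0 : forall a, (chi a * W a 0%Z)%C = 0)
  (Hpar : forall a y, (chi (- a)%Z * W (- a)%Z (- y)%Z)%C = (chi a * W a y)%C)
  (Hchi0 : chi 0%Z = 0).

Definition lterm (w : C) (a y : Z) : C :=
  (chi a * W a y * / (ZtoC a * (ZtoC a * w + ZtoC y)))%C.

(** Rectangular partial sum with [y] and [-y] paired, as the estimates require. The row [y = 0] is
    absent, its weight being zero by [HW0]. *)
Definition lbox (w : C) (A Y : nat) : C :=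
  csum (fun i => csum (fun j => lterm w (Z.of_nat (S i)) (Z.of_nat (S j))
     + lterm w (Z.of_nat (S i)) (- Z.of_nat (S j)))%C Y) A.

Lemma lattice_Z_neq_0 (w : C) (a y : Z) : 0 < Im w -> (a <> 0)%Z ->
  (ZtoC a * w + ZtoC y)%C <> 0.
Proof.
  intros Hw Ha. apply add_Z_neq_0. unfold ZtoC. rewrite im_scal_l.
  apply Rmult_integral_contrapositive_currified; [apply not_0_IZR, Ha|lra].
Qed.

Lemma M_nonneg : 0 <= M.
Proof. eapply Rle_trans; [apply Cmod_ge_0|apply (Hchi 0%Z)]. Qed.

(** The part of mean zero in [y]. The mean [kappa / P] is the same for all [a], so in the other part
    the only dependence of the weight on [a] is [chi a]. *)
Definition Wc (a y : Z) : C := (W a y - kappa / INR P)%C.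

Lemma Wc_norm (a y : Z) : Cmod (Wc a y) <= 2 * M.
Proof.
  unfold Wc. eapply Rle_trans; [apply Cmod_minus_le|].
  assert (K : Cmod (kappa / INR P) <= M); [|specialize (HW a y); lra].
  assert (RP : 0 < INR P) by (apply lt_0_INR, HP).
  rewrite Cmod_div, Cmod_R, Rabs_pos_eq by (lra || apply RINR_neq_0, HP).
  apply Rle_div_l; [exact RP|]. rewrite <- (HWsum 0%Z), Rmult_comm.
  apply csum_norm_const. intros; apply HW.
Qed.

Lemma Wc_partial (a : Z) (e : Z) (Y m : nat) : (e = 1 \/ e = -1)%Z ->
  Cmod (csum (fun j => Wc a (e * Z.of_nat (Y + S j))) m) <= INR P * (2 * M).
Proof.
  intros He.
  rewrite (csum_ext _ (fun j => (fun y => Wc a (e * y)) (Z.of_nat (S Y) + Z.of_nat j)%Z))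
    by (intros; do 2 f_equal; lia).
  assert (Q : periodic P (fun y => W a (e * y))).
  { intros y. destruct He as [-> | ->].
    - rewrite !Z.mul_1_l. apply HWper.
    - rewrite <- (HWper a (-1 * (y + Z.of_nat P))%Z). f_equal. ring. }
  apply (partial_sum_bound P (fun y => Wc a (e * y)));
    [exact HP| | |intros; apply Wc_norm].
  - intros y. unfold Wc. f_equal. apply Q.
  - unfold Wc. rewrite csum_minus, csum_const.
    rewrite (csum_dilate P (W a) e HP (HWper a)), HWsum.
    + field. apply RINR_neq_0, HP.
    + destruct He as [-> | ->]; [apply Z.gcd_1_l|].
      change (-1)%Z with (- (1))%Z. rewrite Z.gcd_opp_l. apply Z.gcd_1_l.
Qed.

(** The double series converges only conditionally. The part of the weight with
    mean zero in [y] is summed by parts in [y]; the rest, [chi a * kappa / P], is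
    summed by parts in [a]. *)
Lemma lbox_tail (w : C) : 0 < Im w -> exists c, 0 <= c /\
  forall A Y n, (1 <= Y)%nat -> Cmod (lbox w A (Y + n) - lbox w A Y) <= c * / sqrt (INR Y).
Proof.
  intros Hw. destruct (lattice_norm w Hw) as (d & Hd & Hlow).
  assert (M0 := M_nonneg). assert (RP : 0 < INR P) by (apply lt_0_INR, HP).
  assert (sd := sqrt_lt_R0 _ Hd).
  set (c1 := INR P * (2 * M) * (/ sqrt d + 2 / d)).
  set (c2 := M * (2 * Cmod w / d + 18 * Cmod w ^ 3 / d ^ 2)).
  set (k := (kappa / INR P)%C).
  assert (P1 : 0 <= c1).
  { unfold c1. apply Rmult_le_pos; [apply Rmult_le_pos; lra|].
    assert (0 < / sqrt d) by (apply Rinv_0_lt_compat, sd).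
    assert (0 < 2 / d) by (apply Rdiv_lt_0_compat; lra). lra. }
  assert (P2 : 0 <= c2).
  { unfold c2. assert (G := Cmod_ge_0 w). apply Rmult_le_pos; [exact M0|].
    assert (0 <= 2 * Cmod w / d).
    { apply Rmult_le_pos; [lra|]. left. apply Rinv_0_lt_compat, Hd. }
    assert (0 <= 18 * Cmod w ^ 3 / d ^ 2); [|lra].
    apply Rmult_le_pos; [|left; apply Rinv_0_lt_compat, pow_lt, Hd].
    apply Rmult_le_pos; [lra|apply pow_le, G]. }
  assert (Gk := Cmod_ge_0 k).
  (* The 6 is two signs of [y] times the bound 3 on the sum of [w32]; the 2 comes from
     [rsum_w32_tail]. *)
  exists (6 * M * c1 + 2 * (Cmod k * c2)). split.
  { apply Rplus_le_le_0_compat; apply Rmult_le_pos; nra. }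
  intros A Y n HY.
  assert (PY : 0 < INR Y) by (apply lt_0_INR; lia).
  assert (sY := sqrt_lt_R0 _ PY). assert (sY' := Rinv_0_lt_compat _ sY).
  unfold lbox. rewrite <- csum_minus.
  set (h := fun e i j => (Wc (Z.of_nat (S i)) (e * Z.of_nat (Y + S j))
      * / (INR (S i) * w + RtoC (IZR e) * INR (Y + S j)))%C).
  set (q := fun i j => (2 * w * / ((INR (S i) * w + INR (Y + S j))
      * (INR (S i) * w + - INR (Y + S j))))%C).
  (* With [W = Wc + k], the [Wc] part keeps the signs of [y] apart ([h]), while in the constant part
     the two signs combine into [q]. *)
  rewrite (csum_ext _ (fun i => (chi (Z.of_nat (S i)) * / INR (S i)
       * (csum (h 1%Z i) n + csum (h (-1)%Z i) n))
     + csum (fun j => k * (chi (Z.of_nat (S i)) * q i j)) n)%C).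
  2:{ intros i _. rewrite csum_app.
      match goal with |- (?x + ?y - ?x)%C = _ => replace (x + y - x)%C with y by ring end.
      rewrite <- csum_plus, <- csum_scal, <- csum_plus. apply csum_ext. intros j _.
      unfold h, q, lterm, Wc. fold k.
      replace (S (Y + j)) with (Y + S j)%nat by lia.
      assert (N0 : RtoC (INR (S i)) <> 0) by (apply RINR_neq_0; lia).
      assert (N1 := lattice_Z_neq_0 w (Z.of_nat (S i)) (Z.of_nat (Y + S j)) Hw ltac:(lia)).
      assert (N2 := lattice_Z_neq_0 w (Z.of_nat (S i)) (- Z.of_nat (Y + S j)) Hw ltac:(lia)).
      replace (1 * Z.of_nat (Y + S j))%Z with (Z.of_nat (Y + S j)) by lia.
      replace (-1 * Z.of_nat (Y + S j))%Z with (- Z.of_nat (Y + S j))%Z by lia.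
      unfold ZtoC in *. rewrite opp_IZR, <- !INR_IZR_INZ, RtoC_opp in *.
      replace (RtoC (-1)) with (- (1))%C by (rewrite <- RtoC_opp; reflexivity).
      field. repeat split; assumption. }
  rewrite csum_plus. eapply Rle_trans; [apply Cmod_triangle|].
  rewrite Rmult_plus_distr_r. apply Rplus_le_compat.
  - apply Rle_trans with (rsum (fun i => 2 * M * c1 * / sqrt (INR Y) * w32 (INR (S i))) A).
    + apply csum_norm_le. intros i _.
      assert (PA : 0 < INR (S i)) by (apply lt_0_INR; lia).
      assert (B : forall e, (e = 1 \/ e = -1)%Z ->
          Cmod (csum (h e i) n) <= c1 * (/ sqrt (INR (S i)) * / sqrt (INR Y))).
      { intros e He. apply (tail_in_y w d Hd Hlow); try lia.
        - apply Rmult_le_pos; lra.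
        - destruct He as [-> | ->]; simpl; ring.
        - intros m. apply Wc_partial, He. }
      assert (B1 := B 1%Z ltac:(lia)). assert (B2 := B (-1)%Z ltac:(lia)).
      rewrite !Cmod_mult, Cmod_inv, Cmod_R, Rabs_pos_eq by (lra || apply RINR_neq_0; lia).
      assert (T := Cmod_triangle (csum (h 1%Z i) n) (csum (h (-1)%Z i) n)).
      assert (G := Hchi (Z.of_nat (S i))). assert (G0 := Cmod_ge_0 (chi (Z.of_nat (S i)))).
      assert (iA := Rinv_0_lt_compat _ PA).
      apply Rle_trans with (M * / INR (S i) * (2 * (c1 * (/ sqrt (INR (S i)) * / sqrt (INR Y))))).
      * apply Rmult_le_compat; [apply Rmult_le_pos; lra|apply Cmod_ge_0| |lra].
        apply Rmult_le_compat_r; lra.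
      * right. unfold w32. assert (sA := sqrt_lt_R0 _ PA). field. repeat split; lra.
    + rewrite rsum_scal. eapply Rle_trans; [apply Rmult_le_compat_l; [|apply rsum_w32]|].
      * apply Rmult_le_pos; [apply Rmult_le_pos|]; lra.
      * lra.
  - rewrite csum_swap.
    apply Rle_trans with (rsum (fun j => Cmod k * c2 * w32 (INR (Y + S j))) n).
    + apply csum_norm_le. intros j _. rewrite csum_scal, Cmod_mult, Rmult_assoc.
      apply Rmult_le_compat_l; [exact Gk|]. unfold q.
      apply (tail_in_a w d Hd Hlow (fun i => chi (Z.of_nat (S i)))); [exact M0| |exact Hchisum].
      apply lt_0_INR. lia.
    + rewrite rsum_scal. eapply Rle_trans; [apply Rmult_le_compat_l; [|apply rsum_w32_tail, HY]|].
      * nra.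
      * right. unfold Rdiv. ring.
Qed.

Variables (w w' : C) (H : Z).
Hypotheses (Hw : 0 < Im w) (Hw' : 0 < Im w') (Hinv : (/ w' = / w + ZtoC H)%C)
  (Hshift : forall a y, (chi (a + H * y)%Z * W (a + H * y)%Z y)%C = (chi a * W a y)%C).

(** For fixed [y], partial fractions in [a] turn the translation of [1/w] by [H]
    into the translation of [a] by [H * y], under which the weight is invariant. *)
Lemma lbox_diff_in_a (Y : nat) :
  ctends (fun A => lbox w' A Y - lbox w A Y)%C 0.
Proof.
  assert (Nw : w <> 0) by (apply Im_neq_0; lra).
  assert (Nw' : w' <> 0) by (apply Im_neq_0; lra).
  set (G := fun y a => (lterm w' a y - lterm w a y)%C).
  apply (ctends_ext (fun A => csum (fun j => csum (fun i =>
     G (Z.of_nat (S j)) (Z.of_nat (S i)) + G (Z.of_nat (S j)) (- Z.of_nat (S i))%Z)%C A) Y)).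
  { intros A. unfold lbox. rewrite <- csum_minus, csum_swap. apply csum_ext. intros i _.
    rewrite <- csum_minus. apply csum_ext. intros j _.
    unfold G.
    (* Parity trades negative [y] for negative [a], so that for each [y > 0] the sum runs over all
       [a <> 0]. *)
    assert (E : forall v, 0 < Im v -> lterm v (- Z.of_nat (S i)) (Z.of_nat (S j))
        = lterm v (Z.of_nat (S i)) (- Z.of_nat (S j))).
    { intros v Hv. unfold lterm.
      rewrite <- (Hpar (Z.of_nat (S i))), Z.opp_involutive.
      assert (N := lattice_Z_neq_0 v (Z.of_nat (S i)) (- Z.of_nat (S j)) Hv ltac:(lia)).
      assert (N0 : ZtoC (Z.of_nat (S i)) <> 0).
      { unfold ZtoC. rewrite <- INR_IZR_INZ. apply RINR_neq_0. lia. }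
      unfold ZtoC in *. rewrite !opp_IZR, !RtoC_opp in *. f_equal. f_equal. ring. }
    rewrite !E by assumption. ring. }
  replace (RtoC 0) with (csum (fun _ => RtoC 0) Y) by (apply csum_zero; reflexivity).
  apply (ctends_csum (fun A j => csum (fun i => G (Z.of_nat (S j)) (Z.of_nat (S i))
     + G (Z.of_nat (S j)) (- Z.of_nat (S i))%Z)%C A)). intros j _.
  set (y := Z.of_nat (S j)).
  assert (Ny : ZtoC y <> 0).
  { unfold ZtoC, y. rewrite <- INR_IZR_INZ. apply RINR_neq_0. lia. }
  set (X := (ZtoC y / w)%C).
  assert (HX : forall a, (X + ZtoC a)%C <> 0).
  { intros a E. assert (E' : (ZtoC a * w + ZtoC y)%C = 0).
    { transitivity (w * (X + ZtoC a))%C; [unfold X; field; exact Nw|rewrite E; ring]. }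
    destruct (Z.eq_dec a 0) as [->|Na].
    - apply Ny. rewrite <- E'. unfold ZtoC. ring.
    - exact (lattice_Z_neq_0 w a y Hw Na E'). }
  set (v := fun a => (chi a * W a y * / (X + ZtoC a))%C).
  assert (Hv : null_at_infinity v).
  { apply (null_over_linear (fun a => chi a * W a y)%C (M * M)); [|exact HX].
    intros a. rewrite Cmod_mult. apply Rmult_le_compat; try apply Cmod_ge_0;
      [apply Hchi|apply HW]. }
  assert (L := ctends_scal (/ ZtoC y)%C _ _ (zsum_shift_null v (H * y) Hv)).
  rewrite Cmult_0_r in L. eapply ctends_ext; [|exact L]. intros A. cbv beta.
  rewrite zsum_pair.
  (* The window of [zsum] contains [a = 0], which the double series omits. Both of its terms vanish:
     [chi 0 = 0], and [Hshift] carries this to [H * y]. *)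
  assert (V0 : (v 0%Z - v (0 + H * y)%Z)%C = 0).
  { unfold v. rewrite Hshift, Hchi0. ring. }
  rewrite V0, Cplus_0_l, <- csum_scal. apply csum_ext. intros i _.
  (* The parts [1/a] of the two partial fractions cancel, and [y/w' + a = y/w + (a + H y)]. *)
  assert (K : forall a, (a <> 0)%Z -> G y a = (/ ZtoC y * (v a - v (a + H * y)%Z))%C).
  { intros a Ha. unfold G, lterm, v. rewrite Hshift.
    assert (N1 := lattice_Z_neq_0 w a y Hw Ha).
    assert (N2 := lattice_Z_neq_0 w' a y Hw' Ha).
    assert (Na : ZtoC a <> 0).
    { intros E. apply RtoC_inj in E. apply Ha, eq_IZR, E. }
    assert (E1 : (/ (X + ZtoC a) = w * / (ZtoC a * w + ZtoC y))%C).
    { unfold X. field. split; assumption. }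
    assert (E2 : (/ (X + ZtoC (a + H * y)) = w' * / (ZtoC a * w' + ZtoC y))%C).
    { replace (X + ZtoC (a + H * y))%C with ((ZtoC a * w' + ZtoC y) / w')%C.
      - field. split; assumption.
      - unfold ZtoC. rewrite plus_IZR, mult_IZR, RtoC_plus, RtoC_mult.
        fold (ZtoC a) (ZtoC H) (ZtoC y).
        transitivity (ZtoC a + ZtoC y * / w')%C; [field; exact Nw'|].
        rewrite Hinv. unfold X. field. exact Nw. }
    rewrite E1, E2. field. repeat split; assumption. }
  rewrite !K by lia. ring.
Qed.

(** By [Ccot_periodic_sum], [P] times the symmetric sum over [y] of [W a y / (a v + y)]; the same
    cotangent sum also appears when the power series of [F] is summed over [b]. *)
Definition linner (v : C) (a : Z) : C :=
  csum (fun j => W a (Z.of_nat j) * Ccot ((ZtoC a * v + ZtoC (Z.of_nat j)) / INR P))%C P.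

Lemma lbox_in_y (v : C) (A : nat) : 0 < Im v ->
  ctends (fun K => lbox v A (P * K))
    (/ INR P * csum (fun i => chi (Z.of_nat (S i)) / INR (S i) * linner v (Z.of_nat (S i))) A)%C.
Proof.
  intros Hv. rewrite <- csum_scal. unfold lbox.
  apply (ctends_csum (fun K i => csum (fun j => lterm v (Z.of_nat (S i)) (Z.of_nat (S j))
     + lterm v (Z.of_nat (S i)) (- Z.of_nat (S j)))%C (P * K))). intros i _.
  set (a := Z.of_nat (S i)).
  assert (Ea : ZtoC a = RtoC (INR (S i))) by (unfold ZtoC, a; rewrite <- INR_IZR_INZ; reflexivity).
  assert (Na : RtoC (INR (S i)) <> 0) by (apply RINR_neq_0; lia).
  assert (Hav : 0 < Im (ZtoC a * v)).
  { rewrite Ea, im_scal_l. apply Rmult_lt_0_compat; [apply lt_0_INR; lia|exact Hv]. }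
  assert (L := ctends_scal (chi a / INR (S i))%C _ _
    (Ccot_periodic_sum P (W a) _ HP (HWper a) Hav)).
  match type of L with ctends _ ?l => match goal with |- ctends _ ?m =>
    replace m with l by (unfold linner; ring) end end.
  eapply ctends_ext; [|exact L]. intros K. cbv beta.
  rewrite zsum_pair, Cmult_plus_distr_l.
  (* Partial fractions produce the term [y = 0] as well; it disappears by [HW0]. *)
  replace (chi a / INR (S i) * (W a 0%Z * / (ZtoC a * v + ZtoC 0)))%C with (RtoC 0).
  2:{ transitivity ((chi a * W a 0%Z) * (/ INR (S i) * / (ZtoC a * v + ZtoC 0)))%C;
        [rewrite HW0; ring|unfold Cdiv; ring]. }
  rewrite Cplus_0_l, <- csum_scal. apply csum_ext. intros j _. unfold lterm.
  assert (N1 := lattice_Z_neq_0 v a (Z.of_nat (S j)) Hv ltac:(unfold a; lia)).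
  assert (N2 := lattice_Z_neq_0 v a (- Z.of_nat (S j)) Hv ltac:(unfold a; lia)).
  rewrite Ea in *. field. repeat split; assumption.
Qed.

(** [lbox_tail] is uniform in [A], which allows the limits in [A] and [Y] to be
    exchanged. *)
Theorem lattice_sum_invariant :
  ctends (fun A => csum (fun i => chi (Z.of_nat (S i)) / INR (S i)
    * (linner w' (Z.of_nat (S i)) - linner w (Z.of_nat (S i))))%C A) 0.
Proof.
  assert (NP := RINR_neq_0 P HP).
  set (D := fun A => csum (fun i => chi (Z.of_nat (S i)) / INR (S i)
    * (linner w' (Z.of_nat (S i)) - linner w (Z.of_nat (S i))))%C A).
  destruct (lbox_tail w Hw) as (c & Hc & T). destruct (lbox_tail w' Hw') as (c' & Hc' & T').
  assert (L : forall A, ctends (fun K => lbox w' A (P * K) - lbox w A (P * K))%C (/ INR P * D A)%C).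
  { intros A. replace (/ INR P * D A)%C with
     (/ INR P * csum (fun i => chi (Z.of_nat (S i)) / INR (S i) * linner w' (Z.of_nat (S i))) A
      - / INR P * csum (fun i => chi (Z.of_nat (S i)) / INR (S i) * linner w (Z.of_nat (S i))) A)%C.
    - apply ctends_minus; apply lbox_in_y; assumption.
    - unfold D. rewrite <- !csum_scal, <- csum_minus. apply csum_ext. intros i _. ring. }
  (* The tail bound passes to the limit in the length of the [y]-sum with [A] fixed. Then [Y] is
     chosen first, from a bound free of [A], and [A] tends to infinity afterwards. *)
  assert (B : forall A Y, (1 <= Y)%nat ->
     Cmod (/ INR P * D A - (lbox w' A Y - lbox w A Y)) <= (c + c') * / sqrt (INR Y)).
  { intros A Y HY. apply (ctends_le_bound _ _ _ _ Y (L A)). intros K HK.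
    assert (E : (P * K = Y + (P * K - Y))%nat) by nia. rewrite E.
    assert (T1 := T A Y (P * K - Y)%nat HY). assert (T2 := T' A Y (P * K - Y)%nat HY).
    replace (lbox w' A (Y + (P * K - Y)) - lbox w A (Y + (P * K - Y)) - (lbox w' A Y - lbox w A Y))%C
      with ((lbox w' A (Y + (P * K - Y)) - lbox w' A Y) - (lbox w A (Y + (P * K - Y)) - lbox w A Y))%C
      by ring.
    eapply Rle_trans; [apply Cmod_minus_le|]. lra. }
  assert (LD : ctends (fun A => / INR P * D A)%C 0).
  { intros eps He.
    destruct (INR_unbounded (((c + c') * 2 / eps) ^ 2)) as [Y0 HY0].
    set (Y := S Y0).
    assert (HY : (c + c') * / sqrt (INR Y) < eps / 2).
    { assert (PY : 0 < INR Y) by (apply lt_0_INR; unfold Y; lia).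
      assert (sY := sqrt_lt_R0 _ PY).
      assert (Q : (c + c') * 2 / eps < sqrt (INR Y)).
      { apply Rsqr_incrst_0.
        - rewrite Rsqr_sqrt by lra. rewrite Rsqr_pow2.
          eapply Rlt_trans; [exact HY0|]. unfold Y. rewrite S_INR. lra.
        - apply Rmult_le_pos; [lra|]. left. apply Rinv_0_lt_compat, He.
        - lra. }
      apply Rlt_div_l; [exact sY|]. apply Rlt_div_l in Q; [|exact He]. lra. }
    destruct (lbox_diff_in_a Y (eps / 2)) as [N HN]; [lra|].
    exists N. intros A HA. specialize (HN A HA).
    assert (B1 := B A Y ltac:(unfold Y; lia)).
    assert (T3 := Cmod_tri3 (/ INR P * D A) (lbox w' A Y - lbox w A Y) 0). lra. }
  apply (ctends_scal (INR P)) in LD. rewrite Cmult_0_r in LD.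
  eapply ctends_ext; [|exact LD]. intros A. cbv beta. field. exact NP.
Qed.

End lattice.

(** * Dirichlet characters *)

Lemma Cconj_neq_0 (x : C) : x <> 0 -> Cconj x <> 0.
Proof. intros H. apply Cmod_gt_0. rewrite Cmod_conj. apply Cmod_gt_0, H. Qed.

Lemma Cconj_R (x : R) : Cconj (RtoC x) = RtoC x.
Proof. unfold Cconj, RtoC; simpl. f_equal; ring. Qed.

Lemma dirichlet_char_conj (q : Z) (chi : Z -> C) :
  dirichlet_char q chi -> dirichlet_char q (conjchar chi).
Proof.
  intros (Hq & Hm & Hp & Hn & H0). unfold conjchar.
  split; [exact Hq|]. split; [intros; rewrite Hm; apply Cmult_conj|].
  split; [intros; rewrite Hp; reflexivity|].
  split; [intros; apply Cconj_neq_0, Hn; assumption|].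
  intros n G. rewrite (H0 n G). apply Cconj_R.
Qed.

Lemma primitive_char_conj (q : Z) (chi : Z -> C) :
  primitive_char q chi -> primitive_char q (conjchar chi).
Proof.
  intros [Hd Hp]. split; [apply dirichlet_char_conj, Hd|].
  intros d Hdq Hdiv H. apply (Hp d Hdq Hdiv). intros a Ga Ma.
  rewrite <- (Cconj_conj (chi a)). change (Cconj (chi a)) with (conjchar chi a).
  rewrite (H a Ga Ma). apply Cconj_R.
Qed.

Lemma char_1 (q : Z) (chi : Z -> C) : dirichlet_char q chi -> chi 1%Z = 1.
Proof.
  intros (Hq & Hm & _ & Hn & _).
  assert (N : chi 1%Z <> 0) by (apply Hn, Z.gcd_1_l).
  assert (E := Hm 1%Z 1%Z). change (1 * 1)%Z with 1%Z in E.
  transitivity (/ chi 1%Z * (chi 1%Z * chi 1%Z))%C.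
  - field. exact N.
  - rewrite <- E. field. exact N.
Qed.

(** The square of [chi (-1)] is [chi 1 = 1], so the value is 1 or -1, hence real. *)
Lemma char_m1_conj (q : Z) (chi : Z -> C) : dirichlet_char q chi ->
  Cconj (chi (-1)%Z) = chi (-1)%Z.
Proof.
  intros Hd. assert (H1 := char_1 q chi Hd). destruct Hd as (_ & Hm & _).
  assert (E := Hm (-1)%Z (-1)%Z). change (-1 * -1)%Z with 1%Z in E. rewrite H1 in E.
  set (x := chi (-1)%Z) in *.
  assert (F : ((x - 1) * (x + 1))%C = 0).
  { transitivity (x * x - 1)%C; [ring|]. rewrite <- E. ring. }
  destruct (Ceq_dec x 1) as [->|N1]; [apply Cconj_R|].
  assert (x = (- (1))%C) as ->; [|rewrite Copp_conj, Cconj_R; reflexivity].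
  assert (G : (x + 1)%C = 0).
  { transitivity (/ (x - 1) * ((x - 1) * (x + 1)))%C; [field; apply Cminus_eq_contra, N1|].
    rewrite F. ring. }
  transitivity (x + 1 - 1)%C; [ring|rewrite G; ring].
Qed.

Section primitive.
Variables (n : nat) (chi : Z -> C).
Hypotheses (Hn : (0 < n)%nat) (Hprim : primitive_char (Z.of_nat n) chi).

Lemma char_periodic : periodic n chi.
Proof. destruct Hprim as [(_ & _ & Hp & _) _]. exact Hp. Qed.

Lemma char_er_periodic (l : Z) : periodic n (fun b => chi b * er n (l * b))%C.
Proof.
  intros b. f_equal; [apply char_periodic|apply (er_periodic n l Hn)].
Qed.

(** Let [d = n / gcd(l, n)], a proper divisor. If [x] is a unit congruent to 1 modulo [d], then
    [l x] is congruent to [l] modulo [n], and the substitution [b -> x b] gives [chi x * S = S]. A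
    nonzero [S] would force [chi x = 1] for all such [x], against primitivity. *)
Lemma primitive_gauss_vanish (l : Z) : Z.gcd l (Z.of_nat n) <> 1%Z ->
  csum (fun b => chi (Z.of_nat b) * er n (l * Z.of_nat b))%C n = 0.
Proof.
  intros Hg. destruct Hprim as [(_ & Hm & _) Hpr].
  set (g := Z.gcd l (Z.of_nat n)) in *.
  assert (Hg0 := Z.gcd_nonneg l (Z.of_nat n)). fold g in Hg0.
  destruct (Z.gcd_divide_r l (Z.of_nat n)) as [d Hd]. fold g in Hd.
  destruct (Z.gcd_divide_l l (Z.of_nat n)) as [m Hml]. fold g in Hml.
  assert (Hdn : (1 <= d < Z.of_nat n)%Z) by nia.
  assert (Hdd : (d | Z.of_nat n)%Z) by (exists g; lia).
  set (S := csum (fun b => chi (Z.of_nat b) * er n (l * Z.of_nat b))%C n).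
  destruct (Ceq_dec S 0) as [E|NS]; [exact E|]. exfalso.
  apply (Hpr d Hdn Hdd). intros x Gx Mx.
  assert (E : (chi x * S)%C = S).
  { unfold S at 2.
    rewrite <- (csum_dilate n (fun b => chi b * er n (l * b))%C x Hn (char_er_periodic l) Gx).
    unfold S. rewrite <- csum_scal. apply csum_ext. intros b _. rewrite Hm, Cmult_assoc.
    f_equal.
    assert (D : (d | x - 1)%Z).
    { apply Z.mod_divide; [lia|]. rewrite Zminus_mod, Mx, <- Zminus_mod. apply Zmod_0_l. }
    destruct D as [t Ht].
    replace (l * (x * Z.of_nat b))%Z with (l * Z.of_nat b + (m * t * Z.of_nat b) * Z.of_nat n)%Z.
    - rewrite er_plus, (proj2 (er_1_iff n (_ * Z.of_nat n) Hn)) by apply Z.divide_factor_r.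
      ring.
    - replace x with (1 + t * d)%Z by lia. rewrite Hd, Hml. ring. }
  transitivity (chi x * S * / S)%C; [field; exact NS|]. rewrite E. field. exact NS.
Qed.

Lemma dft_primitive_vanish (l : Z) : Z.gcd l (Z.of_nat n) <> 1%Z -> dft n chi l = 0.
Proof.
  intros H. unfold dft. rewrite primitive_gauss_vanish; [ring|].
  rewrite Z.gcd_opp_l. exact H.
Qed.

Lemma dft_char_opp (l : Z) : dft n chi (- l) = (chi (-1)%Z * dft n chi l)%C.
Proof.
  unfold dft. rewrite Z.opp_involutive.
  rewrite <- (csum_dilate n (fun b => chi b * er n (l * b))%C (-1) Hn (char_er_periodic l)).
  2:{ change (-1)%Z with (- (1))%Z. rewrite Z.gcd_opp_l. apply Z.gcd_1_l. }
  rewrite (csum_ext _ (fun b => chi (-1)%Z * (chi (Z.of_nat b) * er n (- l * Z.of_nat b)))%C).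
  - rewrite csum_scal. ring.
  - intros b _. destruct Hprim as [(_ & Hm & _) _]. rewrite Hm.
    replace (l * (-1 * Z.of_nat b))%Z with (- l * Z.of_nat b)%Z by ring. ring.
Qed.

Lemma char_sum_0 : n <> 1%nat -> csum (fun b => chi (Z.of_nat b)) n = 0.
Proof.
  intros H1. assert (G : Z.gcd 0 (Z.of_nat n) <> 1%Z).
  { rewrite Z.gcd_0_l. lia. }
  rewrite <- (primitive_gauss_vanish 0 G). apply csum_ext. intros b _.
  rewrite Z.mul_0_l, er_0. ring.
Qed.

End primitive.

(** * Fourier transform of a character twisted at the cusp *)

Lemma er_scale (n s : nat) (m : Z) : (0 < n)%nat -> (0 < s)%nat ->
  er (n * s) (Z.of_nat n * m) = er s m.
Proof.
  intros Hn Hs. unfold er. do 2 f_equal.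
  rewrite mult_INR, mult_IZR, <- INR_IZR_INZ. field.
  split; apply not_0_INR; lia.
Qed.

Section twist.
Variables (n s : nat) (theta : Z -> C) (r : Z).
Hypotheses (Hn : (0 < n)%nat) (Hs : (0 < s)%nat) (Hth : primitive_char (Z.of_nat n) theta).

(** The coefficients of the inner [b]-sum of [F] expanded at the cusp [r/s]. *)
Definition twist (a b : Z) : C := (theta b * er s (a * r * b))%C.

Lemma twist_periodic (a : Z) : periodic (n * s) (twist a).
Proof.
  intros b. unfold twist. rewrite Nat2Z.inj_mul. f_equal.
  - apply (periodic_cong n); [apply char_periodic, Hth|]. exists (Z.of_nat s). ring.
  - apply (periodic_cong s (fun b => er s (a * r * b)) (er_periodic s _ Hs)).
    exists (Z.of_nat n). ring.
Qed.

Lemma dft_twist_sum (a y : Z) : dft (n * s) (twist a) y =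
  (/ INR (n * s) * csum (fun b => theta (Z.of_nat b)
     * er (n * s) ((Z.of_nat n * a * r - y) * Z.of_nat b)) (n * s))%C.
Proof.
  unfold dft, twist. f_equal. apply csum_ext. intros b _.
  rewrite <- (er_scale n s) by assumption. rewrite <- Cmult_assoc, <- er_plus.
  f_equal. f_equal. ring.
Qed.

(** Twisting by [e(a r b / s)] translates the frequency by [n a r] modulo [n s]. A frequency that is
    then a multiple of [s] has period [n], so the sum consists of [s] equal blocks. *)
Lemma dft_twist (a l : Z) :
  dft (n * s) (twist a) (Z.of_nat n * a * r + l * Z.of_nat s) = dft n theta l.
Proof.
  rewrite dft_twist_sum. unfold dft.
  rewrite (csum_ext _ (fun b => (fun b => theta b * er n (- l * b))%C (Z.of_nat b))).
  - rewrite (Nat.mul_comm n s), (csum_blocks n s (fun b => theta b * er n (- l * b))%C Hn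
      (char_er_periodic n theta Hn Hth (- l))).
    rewrite mult_INR, RtoC_mult. field. split; apply RINR_neq_0; assumption.
  - intros b _. f_equal. rewrite <- (er_scale s n) by assumption.
    rewrite (Nat.mul_comm s n). f_equal. ring.
Qed.

(** The shift of [b] by [n] preserves [theta] and multiplies the sum by [er s m], which differs from
    1. *)
Lemma dft_twist_0 (a y : Z) : ~ (Z.of_nat s | y - Z.of_nat n * a * r)%Z ->
  dft (n * s) (twist a) y = 0.
Proof.
  intros H. rewrite dft_twist_sum. set (m := (Z.of_nat n * a * r - y)%Z).
  assert (Hns : (0 < n * s)%nat) by nia.
  set (F := fun b => (theta b * er (n * s) (m * b))%C).
  change (csum _ (n * s)) with (csum (fun b => F (Z.of_nat b)) (n * s)).
  assert (HF : periodic (n * s) F).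
  { intros b. unfold F. f_equal; [|apply (er_periodic (n * s) m Hns)].
    apply (periodic_cong n); [apply char_periodic, Hth|]. exists (Z.of_nat s).
    rewrite Nat2Z.inj_mul. ring. }
  assert (E := csum_shift (n * s) F (Z.of_nat n) Hns HF).
  rewrite (csum_ext _ (fun b => er s m * F (Z.of_nat b))%C) in E.
  2:{ intros b _. unfold F. rewrite Z.mul_add_distr_l, er_plus.
      rewrite (Z.mul_comm m (Z.of_nat n)), er_scale by assumption.
      replace (theta (Z.of_nat n + Z.of_nat b)%Z) with (theta (Z.of_nat b)); [ring|].
      rewrite Z.add_comm. symmetry. apply (char_periodic n theta Hth). }
  rewrite csum_scal in E.
  assert (N : er s m <> 1).
  { intros E1. apply er_1_iff in E1; [|exact Hs]. apply H.
    replace (y - Z.of_nat n * a * r)%Z with (- m)%Z by (unfold m; ring).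
    apply Z.divide_opp_r, E1. }
  set (T := csum (fun b => F (Z.of_nat b)) (n * s)) in *.
  replace T with (RtoC 0); [ring|].
  transitivity (/ (er s m - 1) * (er s m * T - T))%C.
  - rewrite E. ring.
  - field. apply Cminus_eq_contra, N.
Qed.

(** Fourier inversion at 0. That the value does not depend on [a] is what makes [kappa] a
    constant. *)
Lemma dft_twist_total (a : Z) :
  csum (fun j => dft (n * s) (twist a) (Z.of_nat j)) (n * s) = theta 0%Z.
Proof.
  assert (Hns : (0 < n * s)%nat) by nia.
  transitivity (twist a 0%Z).
  - rewrite (dft_inv (n * s) (twist a) 0 Hns (twist_periodic a)).
    apply csum_ext. intros j _. rewrite Z.mul_0_l, er_0. ring.
  - unfold twist. rewrite Z.mul_0_r, er_0. ring.
Qed.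

Lemma dft_twist_opp (a y : Z) :
  dft (n * s) (twist (- a)) (- y) = (theta (-1)%Z * dft (n * s) (twist a) y)%C.
Proof.
  destruct (Zdivide_dec (Z.of_nat s) (y - Z.of_nat n * a * r)) as [[l Hl]|H].
  - replace y with (Z.of_nat n * a * r + l * Z.of_nat s)%Z by lia.
    replace (- (Z.of_nat n * a * r + l * Z.of_nat s))%Z
      with (Z.of_nat n * (- a) * r + (- l) * Z.of_nat s)%Z by ring.
    rewrite !dft_twist. apply dft_char_opp; assumption.
  - rewrite (dft_twist_0 a y H), dft_twist_0; [ring|].
    intros D. apply H. apply Z.divide_opp_r in D.
    replace (y - Z.of_nat n * a * r)%Z with (- (- y - Z.of_nat n * - a * r))%Z by ring.
    exact D.
Qed.

(** The first divisibility keeps [y] inside or outside the support [n a r + s Z]. The second is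
    demanded on the support only: it says that the index [l] of [dft_twist] moves by a multiple of
    the period [n]. *)
Lemma dft_twist_shift (a y h : Z) :
  (Z.of_nat s | h * y * r * Z.of_nat n)%Z ->
  (forall l, y = Z.of_nat n * a * r + l * Z.of_nat s ->
     exists t, h * y * r * Z.of_nat n = t * Z.of_nat n * Z.of_nat s)%Z ->
  dft (n * s) (twist (a + h * y)) y = dft (n * s) (twist a) y.
Proof.
  intros D1 D2.
  destruct (Zdivide_dec (Z.of_nat s) (y - Z.of_nat n * a * r)) as [[l Hl]|H].
  - destruct (D2 l ltac:(lia)) as [t Ht].
    transitivity (dft n theta (l - t * Z.of_nat n)).
    + rewrite <- (dft_twist (a + h * y)). f_equal.
      transitivity (Z.of_nat n * a * r + l * Z.of_nat s)%Z; [lia|].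
      transitivity (Z.of_nat n * a * r + h * y * r * Z.of_nat n
         + l * Z.of_nat s - t * Z.of_nat n * Z.of_nat s)%Z; [lia|ring].
    + replace y with (Z.of_nat n * a * r + l * Z.of_nat s)%Z by lia.
      rewrite dft_twist. apply (periodic_cong n _ (dft_periodic n theta Hn)).
      exists (- t)%Z. ring.
  - rewrite (dft_twist_0 a y H), dft_twist_0; [reflexivity|].
    intros D. apply H.
    replace (y - Z.of_nat n * a * r)%Z
      with (y - Z.of_nat n * (a + h * y) * r + h * y * r * Z.of_nat n)%Z by ring.
    apply Z.divide_add_r; assumption.
Qed.

End twist.

Lemma csum_S (f : nat -> C) (n : nat) : csum f (S n) = (csum f n + f n)%C.
Proof. reflexivity. Qed.

(** * The series of [F] as a double sum *)

Lemma succ_div_mod (A k : nat) : (0 < k)%nat ->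
  ((S A mod k = 0 /\ S A / k = S (A / k)) \/ (S A mod k <> 0 /\ S A / k = A / k))%nat.
Proof.
  intros Hk. assert (E := Nat.div_mod A k ltac:(lia)).
  assert (L := Nat.mod_upper_bound A k ltac:(lia)).
  destruct (Nat.eq_dec (S (A mod k)) k) as [H|H].
  - left. split.
    + symmetry. apply (Nat.mod_unique _ _ (S (A / k))); lia.
    + symmetry. apply (Nat.div_unique _ _ _ 0); lia.
  - right. assert (Q : (S A mod k = S (A mod k))%nat).
    { symmetry. apply (Nat.mod_unique _ _ (A / k)); lia. }
    split; [lia|]. symmetry. apply (Nat.div_unique _ _ _ (S (A mod k))); lia.
Qed.

(** Both sides sum over the pairs with product at most [A]. Passing to [A + 1] lengthens the row of
    [a] by one term exactly when [a] divides [A + 1]. *)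
Lemma divisor_sum (g : nat -> nat -> C) (A : nat) :
  csum (fun m => csum (fun i => if (S m mod S i =? 0)%nat then g (S i) (S m / S i)%nat
     else RtoC 0) (S m)) A
  = csum (fun i => csum (fun j => g (S i) (S j)) (A / S i)) A.
Proof.
  induction A as [|A IH]; [reflexivity|].
  rewrite csum_S, IH.
  assert (E : csum (fun i => csum (fun j => g (S i) (S j)) (A / S i)) A
     = csum (fun i => csum (fun j => g (S i) (S j)) (A / S i)) (S A)).
  { rewrite csum_S, (Nat.div_small A (S A)) by lia.
    change (csum (fun j => g (S A) (S j)) 0) with (RtoC 0). ring. }
  rewrite E, <- csum_plus. apply csum_ext. intros i _.
  destruct (succ_div_mod A (S i) ltac:(lia)) as [[H1 H2]|[H1 H2]].
  - rewrite (proj2 (Nat.eqb_eq _ _) H1), H2. reflexivity.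
  - rewrite (proj2 (Nat.eqb_neq _ _) H1), H2. ring.
Qed.

Lemma rsum_pow_le (x : R) (n : nat) : 0 <= x < 1 -> rsum (fun j => x ^ j) n <= / (1 - x).
Proof.
  intros Hx. assert (E : forall m, rsum (fun j => x ^ j) m = (1 - x ^ m) * / (1 - x)).
  { induction m as [|m IH]; simpl; [ring|]. rewrite IH. field. lra. }
  rewrite E. assert (P : 0 < / (1 - x)) by (apply Rinv_0_lt_compat; lra).
  assert (Q : 0 <= x ^ n) by (apply pow_le; lra). nra.
Qed.

Lemma ex_series_nat_pow (x : R) : 0 < x < 1 -> ex_series (fun n => INR (S n) * x ^ n).
Proof.
  intros Hx. apply ex_series_ext with (fun n => Rabs (INR (S n) * x ^ n)).
  { intros n. apply Rabs_pos_eq. apply Rmult_le_pos; [apply pos_INR|apply pow_le; lra]. }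
  assert (P : forall n, 0 < INR (S n)) by (intros; apply lt_0_INR; lia).
  assert (Q : forall n, 0 < x ^ n) by (intros; apply pow_lt; lra).
  apply ex_series_DAlembert with x; [lra| |].
  - intros n E. specialize (P n). specialize (Q n). nra.
  - apply is_lim_seq_ext with (fun n => x * (1 + / INR (S n))).
    + intros n. rewrite Rabs_pos_eq.
      * rewrite (S_INR (S n)). simpl pow. specialize (P n). specialize (Q n).
        field. split; lra.
      * apply Rmult_le_pos; [apply Rmult_le_pos; [apply pos_INR|left; apply Q]|].
        left. apply Rinv_0_lt_compat, Rmult_lt_0_compat; [apply P|apply Q].
    + assert (L := is_lim_seq_inv_INR (fun n => S n) (fun n => le_S _ _ (le_n n))).
      replace (Finite x) with (Rbar_mult x (1 + 0)) by (simpl; f_equal; ring).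
      apply is_lim_seq_scal_l. apply (is_lim_seq_plus' _ _ 1 0); [apply is_lim_seq_const|exact L].
Qed.

Lemma Re_csum (f : nat -> C) (n : nat) : Re (csum f (S n)) = sum_n (fun i => Re (f i)) n.
Proof.
  induction n as [|n IH].
  - rewrite sum_O, csum_S. simpl csum. rewrite Cplus_0_l. reflexivity.
  - rewrite sum_Sn, <- IH. reflexivity.
Qed.

Lemma Im_csum (f : nat -> C) (n : nat) : Im (csum f (S n)) = sum_n (fun i => Im (f i)) n.
Proof.
  induction n as [|n IH].
  - rewrite sum_O, csum_S. simpl csum. rewrite Cplus_0_l. reflexivity.
  - rewrite sum_Sn, <- IH. reflexivity.
Qed.

Lemma im_le_Cmod (c : C) : Rabs (Im c) <= Cmod c.
Proof. eapply Rle_trans; [apply Rmax_r|apply Rmax_Cmod]. Qed.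

Lemma CSeries_ctends (f : nat -> C) (b : nat -> R) :
  (forall n, Cmod (f n) <= b n) -> ex_series b ->
  ctends (fun n => csum f (S n)) (CSeries f).
Proof.
  intros Hb Eb. apply ctends_Re_Im.
  - apply is_lim_seq_ext with (sum_n (fun i => Re (f i))); [intros; symmetry; apply Re_csum|].
    apply Series_correct. apply (ex_series_le (fun i => Re (f i)) b); [|exact Eb].
    intros n. eapply Rle_trans; [apply re_le_Cmod|apply Hb].
  - apply is_lim_seq_ext with (sum_n (fun i => Im (f i))); [intros; symmetry; apply Im_csum|].
    apply Series_correct. apply (ex_series_le (fun i => Im (f i)) b); [|exact Eb].
    intros n. eapply Rle_trans; [apply im_le_Cmod|apply Hb].
Qed.

Definition Fterm (chi1 chi2 : Z -> C) (z : C) (m : nat) : C :=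
  (lam chi1 chi2 (S m) / RtoC (sqrt (INR (S m))) * ce (INR (S m) * z))%C.

Definition dterm (chi1 theta : Z -> C) (z : C) (a b : nat) : C :=
  (chi1 (Z.of_nat a) / INR a * (theta (Z.of_nat b) * ce z ^ (a * b)))%C.

(** For [n = a b], the factor [sqrt (b/a) / sqrt n] is [1/a]. *)
Lemma Fterm_dterm (chi1 chi2 : Z -> C) (z : C) (m : nat) :
  Fterm chi1 chi2 z m = csum (fun i => if (S m mod S i =? 0)%nat
    then dterm chi1 (conjchar chi2) z (S i) (S m / S i)%nat else RtoC 0) (S m).
Proof.
  unfold Fterm, lam. unfold Cdiv at 1. rewrite <- Cmult_assoc, Cmult_comm, <- csum_scal.
  apply csum_ext. intros i _.
  destruct (Nat.eqb_spec (S m mod S i) 0) as [H|H]; [|ring].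
  assert (E := Nat.div_mod (S m) (S i) ltac:(lia)). rewrite H, Nat.add_0_r in E.
  set (b := (S m / S i)%nat) in *. unfold dterm, conjchar.
  assert (Pa : 0 < INR (S i)) by (apply lt_0_INR; lia).
  assert (Pb : 0 < INR b) by (apply lt_0_INR; nia).
  rewrite ce_nat_mul, <- E.
  assert (Es : RtoC (sqrt (INR b / INR (S i))) = (RtoC (sqrt (INR (S m))) / INR (S i))%C).
  { rewrite <- RtoC_div by lra. f_equal. rewrite E, mult_INR.
    rewrite sqrt_div_alt, sqrt_mult by lra.
    assert (sA := sqrt_lt_R0 _ Pa). rewrite <- (sqrt_sqrt (INR (S i))) at 3 by lra.
    field. lra. }
  rewrite Es. assert (sN : 0 < sqrt (INR (S m))) by (apply sqrt_lt_R0, lt_0_INR; lia).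
  field. split; intros F; apply RtoC_inj in F; lra.
Qed.

Section inner.
Variables (chi1 theta : Z -> C) (M1 M2 : R) (z : C) (inner : nat -> C).
Hypotheses (H1 : forall a, Cmod (chi1 a) <= M1) (H2 : forall b, Cmod (theta b) <= M2)
  (Hz : 0 < Im z)
  (Hin : forall i, ctends (fun B => csum (fun j => theta (Z.of_nat (S j)) * ce z ^ (S i * S j))%C B)
     (inner i)).

(** The omitted [b] satisfy [a b > A], so the remainder is dominated by a geometric series starting
    at [|ce z|^A]. *)
Lemma inner_tail (i A : nat) :
  Cmod (inner i - csum (fun j => theta (Z.of_nat (S j)) * ce z ^ (S i * S j))%C (A / S i))
   <= M2 * / (1 - Cmod (ce z)) * Cmod (ce z) ^ A.
Proof.
  assert (X1 := Cmod_ce_lt z Hz). assert (X0 := Cmod_ge_0 (ce z)).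
  set (x := Cmod (ce z)) in *. set (B := (A / S i)%nat).
  assert (HB : (A <= S i * S B)%nat).
  { assert (E := Nat.div_mod A (S i) ltac:(lia)). fold B in E.
    assert (L := Nat.mod_upper_bound A (S i) ltac:(lia)). nia. }
  assert (M20 : 0 <= M2) by (eapply Rle_trans; [apply Cmod_ge_0|apply (H2 0%Z)]).
  apply (ctends_le_bound _ _ _ _ B (Hin i)). intros n Hn.
  replace n with (B + (n - B))%nat by lia. rewrite csum_app.
  match goal with |- Cmod (?u + ?v - ?u) <= _ => replace (u + v - u)%C with v by ring end.
  apply Rle_trans with (rsum (fun j => M2 * x ^ A * x ^ j) (n - B)).
  - apply csum_norm_le. intros j _. rewrite Cmod_mult, Cmod_pow. fold x.
    rewrite Rmult_assoc. apply Rmult_le_compat; [apply Cmod_ge_0|apply pow_le, X0|apply H2|].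
    rewrite <- pow_add. replace (S i * S (B + j))%nat
      with (A + j + (S i * S (B + j) - (A + j)))%nat by nia.
    rewrite (pow_add x (A + j)). rewrite <- (Rmult_1_r (x ^ (A + j))) at 2.
    apply Rmult_le_compat_l; [apply pow_le, X0|].
    rewrite <- (pow1 (S i * S (B + j) - (A + j))). apply pow_incr. lra.
  - rewrite rsum_scal. assert (G := rsum_pow_le x (n - B) (conj X0 X1)).
    assert (Q : 0 <= M2 * x ^ A) by (apply Rmult_le_pos; [exact M20|apply pow_le, X0]).
    replace (M2 * / (1 - x) * x ^ A) with (M2 * x ^ A * / (1 - x)) by ring.
    apply Rmult_le_compat_l; assumption.
Qed.

(** Replaces the hyperbolic region [a b <= A] by complete rows [a <= A]: each of the [A] rows misses
    an amount of order [|ce z|^A]. *)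
Lemma double_sum_approx :
  ctends (fun A => csum (fun i => csum (fun j => dterm chi1 theta z (S i) (S j)) (A / S i)) A
     - csum (fun i => chi1 (Z.of_nat (S i)) / INR (S i) * inner i)%C A)%C 0.
Proof.
  assert (X1 := Cmod_ce_lt z Hz). assert (X0 := Cmod_ge_0 (ce z)).
  assert (XP : 0 < Cmod (ce z)) by (apply Cmod_gt_0, ce_neq_0).
  set (x := Cmod (ce z)) in *.
  assert (M10 : 0 <= M1) by (eapply Rle_trans; [apply Cmod_ge_0|apply (H1 0%Z)]).
  set (c := M1 * (M2 * / (1 - x))).
  assert (c0 : 0 <= c).
  { unfold c. apply Rmult_le_pos; [exact M10|]. apply Rmult_le_pos.
    - eapply Rle_trans; [apply Cmod_ge_0|apply (H2 0%Z)].
    - left. apply Rinv_0_lt_compat. lra. }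
  apply (ctends_le _ _ (fun A => c * (INR (S A) * x ^ A))).
  - intros A. rewrite Cmod_minus_sym, <- csum_minus.
    match goal with |- Cmod ?e <= _ => replace e with (- csum (fun i =>
      csum (fun j => dterm chi1 theta z (S i) (S j)) (A / S i)
      - chi1 (Z.of_nat (S i)) / INR (S i) * inner i) A)%C by ring end.
    rewrite Cmod_opp.
    apply Rle_trans with (INR A * (c * x ^ A)).
    + apply csum_norm_const. intros i _. unfold dterm.
      rewrite csum_scal, <- (Cmod_opp).
      match goal with |- Cmod (- (?k * ?u - ?k * ?v)) <= _ =>
        replace (- (k * u - k * v))%C with (k * (v - u))%C by ring end.
      assert (T := inner_tail i A). fold x in T.
      assert (P : 1 <= INR (S i)).
      { rewrite S_INR. assert (Q := pos_INR i). lra. }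
      unfold c. rewrite Cmod_mult, Rmult_assoc.
      apply Rmult_le_compat; [apply Cmod_ge_0|apply Cmod_ge_0| |exact T].
      rewrite Cmod_div, Cmod_R, Rabs_pos_eq by (lra || apply RINR_neq_0; lia).
      apply Rle_div_l; [lra|]. specialize (H1 (Z.of_nat (S i))). nra.
    + rewrite S_INR. assert (Q : 0 <= c * x ^ A) by (apply Rmult_le_pos; [exact c0|apply pow_le, X0]).
      nra.
  - replace (Finite 0) with (Rbar_mult c 0) by (simpl; f_equal; ring).
    apply is_lim_seq_scal_l. apply ex_series_lim_0, ex_series_nat_pow. lra.
Qed.

End inner.

(** Absolute convergence of the series: at most [m + 1] divisors, each contributing at most
    [M1 * M2 * |ce z|^m]. *)
Lemma Fterm_norm (chi1 chi2 : Z -> C) (M1 M2 : R) (z : C) (m : nat) :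
  (forall a, Cmod (chi1 a) <= M1) -> (forall b, Cmod (chi2 b) <= M2) -> 0 < Im z ->
  Cmod (Fterm chi1 chi2 z m) <= M1 * M2 * (INR (S m) * Cmod (ce z) ^ m).
Proof.
  intros H1 H2 Hz. rewrite Fterm_dterm.
  assert (X1 := Cmod_ce_lt z Hz). assert (X0 := Cmod_ge_0 (ce z)).
  assert (M10 : 0 <= M1) by (eapply Rle_trans; [apply Cmod_ge_0|apply (H1 0%Z)]).
  assert (M20 : 0 <= M2) by (eapply Rle_trans; [apply Cmod_ge_0|apply (H2 0%Z)]).
  set (x := Cmod (ce z)) in *.
  assert (Q : 0 <= x ^ m) by (apply pow_le, X0).
  replace (M1 * M2 * (INR (S m) * x ^ m)) with (INR (S m) * (M1 * (M2 * x ^ m))) by ring.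
  apply csum_norm_const. intros i _.
  destruct (Nat.eqb_spec (S m mod S i) 0) as [H|H].
  2:{ rewrite Cmod_0. repeat apply Rmult_le_pos; assumption. }
  assert (E := Nat.div_mod (S m) (S i) ltac:(lia)). rewrite H, Nat.add_0_r in E.
  unfold dterm. rewrite <- E, !Cmod_mult, Cmod_pow. fold x.
  assert (P : 1 <= INR (S i)).
  { rewrite S_INR. assert (T := pos_INR i). lra. }
  apply Rmult_le_compat; [apply Cmod_ge_0| | |].
  - apply Rmult_le_pos; [apply Cmod_ge_0|apply pow_le, X0].
  - rewrite Cmod_div, Cmod_R, Rabs_pos_eq by (lra || apply RINR_neq_0; lia).
    apply Rle_div_l; [lra|]. specialize (H1 (Z.of_nat (S i))). nra.
  - apply Rmult_le_compat; [apply Cmod_ge_0|apply pow_le, X0| |].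
    + unfold conjchar. rewrite Cmod_conj. apply H2.
    + simpl. rewrite <- (Rmult_1_l (x ^ m)) at 2. apply Rmult_le_compat_r; lra.
Qed.

Lemma Fseries_approx (chi1 chi2 : Z -> C) (M1 M2 : R) (z : C) (inner : nat -> C) :
  (forall a, Cmod (chi1 a) <= M1) -> (forall b, Cmod (chi2 b) <= M2) -> 0 < Im z ->
  (forall i, ctends (fun B => csum (fun j =>
     conjchar chi2 (Z.of_nat (S j)) * ce z ^ (S i * S j))%C B) (inner i)) ->
  ctends (fun A => csum (fun i => chi1 (Z.of_nat (S i)) / INR (S i) * inner i)%C (S A))
    (CSeries (Fterm chi1 chi2 z)).
Proof.
  intros H1 H2 Hz Hin.
  assert (XP : 0 < Cmod (ce z)) by (apply Cmod_gt_0, ce_neq_0).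
  assert (X1 := Cmod_ce_lt z Hz).
  assert (L1 := CSeries_ctends (Fterm chi1 chi2 z) _
    (fun m => Fterm_norm chi1 chi2 M1 M2 z m H1 H2 Hz)
    (ex_series_scal (M1 * M2) _ (ex_series_nat_pow _ (conj XP X1)))).
  assert (H2' : forall b, Cmod (conjchar chi2 b) <= M2).
  { intros b. unfold conjchar. rewrite Cmod_conj. apply H2. }
  assert (L2 := ctends_subseq _ _ S (fun n => le_S _ _ (le_n n))
    (double_sum_approx chi1 (conjchar chi2) M1 M2 z inner H1 H2' Hz Hin)).
  assert (L := ctends_minus _ _ _ _ L1 L2).
  replace (CSeries (Fterm chi1 chi2 z) - 0)%C with (CSeries (Fterm chi1 chi2 z)) in L by ring.
  eapply ctends_ext; [|exact L]. intros A. cbv beta.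
  rewrite <- divisor_sum.
  rewrite (csum_ext (Fterm chi1 chi2 z) _ (S A) (fun m _ => Fterm_dterm chi1 chi2 z m)).
  match goal with |- (?u - (?u - ?v))%C = _ => ring end.
Qed.

Lemma ctends_pow_0 (x : C) : Cmod x < 1 -> ctends (fun n => x ^ n)%C 0.
Proof.
  intros H. apply (ctends_le _ _ (fun n => Cmod x ^ n)).
  - intros n. right. rewrite <- Cmod_pow. f_equal. ring.
  - apply is_lim_seq_geom. rewrite Rabs_pos_eq; [exact H|apply Cmod_ge_0].
Qed.

(** With [x = ce t], [x/(1 - x) = (1 + x)/(2(1 - x)) - 1/2]. *)
Lemma geom_Ccot (t : C) : 0 < Im t ->
  ctends (fun B => csum (fun j => ce t ^ S j)%C B) (Ccot t / (2 * miPi) - / 2)%C.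
Proof.
  intros Ht. assert (N := ce_neq_1 t Ht). assert (NM := miPi_neq_0).
  assert (N2 : RtoC 2 <> 0) by (intros F; apply RtoC_inj in F; lra).
  assert (L := ctends_scal (ce t / (1 - ce t))%C _ _
    (ctends_minus _ _ _ _ (ctends_const 1) (ctends_pow_0 (ce t) (Cmod_ce_lt t Ht)))).
  replace (Ccot t / (2 * miPi) - / 2)%C with (ce t / (1 - ce t) * (1 - 0))%C.
  - eapply ctends_ext; [|exact L]. intros B. cbv beta.
    rewrite (csum_ext _ (fun j => ce t * ce t ^ j)%C) by (intros; apply Cpow_S).
    rewrite csum_scal, geom by exact N. field. exact N.
  - unfold Ccot. field. repeat split; assumption.
Qed.

(** Fourier inversion writes [w] as a combination of additive characters, each of which turns the
    power series into a geometric one. *)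
Lemma periodic_power_sum (P : nat) (w : Z -> C) (t : C) :
  (0 < P)%nat -> periodic P w -> 0 < Im t ->
  ctends (fun B => csum (fun j => w (Z.of_nat (S j)) * ce (t / INR P) ^ S j)%C B)
    (csum (fun y => dft P w (Z.of_nat y) * Ccot ((t + ZtoC (Z.of_nat y)) / INR P))%C P
       / (2 * miPi) - csum (fun y => dft P w (Z.of_nat y)) P / 2)%C.
Proof.
  intros HP Hw Ht. assert (RP : 0 < INR P) by (apply lt_0_INR, HP).
  set (x := fun y => ce ((t + ZtoC (Z.of_nat y)) / INR P)%C).
  apply (ctends_ext (fun B => csum (fun y => dft P w (Z.of_nat y)
     * csum (fun j => x y ^ S j) B)%C P)).
  { intros B.
    rewrite (csum_ext _ (fun y => csum (fun j => dft P w (Z.of_nat y) * x y ^ S j)%C B))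
      by (intros; rewrite csum_scal; reflexivity).
    rewrite csum_swap. apply csum_ext. intros j _.
    rewrite (dft_inv P w (Z.of_nat (S j)) HP Hw), Cmult_comm, <- csum_scal.
    apply csum_ext. intros y _. unfold x.
    rewrite ce_split, Cpow_mult_l, er_pow by exact HP.
    rewrite (Z.mul_comm (Z.of_nat y)). ring. }
  replace (csum (fun y => dft P w (Z.of_nat y) * Ccot ((t + ZtoC (Z.of_nat y)) / INR P))%C P
       / (2 * miPi) - csum (fun y => dft P w (Z.of_nat y)) P / 2)%C
    with (csum (fun y => dft P w (Z.of_nat y)
        * (Ccot ((t + ZtoC (Z.of_nat y)) / INR P) / (2 * miPi) - / 2))%C P).
  - apply (ctends_csum (fun B y => dft P w (Z.of_nat y) * csum (fun j => x y ^ S j) B)%C).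
    intros y _. apply ctends_scal. apply geom_Ccot.
    rewrite Im_div_nat, Im_plus_Z by exact HP. apply Rdiv_lt_0_compat; assumption.
  - unfold Cdiv. rewrite (Cmult_comm (csum _ P) (/ (2 * miPi))), (Cmult_comm (csum _ P) (/ 2)).
    rewrite <- !csum_scal, <- csum_minus. apply csum_ext. intros y _. ring.
Qed.

Section invariance.
Variables (n1 n2 s : nat) (chi1 chi2 : Z -> C) (r H : Z) (z z' : C).
Hypotheses (Hn1 : (1 < n1)%nat) (Hn2 : (0 < n2)%nat) (Hs : (0 < s)%nat)
  (Hc1 : primitive_char (Z.of_nat n1) chi1) (Hc2 : primitive_char (Z.of_nat n2) chi2)
  (Hpar : (chi1 (-1)%Z * chi2 (-1)%Z)%C = 1)
  (Hz : 0 < Im z) (Hz' : 0 < Im z').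

Let theta := conjchar chi2.
Let omega (v : C) : C := (INR n2 * (INR s * v - ZtoC r))%C.
Let W (a y : Z) : C := dft (n2 * s) (twist s theta r a) y.

Hypotheses
  (HW0 : forall a, (chi1 a * W a 0%Z)%C = 0)
  (Hshift : forall a y, (chi1 (a + H * y)%Z * W (a + H * y)%Z y)%C = (chi1 a * W a y)%C)
  (Hinv : (/ omega z' = / omega z + ZtoC H)%C).

Lemma Im_omega (v : C) : 0 < Im v -> 0 < Im (omega v).
Proof.
  intros Hv. unfold omega, ZtoC. destruct v as [x y]. simpl in Hv |- *.
  assert (0 < INR n2) by (apply lt_0_INR, Hn2). assert (0 < INR s) by (apply lt_0_INR, Hs).
  ring_simplify. repeat apply Rmult_lt_0_compat; assumption.
Qed.

(** Since [v = r/s + omega v / (n2 s)], the factor [e(a b r / s)] goes into [twist] and the rest is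
    a power of [e(a omega v / (n2 s))]. The constant [- theta 0 / 2] does not depend on [v] and
    cancels in the difference. *)
Lemma inner_at_cusp (v : C) (i : nat) : 0 < Im v ->
  ctends (fun B => csum (fun j => theta (Z.of_nat (S j)) * ce v ^ (S i * S j))%C B)
   (linner (n2 * s) W (omega v) (Z.of_nat (S i)) / (2 * miPi) - theta 0%Z / 2)%C.
Proof.
  intros Hv. assert (Hth := primitive_char_conj _ _ Hc2). fold theta in Hth.
  set (a := Z.of_nat (S i)).
  assert (Ea : ZtoC a = RtoC (INR (S i))) by (unfold ZtoC, a; rewrite <- INR_IZR_INZ; reflexivity).
  assert (HP : (0 < n2 * s)%nat) by nia.
  assert (N2 := RINR_neq_0 n2 Hn2). assert (Ns := RINR_neq_0 s Hs).
  assert (Hav : 0 < Im (ZtoC a * omega v)).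
  { rewrite Ea, im_scal_l. apply Rmult_lt_0_compat; [apply lt_0_INR; lia|apply Im_omega, Hv]. }
  assert (L := periodic_power_sum (n2 * s) (twist s theta r a) _ HP
    (twist_periodic n2 s theta r Hs Hth a) Hav).
  rewrite (dft_twist_total n2 s theta r Hn2 Hs Hth a) in L.
  eapply ctends_ext; [|exact L]. intros B. cbv beta. apply csum_ext. intros j _.
  unfold twist. rewrite <- er_pow, <- Cmult_assoc, <- Cpow_mult_l, Cpow_mult_r.
  f_equal. f_equal. rewrite <- ce_nat_mul. unfold er. rewrite <- ce_plus. f_equal.
  rewrite RtoC_div by (apply not_0_INR; lia).
  rewrite mult_IZR, mult_INR, !RtoC_mult. fold (ZtoC a) (ZtoC r). rewrite Ea.
  unfold omega. field. split; assumption.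
Qed.

Theorem Fseries_invariant :
  CSeries (Fterm chi1 chi2 z') = CSeries (Fterm chi1 chi2 z).
Proof.
  assert (Hth := primitive_char_conj _ _ Hc2). fold theta in Hth.
  assert (HP : (0 < n2 * s)%nat) by nia.
  assert (Hn1' : (0 < n1)%nat) by lia.
  assert (P1 := char_periodic n1 chi1 Hc1).
  destruct (periodic_bounded n1 chi1 Hn1' P1) as (M1 & M1p & B1).
  destruct (periodic_bounded n2 chi2 Hn2 (char_periodic n2 chi2 Hc2)) as (M2 & M2p & B2).
  assert (Bth : forall b, Cmod (theta b) <= M2).
  { intros b. unfold theta, conjchar. rewrite Cmod_conj. apply B2. }
  assert (Hn1r : 0 < INR n1) by (apply lt_0_INR, Hn1').
  (* One constant that bounds [chi1], its partial sums ([n1 * M1]) and [W] ([M2]). *)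
  set (M := M1 + INR n1 * M1 + M2).
  assert (Mp : 0 < INR n1 * M1) by (apply Rmult_lt_0_compat; assumption).
  assert (Hchisum : forall m, Cmod (csum (fun i => chi1 (Z.of_nat (S i))) m) <= M).
  { intros m. rewrite (csum_ext _ (fun i => chi1 (1 + Z.of_nat i)%Z)) by (intros; f_equal; lia).
    eapply Rle_trans; [apply (partial_sum_bound n1 chi1 M1)|unfold M; lra]; try assumption.
    apply char_sum_0; [exact Hn1'|exact Hc1|lia]. }
  assert (Hp : forall a y, (chi1 (- a)%Z * W (- a)%Z (- y)%Z)%C = (chi1 a * W a y)%C).
  { intros a y. unfold W. rewrite dft_twist_opp by assumption.
    assert (Hm : chi1 (- a)%Z = (chi1 (-1)%Z * chi1 a)%C).
    { destruct Hc1 as [(_ & Hm & _) _]. rewrite <- Hm.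
      replace (-1 * a)%Z with (- a)%Z by lia. reflexivity. }
    rewrite Hm. unfold theta at 1, conjchar. destruct Hc2 as [Hd2 _].
    rewrite (char_m1_conj _ _ Hd2).
    transitivity ((chi1 (-1)%Z * chi2 (-1)%Z) * (chi1 a * dft (n2 * s) (twist s theta r a) y))%C;
      [ring|rewrite Hpar; ring]. }
  assert (Hc0 : chi1 0%Z = 0).
  { destruct Hc1 as [(_ & _ & _ & _ & H0) _]. apply H0. rewrite Z.gcd_0_l. lia. }
  assert (BM1 : forall a, Cmod (chi1 a) <= M).
  { intros a. eapply Rle_trans; [apply B1|unfold M; lra]. }
  assert (BMW : forall a y, Cmod (W a y) <= M).
  { intros a y. apply dft_norm; [exact HP|]. intros x. unfold twist.
    rewrite Cmod_mult, Cmod_er, Rmult_1_r. eapply Rle_trans; [apply Bth|unfold M; lra]. }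
  assert (LI := lattice_sum_invariant (n2 * s) chi1 W M (theta 0%Z) HP
    BM1 Hchisum BMW
    (fun a => dft_periodic (n2 * s) _ HP)
    (dft_twist_total n2 s theta r Hn2 Hs Hth) HW0 Hp Hc0
    (omega z) (omega z') H (Im_omega z Hz) (Im_omega z' Hz') Hinv Hshift).
  assert (L1 := Fseries_approx chi1 chi2 M1 M2 z _ B1 B2 Hz (fun i => inner_at_cusp z i Hz)).
  assert (L2 := Fseries_approx chi1 chi2 M1 M2 z' _ B1 B2 Hz' (fun i => inner_at_cusp z' i Hz')).
  assert (L3 := ctends_minus _ _ _ _ L2 L1).
  assert (L4 := ctends_scal (/ (2 * miPi))%C _ _
    (ctends_subseq _ _ S (fun n => le_S _ _ (le_n n)) LI)).
  rewrite Cmult_0_r in L4. apply Ceq_minus. apply (ctends_unique _ _ _ L3).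
  eapply ctends_ext; [|exact L4]. intros A. cbv beta.
  rewrite <- csum_scal, <- csum_minus. apply csum_ext. intros i _.
  unfold Cdiv. ring.
Qed.

End invariance.

(** * Invariance under the parabolic matrix *)

Lemma Im_Cinv (x : C) : Im (/ x)%C = - Im x / (Re x ^ 2 + Im x ^ 2).
Proof. destruct x; reflexivity. Qed.

(** The imaginary part of [1/x] has the sign opposite to that of [x], and a real translation does
    not change it. *)
Lemma Im_pos_of_inv (x y : C) (h : Z) : x <> 0 -> y <> 0 -> 0 < Im x ->
  (/ y = / x + ZtoC h)%C -> 0 < Im y.
Proof.
  intros Nx Ny Hx E.
  assert (P : forall t : C, t <> 0 -> 0 < Re t ^ 2 + Im t ^ 2).
  { intros t Nt. rewrite <- Cmod2_alt. apply pow_lt, Cmod_gt_0, Nt. }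
  apply (f_equal Im) in E. rewrite Im_plus_Z, !Im_Cinv in E.
  specialize (P x Nx) as Px. specialize (P y Ny) as Py.
  assert (Q : 0 < Im x / (Re x ^ 2 + Im x ^ 2)) by (apply Rdiv_lt_0_compat; assumption).
  assert (T : Im y / (Re y ^ 2 + Im y ^ 2) = Im x / (Re x ^ 2 + Im x ^ 2)).
  { unfold Rdiv in *. lra. }
  rewrite <- T in Q. apply Rnot_le_lt. intros L.
  assert (Z0 : Im y / (Re y ^ 2 + Im y ^ 2) <= 0); [|lra].
  unfold Rdiv. assert (0 < / (Re y ^ 2 + Im y ^ 2)) by (apply Rinv_0_lt_compat, Py). nra.
Qed.

(** The constant term of the weight 2 Eisenstein series at the cusp [r/s],
    [s = u R], vanishes termwise; this is where [q2 <> R] enters. *)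
Lemma cusp_constant_term (n1 n2 s : nat) (chi1 theta : Z -> C) (Qd Rd r u a : Z) :
  (0 < n2)%nat -> (0 < s)%nat ->
  dirichlet_char (Z.of_nat n1) chi1 -> primitive_char (Z.of_nat n2) theta ->
  (Rd > 0)%Z -> (Z.of_nat n1 * Z.of_nat n2 = Qd * Rd)%Z -> Z.gcd Qd Rd = 1%Z ->
  Z.of_nat n2 <> Rd -> Z.gcd r Rd = 1%Z -> Z.gcd u Qd = 1%Z -> Z.of_nat s = (u * Rd)%Z ->
  (chi1 a * dft (n2 * s) (twist s theta r a) 0%Z)%C = 0.
Proof.
  intros Hn2 Hs Hc1 Hth HR HN HQR Hne Hr Hu Es.
  destruct (Z.eq_dec (Z.gcd a (Z.of_nat n1)) 1) as [Ga|Ga].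
  2:{ destruct Hc1 as (_ & _ & _ & _ & H0). rewrite (H0 a Ga). ring. }
  destruct (Zdivide_dec (Z.of_nat s) (0 - Z.of_nat n2 * a * r)) as [[l Hl]|D].
  2:{ rewrite dft_twist_0 by assumption. ring. }
  replace 0%Z with (Z.of_nat n2 * a * r + l * Z.of_nat s)%Z at 1 by lia.
  rewrite dft_twist by assumption.
  destruct (Z.eq_dec (Z.gcd l (Z.of_nat n2)) 1) as [Gl|Gl].
  2:{ rewrite dft_primitive_vanish by assumption. ring. }
  (* A nonzero product needs [a] prime to [q1], [0] in the support and [l] prime to [q2]. Together
     these force [q2 = R]. *)
  exfalso. set (q2 := Z.of_nat n2) in *. set (q1 := Z.of_nat n1) in *.
  rewrite Es in Hl.
  assert (Q2 : (0 < q2)%Z) by (unfold q2; lia).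
  assert (D1 : (q2 | u * Rd)%Z).
  { apply Z.gauss with l; [|rewrite Z.gcd_comm; exact Gl].
    exists (- (a * r))%Z. lia. }
  (* As a divisor of [u R], [q2] is prime to [Q]; but it divides [Q R]. *)
  assert (D2 : (q2 | Rd)%Z).
  { apply Z.gauss with Qd; [exists q1; lia|].
    apply Zgcd_1_rel_prime, rel_prime_div with (u * Rd)%Z; [|exact D1].
    apply rel_prime_sym, rel_prime_mult; apply Zgcd_1_rel_prime.
    - rewrite Z.gcd_comm; exact Hu.
    - exact HQR. }
  destruct D2 as [R1 HR1].
  assert (Eq1 : q1 = (Qd * R1)%Z) by nia.
  assert (E : (a * r = - (l * u) * R1)%Z) by nia.
  (* The cofactor [R1 = R / q2] divides [a r] and is prime to [r]. It also divides [q1 = Q R1], to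
     which [a] is prime, so it is 1. *)
  assert (D3 : (R1 | a)%Z).
  { apply Z.gauss with r; [exists (- (l * u))%Z; lia|].
    apply Zgcd_1_rel_prime, rel_prime_div with Rd; [|exists q2; lia].
    apply rel_prime_sym, Zgcd_1_rel_prime. exact Hr. }
  assert (D4 : (R1 | 1)%Z).
  { rewrite <- Ga. apply Z.gcd_greatest; [exact D3|]. exists Qd. exact Eq1. }
  apply Z.divide_1_r in D4. apply Hne. nia.
Qed.

(** The factor [n1] in [H] takes care of [chi1]. For the transform, [n1 n2 u = Q s] supplies the
    divisibility by [s]. *)
Lemma weight_shift (n1 n2 s : nat) (chi1 theta : Z -> C) (Qd Rd r u k sgn a y : Z) :
  (0 < n1)%nat -> (0 < n2)%nat -> (0 < s)%nat ->
  primitive_char (Z.of_nat n1) chi1 -> primitive_char (Z.of_nat n2) theta ->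
  (Z.of_nat n1 * Z.of_nat n2 = Qd * Rd)%Z -> Z.of_nat s = (u * Rd)%Z ->
  let H := (sgn * Z.of_nat n1 * k * u)%Z in
  (chi1 (a + H * y)%Z * dft (n2 * s) (twist s theta r (a + H * y)) y
   = chi1 a * dft (n2 * s) (twist s theta r a) y)%C.
Proof.
  intros Hn1 Hn2 Hs Hc1 Hth HN Es H. f_equal.
  - apply (periodic_cong n1); [apply char_periodic, Hc1|].
    exists (sgn * k * u * y)%Z. unfold H. ring.
  - assert (E : (H * y * r * Z.of_nat n2 = sgn * k * y * r * Qd * Z.of_nat s)%Z).
    { rewrite Es. transitivity (sgn * k * u * y * r * (Z.of_nat n1 * Z.of_nat n2))%Z;
        [unfold H; ring|rewrite HN; ring]. }
    apply dft_twist_shift; try assumption; rewrite E.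
    + exists (sgn * k * y * r * Qd)%Z. ring.
    (* On the support, [y Q = n2 a r Q + l u R Q], and [R Q = n1 n2] exhibits the factor [n2]. *)
    + intros l Hl. exists (sgn * k * r * (a * r * Qd + l * u * Z.of_nat n1))%Z.
      f_equal. transitivity (sgn * k * r * (Z.of_nat n2 * a * r * Qd + l * u * (Qd * Rd)))%Z.
      * rewrite Hl, Es. ring.
      * rewrite <- HN. ring.
Qed.

Lemma Fterm_shift (chi1 chi2 : Z -> C) (z : C) (m : Z) :
  CSeries (Fterm chi1 chi2 (z + ZtoC m)%C) = CSeries (Fterm chi1 chi2 z).
Proof.
  assert (E : forall n, Fterm chi1 chi2 (z + ZtoC m)%C n = Fterm chi1 chi2 z n).
  { intros n. unfold Fterm. f_equal.
    replace (INR (S n) * (z + ZtoC m))%C with (INR (S n) * z + ZtoC (Z.of_nat (S n) * m))%C.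
    - apply ce_shift_Z.
    - unfold ZtoC. rewrite mult_IZR, <- INR_IZR_INZ, RtoC_mult. ring. }
  unfold CSeries. f_equal; apply Series_ext; intros n; rewrite E; reflexivity.
Qed.

Lemma ZtoC_plus (a b : Z) : ZtoC (a + b) = (ZtoC a + ZtoC b)%C.
Proof. unfold ZtoC. rewrite plus_IZR, RtoC_plus. reflexivity. Qed.

Lemma ZtoC_mult (a b : Z) : ZtoC (a * b) = (ZtoC a * ZtoC b)%C.
Proof. unfold ZtoC. rewrite mult_IZR, RtoC_mult. reflexivity. Qed.

Lemma ZtoC_sub (a b : Z) : ZtoC (a - b) = (ZtoC a - ZtoC b)%C.
Proof. unfold ZtoC. rewrite minus_IZR, RtoC_minus. reflexivity. Qed.

Lemma ZtoC_of_nat (n : nat) : ZtoC (Z.of_nat n) = RtoC (INR n).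
Proof. unfold ZtoC. rewrite <- INR_IZR_INZ. reflexivity. Qed.

(** In the coordinate [1 / (s z - r)], [s = u R], the parabolic map fixing the
    cusp [r/s] is a translation. *)
Lemma mobius_parabolic (q1 q2 Qd Rd r u k sgn a b c d : Z) (z : C) :
  (sgn * sgn = 1)%Z -> (0 < q1)%Z -> (0 < q2)%Z -> (0 < u * Rd)%Z -> (q1 * q2 = Qd * Rd)%Z ->
  a = (sgn + q1 * q2 * k * u * r)%Z -> c = (q1 * q2 * Rd * k * u ^ 2)%Z ->
  b = (- (Qd * k * r ^ 2))%Z -> d = (sgn - q1 * q2 * k * u * r)%Z ->
  0 < Im z ->
  let om := fun v => (ZtoC q2 * (ZtoC (u * Rd) * v - ZtoC r))%C in
  om (mobius a b c d z) <> 0 /\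
  (/ om (mobius a b c d z) = / om z + ZtoC (sgn * q1 * k * u))%C.
Proof.
  intros Hsg Hq1 Hq2 Hs HN -> -> -> -> Hz om.
  set (v := (ZtoC (u * Rd) * z - ZtoC r)%C).
  assert (Iv : 0 < Im v).
  { unfold v, ZtoC. destruct z as [x y]. simpl in Hz |- *.
    apply IZR_lt in Hs. ring_simplify. apply Rmult_lt_0_compat; assumption. }
  assert (Nv : v <> 0) by (apply Im_neq_0; lra).
  assert (Nq2 : ZtoC q2 <> 0).
  { intros E. apply RtoC_inj in E. apply eq_IZR in E. lia. }
  assert (NuR : ZtoC (u * Rd) <> 0).
  { intros E. apply RtoC_inj in E. apply eq_IZR in E. lia. }
  assert (S2 : (ZtoC sgn * ZtoC sgn)%C = 1) by (rewrite <- ZtoC_mult, Hsg; reflexivity).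
  assert (Nsg : ZtoC sgn <> 0).
  { intros E. rewrite E, Cmult_0_l in S2. apply RtoC_inj in S2. lra. }
  set (D := (ZtoC sgn + ZtoC (q1 * q2 * k * u) * v)%C).
  assert (ND : D <> 0).
  { destruct (Z.eq_dec k 0) as [->|Nk].
    - unfold D. replace (q1 * q2 * 0 * u)%Z with 0%Z by ring. intros E. apply Nsg.
      rewrite <- E. change (ZtoC 0) with (RtoC 0). ring.
    - apply Im_neq_0. unfold D. rewrite Cplus_comm, Im_plus_Z. unfold ZtoC. rewrite im_scal_l.
      apply Rmult_integral_contrapositive_currified; [|lra].
      apply not_0_IZR. assert (u <> 0)%Z by nia. nia. }
  set (g := (ZtoC (sgn + q1 * q2 * k * u * r) * z + ZtoC (- (Qd * k * r ^ 2)))%C).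
  assert (ED : (ZtoC (q1 * q2 * Rd * k * u ^ 2) * z + ZtoC (sgn - q1 * q2 * k * u * r))%C = D).
  { replace (q1 * q2 * Rd * k * u ^ 2)%Z with (q1 * q2 * k * u * (u * Rd))%Z by ring.
    unfold D, v. rewrite !ZtoC_sub, !ZtoC_mult. ring. }
  (* The column [(r, s)] is an eigenvector with eigenvalue [sgn], so [v] is only multiplied by
     [sgn / D]. *)
  assert (Eg : (ZtoC (u * Rd) * g - ZtoC r * D = ZtoC sgn * v)%C).
  { assert (E : (u * Rd * - (Qd * k * r ^ 2) = - (q1 * q2) * k * u * r * r)%Z)
      by (rewrite HN; ring).
    unfold g. rewrite Cmult_plus_distr_l, <- ZtoC_mult, E. unfold D, v.
    replace (- (q1 * q2) * k * u * r * r)%Z with (0 - q1 * q2 * k * u * r * r)%Z by ring.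
    rewrite !ZtoC_plus, !ZtoC_sub, !ZtoC_mult. change (ZtoC 0) with (RtoC 0). ring. }
  assert (Eom : om (mobius (sgn + q1 * q2 * k * u * r) (- (Qd * k * r ^ 2))
      (q1 * q2 * Rd * k * u ^ 2) (sgn - q1 * q2 * k * u * r) z) = (ZtoC q2 * ZtoC sgn * v / D)%C).
  { unfold om, mobius. rewrite ED. fold g.
    transitivity (ZtoC q2 * (ZtoC (u * Rd) * g - ZtoC r * D) / D)%C; [field; exact ND|].
    rewrite Eg. field. exact ND. }
  rewrite Eom. split.
  { unfold Cdiv. apply Cmult_neq_0.
    - repeat apply Cmult_neq_0; assumption.
    - apply Cmod_gt_0. rewrite Cmod_inv by exact ND.
      apply Rinv_0_lt_compat, Cmod_gt_0, ND. }
  unfold om. fold v.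
  transitivity (D * ZtoC sgn * (/ (ZtoC sgn * ZtoC sgn)) / (ZtoC q2 * v))%C.
  { field. repeat split; assumption. }
  rewrite S2. unfold D.
  transitivity ((ZtoC sgn * ZtoC sgn + ZtoC (q1 * q2 * k * u) * ZtoC sgn * v) / (ZtoC q2 * v))%C.
  { field. split; assumption. }
  rewrite S2, !ZtoC_mult. field. split; assumption.
Qed.

Lemma mobius_translate (a b c d b0 d0 : Z) (z : C) :
  (a * d - b * c = 1)%Z -> (a * d0 - b0 * c = 1)%Z ->
  exists m : Z, mobius a b c d z = mobius a b0 c d0 (z + ZtoC m)%C.
Proof.
  (* This is [b d0 - b0 d], the upper right entry of the inverse of the second matrix times the
     first. *)
  intros E E0. exists ((b - b0) * d - b * (d - d0))%Z.
  set (m := ((b - b0) * d - b * (d - d0))%Z).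
  assert (Eb : (b = b0 + a * m)%Z).
  { assert (F : (a * (d - d0) = c * (b - b0))%Z) by lia.
    enough (b - b0 = a * m)%Z by lia.
    transitivity ((b - b0) * (a * d - b * c))%Z; [rewrite E; ring|].
    transitivity (a * ((b - b0) * d) - b * (c * (b - b0)))%Z; [ring|].
    rewrite <- F. unfold m. ring. }
  assert (Ed : (d = d0 + c * m)%Z).
  { assert (F : (a * (d - d0) = c * (b - b0))%Z) by lia.
    enough (d - d0 = c * m)%Z by lia.
    transitivity ((d - d0) * (a * d - b * c))%Z; [rewrite E; ring|].
    transitivity (d * (a * (d - d0)) - b * c * (d - d0))%Z; [ring|].
    rewrite F. unfold m. ring. }
  unfold mobius. clearbody m. rewrite Eb, Ed, !ZtoC_plus, !ZtoC_mult.
  f_equal; ring.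
Qed.

Lemma Fseries_mobius (q1 q2 : Z) (chi1 chi2 : Z -> C) (Qd Rd r u k sgn a b c d : Z) (z : C) :
  primitive_char q1 chi1 -> primitive_char q2 chi2 ->
  (chi1 (-1)%Z * chi2 (-1)%Z)%C = 1 ->
  (Rd > 0)%Z -> (q1 * q2 = Qd * Rd)%Z -> Z.gcd Qd Rd = 1%Z ->
  q1 <> 1%Z -> q2 <> Rd -> Z.gcd r Rd = 1%Z -> Z.gcd u Qd = 1%Z ->
  (sgn = 1 \/ sgn = -1)%Z -> (0 < u)%Z ->
  (a * d - b * c = 1)%Z ->
  a = (sgn + q1 * q2 * k * u * r)%Z -> c = (q1 * q2 * Rd * k * u ^ 2)%Z ->
  0 < Im z ->
  CSeries (Fterm chi1 chi2 (mobius a b c d z)) = CSeries (Fterm chi1 chi2 z).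
Proof.
  intros Hc1 Hc2 Hpar HR HN HQR Hq1 Hne Hr Hu Hsg Hu0 Hdet Ha Hc Hz.
  assert (P1 : (1 <= q1)%Z) by apply Hc1. assert (P2 : (1 <= q2)%Z) by apply Hc2.
  assert (Hsg2 : (sgn * sgn = 1)%Z) by (destruct Hsg as [-> | ->]; reflexivity).
  (* With [s = u R], the first column is that of [sgn] plus [Q k] times the nilpotent matrix with
     rows [(r s, -r^2)] and [(s^2, -r s)], which kills [(r, s)]. This dictates [b0] and [d0]. *)
  set (b0 := (- (Qd * k * r ^ 2))%Z). set (d0 := (sgn - q1 * q2 * k * u * r)%Z).
  assert (Hdet0 : (a * d0 - b0 * c = 1)%Z).
  { rewrite Ha, Hc. unfold b0, d0. rewrite <- Hsg2.
    transitivity (sgn * sgn - (q1 * q2) ^ 2 * k ^ 2 * u ^ 2 * r ^ 2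
       + (Qd * Rd) * (q1 * q2) * k ^ 2 * u ^ 2 * r ^ 2)%Z; [ring|rewrite <- HN; ring]. }
  destruct (mobius_translate a b c d b0 d0 z Hdet Hdet0) as [m Em].
  rewrite Em, <- (Fterm_shift chi1 chi2 z m).
  assert (Hz1 : 0 < Im (z + ZtoC m)%C) by (rewrite Im_plus_Z; exact Hz).
  set (z1 := (z + ZtoC m)%C) in *.
  assert (Hs : (0 < u * Rd)%Z) by nia.
  destruct (mobius_parabolic q1 q2 Qd Rd r u k sgn a b0 c d0 z1 Hsg2 ltac:(lia) ltac:(lia)
     Hs HN Ha Hc eq_refl eq_refl Hz1) as [Nom Einv]. cbv zeta beta in Nom, Einv.
  set (z' := mobius a b0 c d0 z1) in *.
  set (n1 := Z.to_nat q1). set (n2 := Z.to_nat q2). set (s := Z.to_nat (u * Rd)).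
  assert (E1 : q1 = Z.of_nat n1) by (unfold n1; lia).
  assert (E2 : q2 = Z.of_nat n2) by (unfold n2; lia).
  assert (Es : (u * Rd)%Z = Z.of_nat s) by (unfold s; lia).
  rewrite Es, E2, !ZtoC_of_nat in Nom, Einv.
  assert (Rn2 : 0 < INR n2) by (apply lt_0_INR; lia).
  assert (Rs : 0 < INR s) by (apply lt_0_INR; lia).
  assert (Iom : forall v, Im (INR n2 * (INR s * v - ZtoC r))%C = INR n2 * INR s * Im v).
  { intros v. unfold ZtoC. destruct v as [x y]. simpl. ring. }
  assert (Hz' : 0 < Im z').
  { assert (T := Im_pos_of_inv _ _ _ (Im_neq_0 (INR n2 * (INR s * z1 - ZtoC r))%C
       ltac:(rewrite Iom; apply Rgt_not_eq, Rmult_lt_0_compat; [nra|exact Hz1]))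
       Nom ltac:(rewrite Iom; apply Rmult_lt_0_compat; [nra|exact Hz1]) Einv).
    rewrite Iom in T. assert (0 < INR n2 * INR s) by nra. nra. }
  rewrite E1 in *. rewrite E2 in *.
  apply (Fseries_invariant n1 n2 s chi1 chi2 r (sgn * Z.of_nat n1 * k * u) z1 z'); try lia; try assumption.
  - intros aa. apply (cusp_constant_term n1 n2 s chi1 (conjchar chi2) Qd Rd r u aa); try lia; try assumption.
    + apply Hc1.
    + apply primitive_char_conj, Hc2.
  - intros aa y. apply (weight_shift n1 n2 s chi1 (conjchar chi2) Qd Rd r u k sgn aa y); try lia; try assumption.
    apply primitive_char_conj, Hc2.
Qed.

Theorem theorem1p3 (q1 q2 : Z) (chi1 chi2 : Z -> C) (Qd Rd r u : Z) :
  primitive_char q1 chi1 -> primitive_char q2 chi2 ->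
  Cmult (chi1 (-1)%Z) (chi2 (-1)%Z) = RtoC 1 ->
  (q1 * q2 > 1)%Z ->
  (Qd > 0)%Z -> (Rd > 0)%Z -> (q1 * q2 = Qd * Rd)%Z -> Z.gcd Qd Rd = 1%Z ->
  q1 <> 1%Z -> q2 <> Rd ->
  Z.gcd r Rd = 1%Z -> Z.gcd u Qd = 1%Z ->
  forall (k sgn : Z), (sgn = 1 \/ sgn = -1)%Z ->
  forall a b c d : Z, in_Gamma0 (q1 * q2) a b c d ->
    a = (sgn + q1 * q2 * k * u * r)%Z ->
    c = (q1 * q2 * Rd * k * u ^ 2)%Z ->
    forall z : C, (Im z > 0)%R ->
      dedekindS_at q1 q2 chi1 chi2 a b c d z = RtoC 0.
Proof.
  intros Hc1 Hc2 Hpar Hqq HQ HR HN HQR Hq1 Hne Hr Hu k sgn Hsg a b c d [Hdet _] Ha Hc z Hz.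
  assert (Hz0 : 0 < Im z) by lra.
  assert (P1 : (1 <= q1)%Z) by apply Hc1. assert (P2 : (1 <= q2)%Z) by apply Hc2.
  assert (Hsg2 : (sgn * sgn = 1)%Z) by (destruct Hsg as [-> | ->]; reflexivity).
  assert (Hinv : CSeries (Fterm chi1 chi2 (mobius a b c d z)) = CSeries (Fterm chi1 chi2 z)).
  (* The cusp coordinate requires [s = u R > 0]. The pair [(a, c)] is unchanged under
     [(r,u) -> (-r,-u)], and for [u = 0] the matrix acts as a translation. *)
  { destruct (Z.lt_trichotomy u 0) as [U|[U|U]].
    - apply (Fseries_mobius q1 q2 chi1 chi2 Qd Rd (- r) (- u) k sgn a b c d z); try assumption.
      + rewrite Z.gcd_opp_l. exact Hr.
      + rewrite Z.gcd_opp_l. exact Hu.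
      + lia.
      + rewrite Ha. ring.
      + rewrite Hc. ring.
    - rewrite U in Ha, Hc.
      replace (mobius a b c d z) with (z + ZtoC (sgn * b))%C; [apply Fterm_shift|].
      assert (Ha' : a = sgn) by (rewrite Ha; ring).
      assert (Hc' : c = 0%Z) by (rewrite Hc; ring).
      assert (Hd' : d = sgn).
      { transitivity (sgn * (a * d - b * c))%Z; [|rewrite Hdet; ring].
        rewrite Ha', Hc'. transitivity (sgn * sgn * d)%Z; [rewrite Hsg2|]; ring. }
      rewrite Ha', Hc', Hd'. unfold mobius.
      assert (S2 : (ZtoC sgn * ZtoC sgn)%C = 1) by (rewrite <- ZtoC_mult, Hsg2; reflexivity).
      assert (Nsg : ZtoC sgn <> 0).
      { intros E. rewrite E, Cmult_0_l in S2. apply RtoC_inj in S2. lra. }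
      change (ZtoC 0) with (RtoC 0). rewrite ZtoC_mult.
      transitivity ((ZtoC sgn * z + (ZtoC sgn * ZtoC sgn) * ZtoC b) / ZtoC sgn)%C.
      + field. exact Nsg.
      + rewrite S2. field. exact Nsg.
    - apply (Fseries_mobius q1 q2 chi1 chi2 Qd Rd r u k sgn a b c d z); assumption. }
  (* Modulo [N] the determinant reads [sgn * d = 1], so [d] is congruent to [sgn] and [psi] takes
     the value [chi1 chi2 (sgn) = 1]. *)
  assert (Hd : (d - sgn = - sgn * (k * u * r * d - b * Rd * k * u ^ 2) * (q1 * q2))%Z).
  { transitivity (d * (sgn * sgn) - sgn * (a * d - b * c))%Z; [rewrite Hsg2, Hdet; ring|].
    rewrite Ha, Hc. ring. }
  assert (Hper : forall q chi e, primitive_char q chi -> (d - sgn = e * q)%Z -> chi d = chi sgn).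
  { intros q chi e Hp E. assert (Q : (1 <= q)%Z) by apply Hp.
    apply (periodic_cong (Z.to_nat q)).
    - intros x. rewrite Z2Nat.id by lia. apply Hp.
    - rewrite Z2Nat.id by lia. exists e. exact E. }
  assert (Hpsi : psi chi1 chi2 d = RtoC 1).
  { unfold psi.
    rewrite (Hper q1 chi1 (- sgn * (k * u * r * d - b * Rd * k * u ^ 2) * q2)%Z Hc1 ltac:(rewrite Hd; ring)).
    rewrite (Hper q2 chi2 (- sgn * (k * u * r * d - b * Rd * k * u ^ 2) * q1)%Z Hc2 ltac:(rewrite Hd; ring)).
    destruct Hc1 as [D1 _], Hc2 as [D2 _]. destruct Hsg as [-> | ->].
    - rewrite (char_1 _ _ D1), (char_1 _ _ D2), Cconj_R. ring.
    - rewrite (char_m1_conj _ _ D2). exact Hpar. }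
  unfold dedekindS_at, phi_at. rewrite Hpsi.
  (* The linear term is absent because [q1 <> 1], and the constant term cancels because
     [psi = 1]. *)
  assert (EF : forall v, Ffun q1 q2 chi1 chi2 v = (coef0 q2 chi1 + CSeries (Fterm chi1 chi2 v))%C).
  { intros v. unfold Ffun, coef1. rewrite (proj2 (Z.eqb_neq _ _) Hq1).
    change (CSeries _) with (CSeries (Fterm chi1 chi2 v)). ring. }
  rewrite !EF, Hinv. ring.
Qed.
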